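(* Let $Q=(-a_1,a_1)\times\dots\times(-a_d,a_d)\subset\mathbb{R}^d$, $a_1,\dots,a_d>0$, $d\geq2$, be a hyperrectangle and suppose that $\alpha\to\infty$ in a sector of the form $T_\varphi^-$ for some $\varphi\in(0,\pi/2)$. Then for each $j=1,\dots,d-1$ there are infinitely many divergent eigenvalues $\lambda(\alpha)$ of the Robin Laplacian $-\Delta_Q^\alpha$ whose leading term asymptotics reads $\lambda(\alpha)\sim-j\alpha^2$, and $2^d$ eigenvalues which behave like $\lambda(\alpha)\sim-d\alpha^2$.
   Context: The Robin Laplacian $-\Delta_Q^\alpha$ is the operator on $L^2(Q)$ associated with the form $a_\alpha[u,v]=\int_Q\nabla u\cdot\overline{\nabla v}\,\mathrm{d}x+\int_{\partial Q}\alpha u\overline{v}\,\mathrm{d}\sigma$ on $H^1(Q)$, i.e. the Laplacian with boundary condition $\frac{\partial u}{\partial\nu}+\alpha u=0$ on $\partial Q$, $\nu$ the outer unit normal. $T_\varphi^-:=-\{z\in\mathbb{C}:|\arg z|<\varphi\}$. Eigenvalues are considered as families (curves) $\lambda(\alpha)$, counted with multiplicity; divergent means $|\lambda(\alpha)|\to\infty$; $\lambda(\alpha)\sim c\,\alpha^2$ means $\lambda(\alpha)/(c\,\alpha^2)\to1$ as $\alpha\to\infty$ in $T_\varphi^-$. *)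

(* Defs.v *)
From HB Require Import structures.
From mathcomp Require Import all_boot all_order all_algebra complex.
From mathcomp Require Import all_classical all_reals all_analysis.
Set Implicit Arguments.
Unset Strict Implicit.
Unset Printing Implicit Defensive.
Import Order.TTheory GRing.Theory Num.Theory.
Import numFieldNormedType.Exports.
Local Open Scope classical_set_scope.
Local Open Scope ring_scope.

(* Product sigma-algebra (generated by the coordinates) on row vectors; the
   library provides it for tuples only. *)
Definition measure_rV_display : measure_display -> measure_display.
Proof. exact. Qed.

Section measurable_rV.
Context {d} {T : measurableType d}.
Variable n : nat.

Let coords : 'I_n -> 'rV[T]_n -> T := fun i x => x ord0 i.

Let rV_set0 : g_sigma_preimage coords set0.
Proof. exact: sigma_algebra0. Qed.

Let rV_setC A : g_sigma_preimage coords A -> g_sigma_preimage coords (~` A).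
Proof. exact: sigma_algebraC. Qed.

Let rV_bigcup (F : _^nat) : (forall i, g_sigma_preimage coords (F i)) ->
  g_sigma_preimage coords (\bigcup_i (F i)).
Proof. exact: sigma_algebra_bigcup. Qed.

HB.instance Definition _ := @isMeasurable.Build (measure_rV_display d)
  'rV[T]_n (g_sigma_preimage coords) rV_set0 rV_setC rV_bigcup.

End measurable_rV.

Lemma measurable_coord d (T : measurableType d) n (i : 'I_n) :
  measurable_fun [set: 'rV[T]_n] (fun x : 'rV[T]_n => x ord0 i).
Proof.
move=> _ Y mY; rewrite setTI; apply: sub_sigma_algebra => /=.
rewrite -bigcup_seq/=; exists i => /=; first by rewrite mem_index_enum.
by exists Y => //; rewrite setTI.
Qed.

Lemma measurable_fun_coordP d1 d2 (T1 : measurableType d1)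
    (T2 : measurableType d2) n (f : T1 -> 'rV[T2]_n) :
  (forall i, measurable_fun [set: T1] (fun x => f x ord0 i)) ->
  measurable_fun [set: T1] f.
Proof.
move=> mf.
suff : g_sigma_preimage (fun i => (fun x : 'rV[T2]_n => x ord0 i) \o f)
    `<=` measurable.
  rewrite g_sigma_preimage_comp => prefS _ A mA.
  by apply: prefS; exists A.
apply: smallest_sub; first exact: sigma_algebra_measurable.
case: n => [|n] in f mf *; first by rewrite big_ord0.
rewrite -bigcup_mkord_ord; apply: bigcup_sub => i Ii.
by move=> A [B mB <-]; exact: mf.
Qed.

Section lebesgue_measure_rV.
Variable R : realType.

Definition rV_cons n (p : R * 'rV[R]_n) : 'rV[R]_n.+1 :=
  \row_j if unlift ord0 j is Some k then p.2 ord0 k else p.1.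

Definition rV_uncons n (x : 'rV[R]_n.+1) : R * 'rV[R]_n :=
  (x ord0 ord0, \row_k x ord0 (lift ord0 k)).

Lemma rV_uncons_consK n : cancel (@rV_cons n) (@rV_uncons n).
Proof.
case=> r y; rewrite /rV_uncons; congr pair; first by rewrite mxE unlift_none.
by apply/rowP => k; rewrite !mxE liftK.
Qed.

Lemma rV_cons_unconsK n : cancel (@rV_uncons n) (@rV_cons n).
Proof.
move=> x; apply/rowP => j; rewrite mxE /=.
by case: unliftP => [k|] ->; rewrite ?mxE.
Qed.

Lemma measurable_rV_cons n : measurable_fun setT (@rV_cons n).
Proof.
apply: measurable_fun_coordP => i.
case: (unliftP ord0 i) => [k|] ->.
  rewrite (_ : (fun x => _) = (fun y : 'rV[R]_n => y ord0 k) \o snd).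
    apply: measurableT_comp; last exact: measurable_snd.
    exact: measurable_coord.
  by apply/funext => x; rewrite mxE liftK.
rewrite (_ : (fun x => _) = fst); first exact: measurable_fst.
by apply/funext => x; rewrite mxE unlift_none.
Qed.

Lemma measurable_rV_uncons n : measurable_fun setT (@rV_uncons n).
Proof.
apply/measurable_fun_pair; first exact: measurable_coord.
apply: measurable_fun_coordP => i; rewrite (_ : (fun x => _) =
    (fun x : 'rV[R]_n.+1 => x ord0 (lift ord0 i))).
  exact: measurable_coord.
by apply/funext => x; rewrite mxE.
Qed.

Section step.
Variables (n : nat) (mu : {sigma_finite_measure set 'rV[R]_n -> \bar R}).

Definition rV_cons_measure : set 'rV[R]_n.+1 -> \bar R :=
  pushforward (@lebesgue_measure R \x mu)%E (@rV_cons n).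

Let mu' : {measure set 'rV[R]_n.+1 -> \bar R} :=
  measure_function_pushforward__canonical__measure_function_Measure
    ((@lebesgue_measure R \x mu)%E :
      {measure set (measurableTypeR R * 'rV[R]_n)%type -> \bar R})
    (@measurable_rV_cons n).

HB.instance Definition _ := Measure.copy rV_cons_measure mu'.

Let sigma_finite_rV_cons : sigma_finite setT rV_cons_measure.
Proof.
have /sigma_finiteP[F [TF ndF Foo]] := sigma_finiteT (@lebesgue_measure R).
have /sigma_finiteP[G [TG ndG Goo]] := sigma_finiteT mu.
exists (fun k => @rV_uncons n @^-1` (F k `*` G k)).
  rewrite -preimage_bigcup (_ : \bigcup_k _ = setT) ?preimage_setT//.
  apply/seteqP; split => // -[x y] _.
  have [p _ Fpx] : (\bigcup_k F k) x by rewrite -TF.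
  have [q _ Gqy] : (\bigcup_k G k) y by rewrite -TG.
  exists (maxn p q) => //; split => /=.
  - by move: x Fpx; exact/subsetPset/ndF/leq_maxl.
  - by move: y Gqy; exact/subsetPset/ndG/leq_maxr.
move=> k; have [mF Fk] := Foo k; have [mG Gk] := Goo k; split.
  rewrite -[X in measurable X]setTI.
  by apply: measurable_rV_uncons => //; exact: measurableX.
rewrite /rV_cons_measure /pushforward -comp_preimage.
rewrite (_ : _ \o _ = id); last exact/funext/rV_uncons_consK.
by rewrite preimage_id product_measure1E// lte_mul_pinfty// ge0_fin_numE.
Qed.

HB.instance Definition _ := @Measure_isSigmaFinite.Build _ _ _
  rV_cons_measure sigma_finite_rV_cons.

End step.

(* d-dimensional Lebesgue measure: a point mass for d = 0, and
   dx_0 (x) (dx_1 ... dx_n) for d = n.+1. *)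
Fixpoint lebesgue_rV n : {sigma_finite_measure set 'rV[R]_n -> \bar R} :=
  match n with
  | 0 => @dirac _ _ (0 : 'rV[R]_0) R
  | m.+1 => rV_cons_measure (lebesgue_rV m)
  end.

End lebesgue_measure_rV.

(* R[i] with the type on which the topology of numeric fields is inferred. *)
Definition Cplx (R : realType) : numFieldType := R[i]%C.

Section hyperrectangle.
Variable R : realType.
Local Notation C := (Cplx R).

Definition Cre (z : C) : R := complex.Re z.
Definition Cim (z : C) : R := complex.Im z.
Definition Cmk (x y : R) : C := (x +i* y)%C.
Definition Cmod (z : C) : R := Normc.normc (z : R[i]%C).
Definition Cconj (z : C) : C := conjc (z : R[i]%C).

Section L2.
Variable n : nat.
Implicit Types (D : set 'rV[R]_n) (f : 'rV[R]_n -> C).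

Definition cint D f : C :=
  Cmk (Rintegral (lebesgue_rV R n) D (Cre \o f))
      (Rintegral (lebesgue_rV R n) D (Cim \o f)).

Definition sqnorm D f : \bar R :=
  (\int[lebesgue_rV R n]_(x in D) ((Cmod (f x)) ^+ 2)%:E)%E.

Definition L2 D f : Prop :=
  [/\ measurable_fun D (Cre \o f), measurable_fun D (Cim \o f) &
      (sqnorm D f < +oo)%E].

Definition L2_cvg D (fs : nat -> 'rV[R]_n -> C) f : Prop :=
  sqnorm D (fun x => fs k x - f x) @[k --> \oo] --> 0%E.

Definition dir (i : 'I_n) : 'rV[R]_n := delta_mx ord0 i.

Fixpoint Ck (k : nat) (f : 'rV[R]_n -> R) : Prop :=
  continuous f /\
  match k with
  | 0 => True
  | l.+1 => forall i, (forall x, derivable f x (dir i)) /\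
                      Ck l (fun x => 'D_(dir i) f x)
  end.

Definition C1 f : Prop := Ck 1 (Cre \o f) /\ Ck 1 (Cim \o f).

Definition cpartial (i : 'I_n) f (x : 'rV[R]_n) : C :=
  Cmk ('D_(dir i) (Cre \o f) x) ('D_(dir i) (Cim \o f) x).

(* C_c^oo(D) for an open set D *)
Definition test_function D (phi : 'rV[R]_n -> R) : Prop :=
  (forall k, Ck k phi) /\
  exists2 K : set 'rV[R]_n, compact K /\ K `<=` D &
    forall x, ~ K x -> phi x = 0.

Definition weak_partial D (i : 'I_n) f (g : 'rV[R]_n -> C) : Prop :=
  forall phi, test_function D phi ->
    cint D (fun x => f x * Cmk ('D_(dir i) phi x) 0) =
    - cint D (fun x => g x * Cmk (phi x) 0).

(* f lies in H^1(D) and has weak gradient (g_i)_i *)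
Definition H1 D f (g : 'I_n -> 'rV[R]_n -> C) : Prop :=
  L2 D f /\ forall i, L2 D (g i) /\ weak_partial D i f (g i).

End L2.

Section robin.
Variables (d : nat) (a : 'I_d -> R).

Definition box : set 'rV[R]_d := [set x | forall i, - a i < x ord0 i < a i].

(* The face {x_i = a_i} (s = true) or {x_i = - a_i} (s = false) of the box is
   parametrized by the remaining d - 1 coordinates. *)
Definition face_domain (i : 'I_d) : set 'rV[R]_d.-1 :=
  [set y | forall k, - a (lift i k) < y ord0 k < a (lift i k)].

Definition face_point (i : 'I_d) (s : bool) (y : 'rV[R]_d.-1) : 'rV[R]_d :=
  \row_j if unlift i j is Some k then y ord0 k else if s then a i else - a i.

(* integral over the boundary; edges of dimension < d - 1 have measure zero *)
Definition bint (f : 'rV[R]_d -> C) : C :=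
  \sum_(i < d) \sum_(s : bool) cint (face_domain i) (f \o face_point i s).

(* t, a function on the boundary, is the trace of the H^1 function u with
   weak gradient g: the limit in L^2 of the boundary values of C^1 functions on
   the closed box which converge to u in H^1. Every H^1 function on the box has
   such a trace, unique up to null sets. *)
Definition trace (u : 'rV[R]_d -> C) (g : 'I_d -> 'rV[R]_d -> C)
    (t : 'rV[R]_d -> C) : Prop :=
  (forall i s, L2 (face_domain i) (t \o face_point i s)) /\
  exists phi : nat -> 'rV[R]_d -> C,
    [/\ forall k, C1 (phi k),
        L2_cvg box phi u,
        forall i, L2_cvg box (fun k => cpartial i (phi k)) (g i) &
        forall i s, L2_cvg (face_domain i)
          (fun k => phi k \o face_point i s) (t \o face_point i s)].

(* a_alpha[u,v], in terms of the weak gradients and traces of u and v *)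
Definition robin_form (alpha : C)
    (gu : 'I_d -> 'rV[R]_d -> C) (tu : 'rV[R]_d -> C)
    (gv : 'I_d -> 'rV[R]_d -> C) (tv : 'rV[R]_d -> C) : C :=
  cint box (fun x => \sum_(i < d) gu i x * Cconj (gv i x)) +
  bint (fun x => alpha * tu x * Cconj (tv x)).

(* Graph of the operator associated with a_alpha: u belongs to the domain of
   the Robin Laplacian and is mapped to f. *)
Definition robin_laplacian (alpha : C) (u f : 'rV[R]_d -> C) : Prop :=
  L2 box f /\
  exists gu tu, [/\ H1 box u gu, trace u gu tu &
    forall v gv tv, H1 box v gv -> trace v gv tv ->
      robin_form alpha gu tu gv tv = cint box (fun x => f x * Cconj (v x))].

Definition ae_zero (u : 'rV[R]_d -> C) : Prop :=
  {ae lebesgue_rV R d, forall x, box x -> u x = 0}.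

Definition eigenvalue (alpha z : C) : Prop :=
  exists2 u, ~ ae_zero u & robin_laplacian alpha u (fun x => z * u x).

(* u belongs to the kernel of (A - z)^k, A the Robin Laplacian *)
Fixpoint root_vector (alpha z : C) (k : nat) (u : 'rV[R]_d -> C) : Prop :=
  match k with
  | 0 => ae_zero u
  | l.+1 => exists2 w, robin_laplacian alpha u (fun x => z * u x + w x) &
                       root_vector alpha z l w
  end.

(* the algebraic multiplicity of z is at least m *)
Definition multiplicity_ge (alpha z : C) (m : nat) : Prop :=
  exists2 u : 'I_m -> 'rV[R]_d -> C,
    forall i, exists k, root_vector alpha z k (u i) &
    forall c : 'I_m -> C,
      ae_zero (fun x => \sum_(i < m) c i * u i x) -> forall i, c i = 0.

(* s lists n eigenvalues, each repeated at most as often as its multiplicity *)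
Definition eigenvalue_list (alpha : C) (n : nat) (s : 'I_n -> C) : Prop :=
  (forall i, eigenvalue alpha (s i)) /\
  forall z, multiplicity_ge alpha z #|[pred i | s i == z]|.

End robin.

(* T_phi^- = - {z : |arg z| < phi} *)
Definition sector (phi : R) : set C :=
  [set z | exists r theta : R,
     [/\ 0 < r, `|theta| < phi & z = - Cmk (r * cos theta) (r * sin theta)]].

Definition sector_tail (phi M : R) : set C :=
  [set z | sector phi z /\ M < Cmod z].

(* the filter "alpha -> oo in T_phi^-" *)
Definition sector_infty (phi : R) : set_system C :=
  filter_from [set: R] (sector_tail phi).

(* n curves of eigenvalues, counted with multiplicity, defined for all large
   alpha in the sector *)
Definition eigencurves (d : nat) (a : 'I_d -> R) (phi : R) (n : nat)
    (lambda : 'I_n -> C -> C) : Prop :=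
  exists M : R,
    (forall alpha, sector_tail phi M alpha ->
       eigenvalue_list a alpha (fun i => lambda i alpha)) /\
    (forall i, {within sector_tail phi M, continuous (lambda i)}).

Definition divergent (phi : R) (lambda : C -> C) : Prop :=
  Cmod (lambda alpha) @[alpha --> sector_infty phi] --> +oo.

Definition asymptotic_sq (phi : R) (c : C) (lambda : C -> C) : Prop :=
  lambda alpha / (c * alpha ^+ 2) @[alpha --> sector_infty phi] --> (1 : C).

End hyperrectangle.

(* Main.v *)
(** Upper bound. It is enough to look at one large real t = - alpha. Then the
    operator is symmetric, so its root vectors are eigenvectors and distinct
    eigenvalues have orthogonal eigenvectors. On (-a, a) one has
      t (f(a)^2 + f(-a)^2) <= int f'^2 + K t^2 (<f, e_1>^2 + <f, e_2>^2),
    where e_1, e_2 are the normalized exponentials exp (- t (a -+ x)) cut off to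
    the two half-intervals, and K -> 1. The orthogonal projections onto
    span (e_1, e_2) in the various coordinates commute, hence
      Re a_alpha[u, u] >= - K t^2 ((d - 1) |u|^2 + sum_Psi |<u, Psi>|^2),
    Psi running over the 2^d tensor products of the e's. More than 2^d
    eigenvalues below - (d - 1/4) t^2 would give a combination of eigenvectors
    orthogonal to all the Psi, a contradiction.

    Existence. With kappa = - alpha, the function prod_i (exp (k_i x_i) + s_i
    exp (- k_i x_i)), s_i = 1 or -1, is an eigenfunction for - sum_i k_i^2 when
    (k_i - kappa) exp (k_i a_i) = s_i (k_i + kappa) exp (- k_i a_i). Contractions
    produce a root k = kappa + o(1) for each sign, and for s_i = 1 a bounded root
    close to i (m + 1/2) pi / a_i for each m. Roots of the first kind in j
    coordinates and of the second kind in the others, m being free in the last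
    one, give - j alpha^2; the 2^d choices of signs give - d alpha^2, and these
    eigenfunctions are independent because of their parities. *)

(* The number of curves does not depend on [alpha], which is why one real value decides the upper
   bound although the operator is not symmetric for nonreal [alpha] and multiplicities are
   algebraic. The two exponentials of an interval are cut off so that they are exactly orthonormal;
   the coordinate projections P_i are then honest commuting projections, and sum P_i <= (d - 1) +
   prod P_i, where the product has rank at most 2^d. This is the origin of the factor d - 1; any
   level strictly between d - 1 and d could replace d - 1/4. Traces are L^2 limits of boundary
   values of C^1 functions, so the lower bound is proved for C^1 functions by slicing and then
   passed to the limit.

   Curves must be continuous, so the fixed points come with a Lipschitz bound in the parameter.
   Different curves may meet, and a list of eigenvalues calls for independence inside each class of
   equal values. For j < d the values are pairwise distinct, because the bounded roots lie in
   disjoint discs; for j = d coincidences may occur, e.g. for a cube, and the values at the 2^d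
   points with coordinates a_i/2 or - a_i/2 separate the eigenfunctions. *)
Require Import Defs.
From HB Require Import structures.
From mathcomp Require Import all_boot all_order all_algebra complex.
From mathcomp Require Import all_classical all_reals all_analysis.
From mathcomp Require Import measurable_realfun measurable_fun_approximation.
From mathcomp Require Import ring lra.
Set Implicit Arguments.
Unset Strict Implicit.
Unset Printing Implicit Defensive.
Import Order.TTheory GRing.Theory Num.Theory.
Import numFieldNormedType.Exports.
Local Open Scope classical_set_scope.
Local Open Scope ring_scope.

(** * Coordinates and Lebesgue measure *)

Section coordinates.
Variable R : realType.

(** [lebesgue_rV] singles out coordinate zero, whereas faces and slices need an arbitrary one. The
    body is that of [face_point] with the inserted value left free, so [face_pointE] holds by
    computation. *)
Definition rV_ins n (i : 'I_n.+1) (p : R * 'rV[R]_n) : 'rV[R]_n.+1 :=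
  \row_j if unlift i j is Some k then p.2 ord0 k else p.1.

Lemma rV_ins_eq n (i : 'I_n.+1) p : rV_ins i p ord0 i = p.1.
Proof. by rewrite mxE unlift_none. Qed.

Lemma rV_ins_lift n (i : 'I_n.+1) k p : rV_ins i p ord0 (lift i k) = p.2 ord0 k.
Proof. by rewrite mxE liftK. Qed.

Lemma measurable_rV_ins n (i : 'I_n.+1) : measurable_fun setT (@rV_ins n i).
Proof.
apply: measurable_fun_coordP => j.
case: (unliftP i j) => [k|] ->.
  rewrite (_ : (fun x => _) = (fun y : 'rV[R]_n => y ord0 k) \o snd).
    apply: measurableT_comp; last exact: measurable_snd.
    exact: measurable_coord.
  by apply/funext => x; rewrite rV_ins_lift.
rewrite (_ : (fun x => _) = fst); first exact: measurable_fst.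
by apply/funext => x; rewrite rV_ins_eq.
Qed.

Lemma rV_ins0 n : @rV_ins n ord0 = @rV_cons R n.
Proof. by []. Qed.

Lemma lift_lift0 n (i : 'I_n.+1) (k : 'I_n) :
  lift (lift ord0 i) (lift ord0 k) = lift ord0 (lift i k) :> 'I_n.+2.
Proof. by apply: val_inj; rewrite /= /bump !add1n ltnS; case: (i <= k)%N. Qed.

Lemma lift_lift00 n (i : 'I_n.+1) : lift (lift ord0 i) ord0 = ord0 :> 'I_n.+2.
Proof. exact: val_inj. Qed.

Lemma rV_ins_cons n (i : 'I_n.+1) t s (y : 'rV[R]_n) :
  rV_ins (lift ord0 i) (t, rV_cons (s, y)) = rV_cons (s, rV_ins i (t, y)).
Proof.
apply/rowP => j; case: (unliftP ord0 j) => [k|] ->.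
  rewrite -!rV_ins0 [RHS]rV_ins_lift/=.
  case: (unliftP i k) => [l|] ->; last by rewrite !rV_ins_eq.
  by rewrite -lift_lift0 rV_ins_lift/= !rV_ins_lift.
have := rV_ins_lift (lift ord0 i) ord0 (t, rV_cons (s, y)).
by rewrite lift_lift00 => ->; rewrite -!rV_ins0 !rV_ins_eq.
Qed.

Lemma lebesgue_rV_cons n (A : set 'rV[R]_n.+1) : measurable A ->
  lebesgue_rV R n.+1 A =
  (\int[@lebesgue_measure R]_t lebesgue_rV R n [set y | A (rV_cons (t, y))])%E.
Proof.
move=> mA /=; rewrite /rV_cons_measure /pushforward /= /product_measure1.
by apply: eq_integral => t _; rewrite /= xsectionE.
Qed.

Lemma lebesgue_rV0 (A : set 'rV[R]_0) : A 0 -> lebesgue_rV R 0 A = 1%E.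
Proof. by move=> A0; rewrite /= diracE mem_set. Qed.

Opaque lebesgue_rV.

Lemma exchange_sections d1 d2 d3 (T1 : measurableType d1) (T2 : measurableType d2)
    (T3 : measurableType d3) (m1 : {sigma_finite_measure set T1 -> \bar R})
    (m2 : {sigma_finite_measure set T2 -> \bar R})
    (m3 : {sigma_finite_measure set T3 -> \bar R}) (S : set (T1 * T2 * T3)) :
  measurable S ->
  (\int[m1]_s \int[m2]_t m3 [set y | S (s, t, y)] =
   \int[m2]_t \int[m1]_s m3 [set y | S (s, t, y)])%E.
Proof.
move=> mS; pose f (p : T1 * T2) := m3 (xsection S p).
have mf : measurable_fun setT f by exact: measurable_fun_xsection.
have f0 p : (0 <= f p)%E by exact: measure_ge0.
have fE s t : f (s, t) = m3 [set y | S (s, t, y)] by rewrite /f xsectionE.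
transitivity (\int[m1]_s \int[m2]_t f (s, t))%E.
  by apply: eq_integral => s _; apply: eq_integral => t _; rewrite fE.
rewrite fubini_tonelli//.
by apply: eq_integral => s _; apply: eq_integral => t _; rewrite fE.
Qed.

(** Induction on the dimension: for [i] above zero, coordinate zero is split off first, the
    induction hypothesis splits off [i] from the rest, and Tonelli exchanges the two outer
    integrals. *)
Lemma lebesgue_rV_ins n (i : 'I_n.+1) (A : set 'rV[R]_n.+1) : measurable A ->
  lebesgue_rV R n.+1 A =
  (\int[@lebesgue_measure R]_t lebesgue_rV R n [set y | A (rV_ins i (t, y))])%E.
Proof.
elim: n i A => [|n IH] i A mA.
  by rewrite (ord1 i) rV_ins0; exact: lebesgue_rV_cons.
case: (unliftP ord0 i) => [k|] ->; last by rewrite rV_ins0; exact: lebesgue_rV_cons.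
have msec m (j : 'I_m.+1) B t : measurable B -> measurable [set y | B (@rV_ins m j (t, y))].
  move=> mB; rewrite -[X in measurable X]setTI.
  by apply: (measurableT_comp (@measurable_rV_ins m j)) => //; exact: measurable_pair1.
pose S := [set q : (R * R) * 'rV[R]_n | A (rV_cons (q.1.1, rV_ins k (q.1.2, q.2)))].
have mS : measurable S.
  rewrite -[X in measurable X]setTI.
  have : measurable_fun setT (fun q : (R * R) * 'rV[R]_n =>
     rV_cons (q.1.1, rV_ins k (q.1.2, q.2))).
    apply: measurableT_comp; first exact: measurable_rV_cons.
    apply/measurable_fun_pair => /=.
      by apply: measurableT_comp => //; exact: measurable_fst.
    apply: measurableT_comp; first exact: measurable_rV_ins.
    apply/measurable_fun_pair => /=; last exact: measurable_snd.
    by apply: measurableT_comp => //; exact: measurable_snd.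
  by apply.
apply: (etrans (lebesgue_rV_cons mA)).
transitivity (\int[@lebesgue_measure R]_s \int[@lebesgue_measure R]_t
    lebesgue_rV R n [set y | S (s, t, y)])%E.
  apply: eq_integral => s _; apply: (IH k).
  exact: (msec _ ord0).
apply: (etrans (exchange_sections (@lebesgue_measure R) (@lebesgue_measure R)
  (lebesgue_rV R n) (S := S) mS)).
apply: eq_integral => t _.
apply/esym/(etrans (lebesgue_rV_cons (msec _ (lift ord0 k) _ t mA))).
apply: eq_integral => s _; congr (lebesgue_rV R n _).
by apply/seteqP; split => y; rewrite /S /= rV_ins_cons.
Qed.

End coordinates.

(** * Bounded measurable functions and Fubini's theorem *)

Section bounded_measurable.
Variable R : realType.

(** A class closed under products, substitution and partial integration over sets of finite measure,
    and integrable on such sets, so that Fubini never raises an integrability question. The bound is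
    global; this is why continuous functions are cut off to the box below. *)
Definition bounded_measurable d (T : measurableType d) (f : T -> R) : Prop :=
  measurable_fun setT f /\ exists M, forall x, `|f x| <= M.

Section one_type.
Context d (T : measurableType d).
Implicit Types f g : T -> R.
Local Notation bmf := (@bounded_measurable d T).

Lemma bmf_cst r : bmf (fun=> r).
Proof. by split => //; exists `|r|. Qed.

Lemma bmfD f g : bmf f -> bmf g -> bmf (fun x => f x + g x).
Proof.
move=> [mf [M fM]] [mg [N gN]]; split; first exact: measurable_funD.
by exists (M + N) => x; rewrite (le_trans (ler_normD _ _))// lerD.
Qed.

Lemma bmfM f g : bmf f -> bmf g -> bmf (fun x => f x * g x).
Proof.
move=> [mf [M fM]] [mg [N gN]]; split; first exact: measurable_funM.
by exists (M * N) => x; rewrite normrM ler_pM.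
Qed.

Lemma bmfZ r f : bmf f -> bmf (fun x => r * f x).
Proof. by move=> bf; apply: bmfM => //; exact: bmf_cst. Qed.

Lemma bmfB f g : bmf f -> bmf g -> bmf (fun x => f x - g x).
Proof.
move=> bf bg; apply: bmfD => //.
by under eq_fun do rewrite -mulN1r; exact: bmfZ.
Qed.

Lemma bmf_comp d' (U : measurableType d') (h : U -> T) f :
  measurable_fun setT h -> bmf f -> bounded_measurable (f \o h).
Proof.
move=> mh [mf [M fM]]; split; first exact: measurableT_comp.
by exists M => x /=.
Qed.

Section integral.
Variables (mu : {measure set T -> \bar R}) (D : set T).
Hypotheses (mD : measurable D) (muD : (mu D < +oo)%E).

Lemma integrable_cst_lty r : mu.-integrable D (EFin \o cst r).
Proof.
apply/integrableP; split; first exact/measurable_EFinP/measurable_cst.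
rewrite (eq_integral (cst `|r|%:E))// integral_cst//.
by rewrite lte_mul_pinfty.
Qed.

Lemma bmf_integrable f : bmf f -> mu.-integrable D (EFin \o f).
Proof.
move=> [mf [M fM]]; apply: (@le_integrable _ _ _ mu D mD _ (cst M%:E)).
- exact/measurable_EFinP/(measurable_funS measurableT).
- by move=> x _ /=; rewrite lee_fin (le_trans (fM x))// ler_norm.
- exact: integrable_cst_lty.
Qed.

End integral.
End one_type.

Section two_types.
Context d1 d2 (T1 : measurableType d1) (T2 : measurableType d2).
Variables (m1 : {sigma_finite_measure set T1 -> \bar R})
          (m2 : {sigma_finite_measure set T2 -> \bar R}).
Variables (D1 : set T1) (D2 : set T2).
Hypotheses (mD1 : measurable D1) (mD2 : measurable D2).
Hypotheses (fD1 : (m1 D1 < +oo)%E) (fD2 : (m2 D2 < +oo)%E).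
Variable F : T1 * T2 -> R.
Hypothesis bF : bounded_measurable F.

Lemma bmf_pair1 x : bounded_measurable (fun y => F (x, y)).
Proof.
by apply: (bmf_comp _ bF); exact: measurable_pair1.
Qed.

Lemma bmf_pair2 y : bounded_measurable (fun x => F (x, y)).
Proof.
by apply: (bmf_comp _ bF); exact: measurable_pair2.
Qed.

Let FD := (EFin \o F) \_ (D1 `*` D2).

Let mD12 : measurable (D1 `*` D2). Proof. exact: measurableX. Qed.

Let intFD : (m1 \x m2)%E.-integrable setT FD.
Proof.
apply: (integrable_mkcond (EFin \o F) mD12).1.
apply: bmf_integrable => //.
rewrite -[ltLHS]/((m1 \x m2)%E (D1 `*` D2)) product_measure1E//.
by rewrite lte_mul_pinfty// ge0_fin_numE.
Qed.

Let FDE1 x : (\int[m2]_y FD (x, y))%E =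
  (EFin \o (fun x => Rintegral m2 D2 (fun y => F (x, y))) \_ D1) x.
Proof.
rewrite /= patchE; case: ifPn => [/set_mem xD|/negP xD].
  rewrite /Rintegral fineK; last first.
    by apply: integrable_fin_num => //; apply: bmf_integrable => //; exact: bmf_pair1.
  rewrite [RHS]integral_mkcond; apply: eq_integral => y _.
  rewrite /FD !patchE; congr (if _ then _ else _).
  by apply/idP/idP => /set_mem; [case=> _ /= /mem_set|move=> yD; apply/mem_set].
rewrite integral0_eq// => y _; rewrite /FD patchE ifN//.
by apply/negP => /set_mem[/= xD' _]; apply: xD; exact/mem_set.
Qed.

Let FDE2 y : (\int[m1]_x FD (x, y))%E =
  (EFin \o (fun y => Rintegral m1 D1 (fun x => F (x, y))) \_ D2) y.
Proof.
rewrite /= patchE; case: ifPn => [/set_mem xD|/negP xD].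
  rewrite /Rintegral fineK; last first.
    by apply: integrable_fin_num => //; apply: bmf_integrable => //; exact: bmf_pair2.
  rewrite [RHS]integral_mkcond; apply: eq_integral => x _.
  rewrite /FD !patchE; congr (if _ then _ else _).
  by apply/idP/idP => /set_mem; [case=> /= /mem_set|move=> yD; apply/mem_set].
rewrite integral0_eq// => x _; rewrite /FD patchE ifN//.
by apply/negP => /set_mem[/= _ xD']; apply: xD; exact/mem_set.
Qed.

Lemma Rintegral_prod :
  Rintegral (m1 \x m2)%E (D1 `*` D2) F =
  Rintegral m2 D2 (fun y => Rintegral m1 D1 (fun x => F (x, y))).
Proof.
rewrite {1}/Rintegral integral_mkcond -integral21_prod_meas1//.
under eq_integral do rewrite /fubini_G FDE2.
by rewrite [in RHS]Rintegral_mkcond.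
Qed.

Lemma Rintegral_exchange :
  Rintegral m1 D1 (fun x => Rintegral m2 D2 (fun y => F (x, y))) =
  Rintegral m2 D2 (fun y => Rintegral m1 D1 (fun x => F (x, y))).
Proof.
rewrite -Rintegral_prod [in RHS]/Rintegral integral_mkcond -integral12_prod_meas1//.
under [in RHS]eq_integral do rewrite /fubini_F FDE1.
by rewrite [in LHS]Rintegral_mkcond.
Qed.

End two_types.

Lemma bmf_Rintegral d1 d2 (T1 : measurableType d1) (T2 : measurableType d2)
    (m2 : {sigma_finite_measure set T2 -> \bar R}) (D2 : set T2)
    (F : T1 * T2 -> R) : measurable D2 -> (m2 D2 < +oo)%E ->
  bounded_measurable F ->
  bounded_measurable (fun x => Rintegral m2 D2 (fun y => F (x, y))).
Proof.
move=> mD fD bF; have [mF [M FM]] := bF; split; last first.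
  exists (Rintegral m2 D2 (cst M)) => x.
  have i1 := bmf_integrable mD fD (bmf_pair1 bF x).
  rewrite (le_trans (le_normr_Rintegral _ i1))//.
  apply: le_Rintegral => //.
  - exact: integrable_norm.
  - exact: integrable_cst_lty.
(* Tonelli gives measurability of partial integrals of nonnegative functions; adding the bound [M]
   makes the integrand nonnegative, and the constant is subtracted afterwards. *)
pose G (p : T1 * T2) : \bar R := ((F p + M)%:E * (\1_D2 p.2)%:E)%E.
have G0 p : (0 <= G p)%E.
  rewrite /G -EFinM lee_fin mulr_ge0//; have := FM p; rewrite ler_norml; lra.
have mG : measurable_fun setT G.
  rewrite /G; under eq_fun do rewrite -EFinM.
  apply/measurable_EFinP/measurable_funM; first exact: measurable_funD.
  by apply: measurableT_comp => //; exact: measurable_snd.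
have := measurable_fun_fubini_tonelli_F (m2 := m2) G mG G0.
rewrite /fubini_F => mG'.
rewrite (_ : (fun x => _) = fun x =>
    fine (\int[m2]_y G (x, y))%E - Rintegral m2 D2 (cst M)).
  by apply: measurable_funB => //; apply: measurableT_comp.
apply/funext => x; have bx := bmf_pair1 bF x.
have ix := bmf_integrable mD fD bx.
have iM : m2.-integrable D2 (EFin \o cst M) by exact: integrable_cst_lty.
suff -> : (\int[m2]_y G (x, y))%E = (\int[m2]_(y in D2) (F (x, y) + M)%:E)%E.
  by rewrite -[X in X - _]/(Rintegral m2 D2 (fun y => F (x, y) + cst M y))
    RintegralD// addrK.
rewrite [RHS]integral_mkcond; apply: eq_integral => y _.
by rewrite /G patchE indicE/=; case: ifP => _; rewrite ?mule1 ?mule0.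
Qed.

End bounded_measurable.

(** * Measure of boxes and integration along one coordinate *)

Section boxes.
Variable R : realType.
Implicit Types n : nat.

Definition box_itv n (a : 'I_n -> R) i : set R := `]- a i, a i[%classic.
Definition box_del n (a : 'I_n.+1 -> R) (i : 'I_n.+1) : 'I_n -> R := fun k => a (lift i k).

Definition rV_cube n (l r : 'I_n -> R) : set 'rV[R]_n :=
  [set x | forall i, l i < x ord0 i < r i].

Lemma measurable_cube n (l r : 'I_n -> R) : measurable (rV_cube l r).
Proof.
rewrite (_ : rV_cube l r = \bigcap_(i in [set: 'I_n])
    [set x : 'rV[R]_n | x ord0 i \in `]l i, r i[]).
  apply: fin_bigcap_measurable => // i _.
  rewrite -[X in measurable X]setTI.
  exact: (@measurable_coord _ _ n i measurableT _ (measurable_itv _)).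
by apply/seteqP; split => x /= xa i => [_|]; have := xa i; rewrite /= in_itv//=; apply.
Qed.

Lemma cube_ins n (l r : 'I_n.+1 -> R) i t y :
  rV_cube l r (rV_ins i (t, y)) <->
  `]l i, r i[%classic t /\ rV_cube (fun k => l (lift i k)) (fun k => r (lift i k)) y.
Proof.
rewrite /= in_itv /=; split => [H|[Ht Hy] j].
  split; first by have := H i; rewrite rV_ins_eq.
  by move=> k; have := H (lift i k); rewrite rV_ins_lift.
case: (unliftP i j) => [k|] ->; last by rewrite rV_ins_eq.
by rewrite rV_ins_lift; exact: Hy.
Qed.

Lemma lebesgue_cube_ins n (l r : 'I_n.+1 -> R) i :
  lebesgue_rV R n.+1 (rV_cube l r) =
  (@lebesgue_measure R `]l i, r i[%classic *
   lebesgue_rV R n (rV_cube (fun k => l (lift i k)) (fun k => r (lift i k))))%E.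
Proof.
set B := rV_cube (fun k => l (lift i k)) _.
apply: (etrans (lebesgue_rV_ins i (measurable_cube l r))).
transitivity (\int[@lebesgue_measure R]_(t in `]l i, r i[) (cst (lebesgue_rV R n B) t))%E;
    last first.
  rewrite integral_cst; first by rewrite muleC.
  exact: measurable_itv.
rewrite [RHS]integral_mkcond; apply: eq_integral => t _; rewrite patchE.
case: ifPn => [/set_mem ta|/negP ta].
  by congr (lebesgue_rV R n _); apply/seteqP; split => y /=; rewrite cube_ins => // -[].
rewrite [X in lebesgue_rV R n X](_ : _ = set0) ?measure0//.
by apply/seteqP; split => y //=; rewrite cube_ins => -[/mem_set].
Qed.

Lemma cube_lty n (l r : 'I_n -> R) : (lebesgue_rV R n (rV_cube l r) < +oo)%E.
Proof.
elim: n l r => [|n IH] l r; first by rewrite lebesgue_rV0 ?ltry// => -[].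
rewrite (lebesgue_cube_ins l r ord0) lte_mul_pinfty//.
  by rewrite ge0_fin_numE// lebesgue_measure_itv/=; case: ifP => // _; rewrite -EFinB ltry.
Qed.

Lemma cube_gt0 n (l r : 'I_n -> R) : (forall i, l i < r i) ->
  (0 < lebesgue_rV R n (rV_cube l r))%E.
Proof.
elim: n l r => [|n IH] l r lr; first by rewrite lebesgue_rV0// => -[].
rewrite (lebesgue_cube_ins l r ord0) mule_gt0 ?IH// lebesgue_measure_itv/= lte_fin lr.
by rewrite -EFinB lte_fin subr_gt0.
Qed.

Lemma measurable_box n (a : 'I_n -> R) : measurable (box a).
Proof. exact: measurable_cube. Qed.

Lemma box_lty n (a : 'I_n -> R) : (lebesgue_rV R n (box a) < +oo)%E.
Proof. exact: cube_lty. Qed.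

Lemma box_ins n (a : 'I_n.+1 -> R) i t y :
  box a (rV_ins i (t, y)) <-> box_itv a i t /\ box (box_del a i) y.
Proof. exact: (cube_ins (fun i => - a i) a). Qed.

Lemma measurable_box_itv n (a : 'I_n -> R) i : measurable (box_itv a i).
Proof. exact: measurable_itv. Qed.

Lemma box_itv_lty n (a : 'I_n -> R) i : (@lebesgue_measure R (box_itv a i) < +oo)%E.
Proof.
by rewrite /box_itv lebesgue_measure_itv/=; case: ifP => // _; rewrite -EFinB ltry.
Qed.

(** Lebesgue measure is the image of a product measure under [rV_ins i], by [lebesgue_rV_ins]; the
    rest is change of variables and Fubini. *)
Lemma Rintegral_box_ins n (a : 'I_n.+1 -> R) i (F : 'rV[R]_n.+1 -> R) :
  bounded_measurable F ->
  Rintegral (lebesgue_rV R n.+1) (box a) F =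
  Rintegral (lebesgue_rV R n) (box (box_del a i)) (fun y =>
    Rintegral (@lebesgue_measure R) (box_itv a i) (fun t => F (rV_ins i (t, y)))).
Proof.
move=> bF.
have bFi : bounded_measurable (F \o @rV_ins R n i).
  exact: (bmf_comp (@measurable_rV_ins R n i) bF).
have E : @rV_ins R n i @^-1` (box a) = box_itv a i `*` box (box_del a i).
  by apply/seteqP; split => -[t y] /=; rewrite box_ins.
have mX : measurable (box_itv a i `*` box (box_del a i)).
  by apply: measurableX; [exact: measurable_box_itv|exact: measurable_box].
pose nu : {measure set (measurableTypeR R * 'rV[R]_n)%type -> \bar R} :=
  (@lebesgue_measure R \x lebesgue_rV R n)%E.
have nuX : (nu (box_itv a i `*` box (box_del a i)) < +oo)%E.
  have := product_measure1E (@lebesgue_measure R) (lebesgue_rV R n)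
    (measurable_box_itv a i) (measurable_box (box_del a i)).
  rewrite /nu /= => ->.
  by rewrite lte_mul_pinfty ?ge0_fin_numE ?box_itv_lty ?box_lty.
have mi : measurable_fun setT (@rV_ins R n i : measurableTypeR R * 'rV[R]_n -> _).
  exact: measurable_rV_ins.
have step1 : (\int[lebesgue_rV R n.+1]_(x in box a) (F x)%:E =
    \int[pushforward nu (@rV_ins R n i)]_(x in box a) (F x)%:E)%E.
  apply: (@eq_measure_integral _ _ R (box a)
    (measure_function_pushforward__canonical__measure_function_Measure nu mi)) => A mA _.
  apply: (etrans (lebesgue_rV_ins i mA)).
  rewrite /= /pushforward /= /product_measure1; apply: eq_integral => t _.
  by rewrite /= xsectionE.
have mF : measurable_fun setT (EFin \o F) by apply/measurable_EFinP; case: bF.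
have iF : nu.-integrable (@rV_ins R n i @^-1` (box a)) ((EFin \o F) \o @rV_ins R n i).
  by rewrite E; apply: bmf_integrable.
have step2 := integral_pushforward mi mF iF (measurable_box a).
have step3 := Rintegral_prod (m1 := @lebesgue_measure R) (m2 := lebesgue_rV R n)
  (measurable_box_itv a i) (measurable_box (box_del a i))
  (box_itv_lty a i) (box_lty (box_del a i)) bFi.
rewrite -[RHS]step3 /Rintegral; congr fine.
by apply: (etrans step1); apply: (etrans step2); rewrite E.
Qed.

End boxes.

(** * Continuous functions: measurability, slices, divergence theorem *)

Section continuity.
Variable R : realType.
Implicit Types n : nat.

Lemma ball_rVP n (x y : 'rV[R]_n) e : 0 < e ->
  ball x e y <-> forall j, `|x ord0 j - y ord0 j| < e.
Proof.
move=> e0; split => [[_ H] j|H]; first exact: (H ord0 j).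
by split => // i j; rewrite (ord1 i); exact: H.
Qed.

Lemma measurable_ball_rV n (x : 'rV[R]_n) e : measurable (ball x e).
Proof.
have [e0|e0] := ltP 0 e; last first.
  rewrite (_ : ball x e = set0)//; apply/seteqP; split => // y [e0' _].
  by move: (lt_le_trans e0' e0); rewrite ltxx.
rewrite (_ : ball x e = \bigcap_(j in [set: 'I_n])
    [set y : 'rV[R]_n | y ord0 j \in `]x ord0 j - e, x ord0 j + e[]).
  apply: fin_bigcap_measurable => // i _.
  rewrite -[X in measurable X]setTI.
  exact: (@measurable_coord _ _ n i measurableT _ (measurable_itv _)).
apply/seteqP; split => y.
  by move=> /(ball_rVP _ _ e0) H j _ /=; have := H j; rewrite in_itv/= ltr_norml; lra.
move=> H; apply/ball_rVP => // j.
by have := H j I; rewrite /= in_itv/= ltr_norml; lra.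
Qed.

(** The link between the topology and the sigma-algebra generated by the coordinates: an open set is
    a countable union of balls with rational centre and radius [1 / (k + 1)]. *)
Lemma open_measurable_rV n (A : set 'rV[R]_n) : open A -> measurable A.
Proof.
move=> oA.
pose B (p : 'rV[rat]_n * nat) : set 'rV[R]_n :=
  ball (map_mx (@ratr R) p.1) p.2.+1%:R^-1.
pose C m : set 'rV[R]_n :=
  if unpickle m is Some p then if `[< B p `<=` A >] then B p else set0 else set0.
rewrite (_ : A = \bigcup_m C m).
  apply: bigcup_measurable => m _; rewrite /C; case: unpickle => [p|//].
  by case: ifP => // _; exact: measurable_ball_rV.
apply/seteqP; split => [x Ax|x [m _]]; last first.
  by rewrite /C; case: unpickle => [p|//]; case: asboolP => // pA /pA.
have /nbhs_ballP[e /= e0 eA] : nbhs x A by exact: open_nbhs_nbhs.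
have [k ke] : exists k, k.+1%:R^-1 < e / 2.
  have e20 : 0 < e / 2 by rewrite divr_gt0.
  by have [k _ Hk] := near_infty_natSinv_lt (PosNum e20); exists k; apply: (Hk k) => /=.
have k0 : 0 < k.+1%:R^-1 :> R by rewrite invr_gt0.
have H j : exists q : rat, `|x ord0 j - ratr q| < k.+1%:R^-1.
  have /rat_in_itvoo[q] : x ord0 j - k.+1%:R^-1 < x ord0 j + k.+1%:R^-1.
    by rewrite ltrD2l gtrN.
  rewrite in_itv/= => /andP[q1 q2]; exists q.
  by rewrite ltr_norml ltrNl opprB ltrBlDl q2 ltrBlDl -ltrBlDr q1.
have [q Hq] := choice H.
have Bx : B (\row_j q j, k) x.
  by apply/ball_rVP => // j /=; rewrite !mxE distrC.
exists (pickle (\row_j q j : 'rV[rat]_n, k)) => //.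
rewrite /C pickleK; case: asboolP => // -[]; move=> z Bz; apply: eA.
have := ball_triangle (ball_sym Bx) Bz.
by apply: le_ball; rewrite [in leRHS](splitr e) lerD// ltW.
Qed.

Lemma continuous_measurable_rV n (f : 'rV[R]_n -> R) :
  continuous f -> measurable_fun setT f.
Proof.
move=> /continuousP cf; apply: (measurability _ (RGenOpens.measurableE R)).
move=> _ [_ [a [b ->] <-]]; rewrite setTI; apply: open_measurable_rV.
exact/cf/interval_open.
Qed.

Definition closed_box n (a : 'I_n -> R) : set 'rV[R]_n :=
  [set x | forall i, - a i <= x ord0 i <= a i].

Lemma box_closed_box n (a : 'I_n -> R) x : box a x -> closed_box a x.
Proof. by move=> H i; have /andP[/ltW -> /ltW ->] := H i. Qed.

Lemma closed_box_ins n (a : 'I_n.+1 -> R) i t y : - a i <= t <= a i ->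
  box (box_del a i) y -> closed_box a (rV_ins i (t, y)).
Proof.
move=> ta yb j; case: (unliftP i j) => [k|] ->; last by rewrite rV_ins_eq.
by rewrite rV_ins_lift; exact: (box_closed_box yb).
Qed.

Definition bounded_on (T : Type) (D : set T) (f : T -> R) :=
  exists M, forall x, D x -> `|f x| <= M.

Lemma continuous_bounded_box n (a : 'I_n -> R) (f : 'rV[R]_n -> R) :
  continuous f -> bounded_on (closed_box a) f.
Proof.
move=> cf.
have : compact (f @` closed_box a).
  apply: continuous_compact; first exact: continuous_subspaceT.
  rewrite (_ : closed_box a = [set v : 'rV[R]_n | forall i, `[- a i, a i]%classic (v ord0 i)]).
    exact: (@rV_compact _ n (fun i => `[- a i, a i]%classic) (fun i => @segment_compact R _ _)).
  by apply/seteqP; split => x H i; have := H i; rewrite /= in_itv.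
move=> /compact_bounded[M [_ HM]]; exists (M + 1) => x xa.
by apply: (HM (M + 1)); [rewrite ltrDl|exists x].
Qed.

Lemma bounded_on_patch d (T : measurableType d) (D : set T) (f : T -> R) :
  measurable D -> measurable_fun setT f -> bounded_on D f ->
  bounded_measurable (f \_ D).
Proof.
move=> mD mf [M HM]; split.
  rewrite (_ : f \_ D = fun x => f x * \1_D x).
    by apply: measurable_funM => //; exact: measurable_indic.
  by apply/funext => x; rewrite patchE indicE; case: ifP; rewrite ?mulr1 ?mulr0.
exists `|M| => x; rewrite patchE; case: ifPn => [/set_mem/HM|_]; last by rewrite normr0.
by move=> /le_trans; apply; rewrite ler_norm.
Qed.

Lemma bounded_integrable d (T : measurableType d) (mu : {measure set T -> \bar R})
    (D : set T) (f : T -> R) : measurable D -> (mu D < +oo)%E ->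
  measurable_fun setT f -> bounded_on D f -> mu.-integrable D (EFin \o f).
Proof.
move=> mD muD mf bf.
have := bmf_integrable mD muD (bounded_on_patch mD mf bf).
apply: eq_integrable => // x xD /=; by rewrite patchE xD.
Qed.

Lemma Rintegral_box_slice n (a : 'I_n.+1 -> R) i (F : 'rV[R]_n.+1 -> R) :
  measurable_fun setT F -> bounded_on (box a) F ->
  Rintegral (lebesgue_rV R n.+1) (box a) F =
  Rintegral (lebesgue_rV R n) (box (box_del a i)) (fun y =>
    Rintegral (@lebesgue_measure R) (box_itv a i) (fun t => F (rV_ins i (t, y)))).
Proof.
move=> mF bF.
have := Rintegral_box_ins a i (bounded_on_patch (measurable_box a) mF bF).
have -> : Rintegral (lebesgue_rV R n.+1) (box a) (F \_ (box a)) =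
    Rintegral (lebesgue_rV R n.+1) (box a) F.
  by apply: eq_Rintegral => x xD; rewrite /patch xD.
move=> ->; apply: eq_Rintegral => y /set_mem yD; apply: eq_Rintegral => t /set_mem tD.
by rewrite /patch ifT//; apply/mem_set/box_ins.
Qed.

Lemma rV_ins_shift n (i : 'I_n.+1) h t (y : 'rV[R]_n) :
  rV_ins i (h + t, y) = h *: dir R i + rV_ins i (t, y).
Proof.
apply/rowP => j; rewrite [RHS]mxE [X in _ = X + _]mxE.
have -> : dir R i ord0 j = (j == i)%:R by rewrite /dir mxE eqxx.
case: (unliftP i j) => [k|] ->.
  by rewrite !rV_ins_lift eq_sym (negbTE (neq_lift _ _)) mulr0 add0r.
by rewrite !rV_ins_eq eqxx mulr1.
Qed.

Lemma continuous_rV_ins n (i : 'I_n.+1) (y : 'rV[R]_n) :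
  continuous (fun t => rV_ins i (t, y)).
Proof.
move=> t; apply/cvg_ballP => e e0; near=> s.
apply/ball_rVP => // j.
case: (unliftP i j) => [k|] ->; first by rewrite !rV_ins_lift subrr normr0.
rewrite !rV_ins_eq/=; near: s.
by apply/nbhs_ballP; exists e.
Unshelve. all: by end_near. Qed.

Let diff_quotient_slice n (i : 'I_n.+1) (F : 'rV[R]_n.+1 -> R) y t :
  (fun h : R => h^-1 *: ((F \o shift (rV_ins i (t, y))) (h *: dir R i) -
    F (rV_ins i (t, y)))) =
  (fun h : R => h^-1 *: (((fun s => F (rV_ins i (s, y))) \o shift t) (h *: (1 : R)) -
    F (rV_ins i (t, y)))).
Proof. by apply/funext => h /=; rewrite -rV_ins_shift [h *: _]mulr1. Qed.

Lemma derive_slice n (i : 'I_n.+1) (F : 'rV[R]_n.+1 -> R) y t :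
  'D_(dir R i) F (rV_ins i (t, y)) = derive1 (fun s => F (rV_ins i (s, y))) t.
Proof. by rewrite derive1E /derive diff_quotient_slice. Qed.

Lemma derivable_slice n (i : 'I_n.+1) (F : 'rV[R]_n.+1 -> R) y t :
  derivable F (rV_ins i (t, y)) (dir R i) ->
  derivable (fun s => F (rV_ins i (s, y))) t 1.
Proof. by rewrite /derivable diff_quotient_slice. Qed.

Lemma slice_derivable n (i : 'I_n.+1) (F : 'rV[R]_n.+1 -> R) y t :
  derivable (fun s => F (rV_ins i (s, y))) t 1 ->
  derivable F (rV_ins i (t, y)) (dir R i).
Proof. by rewrite /derivable -diff_quotient_slice. Qed.

Lemma Rintegral_itvoo (f : R -> R) (a b : R) : {within `[a, b], continuous f} ->
  Rintegral (@lebesgue_measure R) `]a, b[%classic f =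
  Rintegral (@lebesgue_measure R) `[a, b]%classic f.
Proof.
move=> cf; have icf := continuous_compact_integrable (@segment_compact _ a b) cf.
rewrite Rintegral_itv_obnd_cbnd; last first.
  by apply: integrableS icf => //; apply: subset_itv_oo_cc.
rewrite Rintegral_itv_bndo_bndc//.
by apply: integrableS icf => //; apply: subset_itv_co_cc.
Qed.

Lemma Rintegral_derive (F : R -> R) (a b : R) : a < b ->
  (forall x, derivable F x 1) -> continuous (derive1 F) ->
  Rintegral (@lebesgue_measure R) `]a, b[%classic (derive1 F) = F b - F a.
Proof.
move=> ab dF cF.
have cF' : continuous F by move=> x; apply: differentiable_continuous; exact/derivable1_diffP.
rewrite Rintegral_itvoo; last exact: continuous_subspaceT.
have oo : derivable_oo_LRcontinuous F a b.
  split => //; [exact/cvg_at_right_filter/cF'|exact/cvg_at_left_filter/cF'].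
have := @continuous_FTC2 R (derive1 F) F a b ab (continuous_subspaceT cF) oo.
move=> /(_ (fun _ _ => erefl)) FTC.
by rewrite /Rintegral [X in fine X]FTC.
Qed.

(** Fubini reduces this to the fundamental theorem of calculus on each segment in direction [i]. *)
Lemma box_divergence n (a : 'I_n.+1 -> R) i (F : 'rV[R]_n.+1 -> R) :
  0 < a i -> (forall x, derivable F x (dir R i)) ->
  continuous ('D_(dir R i) F : 'rV[R]_n.+1 -> R) ->
  Rintegral (lebesgue_rV R n.+1) (box a) ('D_(dir R i) F : 'rV[R]_n.+1 -> R) =
  Rintegral (lebesgue_rV R n) (box (box_del a i))
    (fun y => F (rV_ins i (a i, y)) - F (rV_ins i (- a i, y))).
Proof.
move=> ai dF cF; rewrite (@Rintegral_box_slice _ a i).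
- apply: eq_Rintegral => y _.
  under eq_Rintegral do rewrite derive_slice.
  rewrite Rintegral_derive//; first by lra.
  + by move=> x; exact: derivable_slice.
  + rewrite (_ : derive1 _ = fun t => 'D_(dir R i) F (rV_ins i (t, y))); last first.
      by apply/funext => t; rewrite derive_slice.
    move=> x; exact: (continuous_comp (@continuous_rV_ins _ i y x) (cF _)).
- exact: continuous_measurable_rV.
- have [M HM] := @continuous_bounded_box _ a _ cF.
  by exists M => x /box_closed_box/HM.
Qed.

End continuity.

(** * One-dimensional endpoint inequality *)

Section endpoint_inequality.
Variable R : realType.
Local Notation mu := (@lebesgue_measure R).

Lemma continuous_integrable_oo (f : R -> R) (l r : R) : continuous f ->
  mu.-integrable `]l, r[%classic (EFin \o f).
Proof.
move=> cf.
have icf := continuous_compact_integrable (@segment_compact _ l r) (continuous_subspaceT cf).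
by apply: integrableS icf => //; apply: subset_itv_oo_cc.
Qed.

Lemma derivable_continuous (f : R -> R) : (forall x : R, derivable f x 1) -> continuous f.
Proof. by move=> df x; apply: differentiable_continuous; exact/derivable1_diffP. Qed.

Lemma Rintegral_is_derive (F f : R -> R) (l r : R) : l < r ->
  (forall x : R, is_derive x (1 : R) F (f x)) -> continuous f ->
  Rintegral mu `]l, r[%classic f = F r - F l.
Proof.
move=> lr dF cf.
have E : derive1 F = f by apply/funext => x; rewrite derive1E; exact: derive_val.
by rewrite -E Rintegral_derive// ?E// => x; exact: ex_derive.
Qed.

Lemma continuous_sqr (T : topologicalType) (f : T -> R) :
  continuous f -> continuous (fun x => f x ^+ 2).
Proof.
move=> cf; under eq_fun do rewrite expr2.
by move=> x; apply: cvgM; exact: cf.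
Qed.

Lemma is_derive_congr (f g : R -> R) (x df dg : R) :
  is_derive x (1 : R) f df -> f = g -> df = dg -> is_derive x (1 : R) g dg.
Proof. by move=> + <- <-. Qed.

Lemma is_derive_expR_affine (c p x : R) :
  is_derive x (1 : R) (fun y => expR (c * (y - p))) (c * expR (c * (x - p))).
Proof.
have H : is_derive x (1 : R) (fun y : R => c * (y - p)) c.
  by apply: is_derive_eq; rewrite subr0 [_ *: _]mulr1.
by rewrite mulrC; exact: (@is_derive1_comp R expR _ x _ _ (is_derive_expR _) H).
Qed.

Lemma continuous_expR_affine (c p : R) : continuous (fun y => expR (c * (y - p))).
Proof.
by apply: derivable_continuous => x; case: (is_derive_expR_affine c p x).
Qed.

(* The weight q = e - e(far end) vanishes at the far end, equals 1 - eta at the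
   end p, and q' = sg * t * e; integrating (g' - sg * t * g(p) * q)^2 >= 0 turns
   g(p) into the moment of g against e. *)
Lemma endpoint_le (g : R -> R) (l r t : R) (sg : bool) (K : R) :
  let p := if sg then r else l in
  let e := fun x => expR ((if sg then t else - t) * (x - p)) in
  let N2 := Rintegral mu `]l, r[%classic (fun x => e x ^+ 2) in
  let eta := expR (- t * (r - l)) in
  l < r -> 0 < t -> 4 * eta < 1 -> 1 <= K * (1 - 4 * eta) ->
  (forall x : R, derivable g x 1) -> continuous (derive1 g) ->
  [/\ 0 < N2 & t * g p ^+ 2 <=
    Rintegral mu `]l, r[%classic (fun x => derive1 g x ^+ 2) +
    K * t ^+ 2 * (Rintegral mu `]l, r[%classic (fun x => g x * e x) ^+ 2 / N2)].
Proof.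
move=> p e N2 eta lr t0 eta4 K1 dg cg.
set G := g p; set X := Rintegral mu `]l, r[%classic (fun x => g x * e x).
pose c := if sg then t else - t; pose s : R := if sg then 1 else - 1.
have cE : c = s * t by rewrite /c /s; case: (sg); rewrite ?mul1r ?mulN1r.
have s2 : s * s = 1 by rewrite /s; case: (sg); rewrite ?mulr1 ?mulrNN ?mulr1.
have eta0 : 0 < eta by exact: expR_gt0.
have e0 x : 0 < e x by exact: expR_gt0.
have de (x : R) : is_derive x (1 : R) e (c * e x) by exact: is_derive_expR_affine.
have ce : continuous e by exact: continuous_expR_affine.
have cgg : continuous g by exact: derivable_continuous.
have ep : e p = 1 by rewrite /e subrr mulr0 expR0.
pose p' := if sg then l else r.
have ep' : e p' = eta.
  rewrite /e /p' /p /eta; congr expR; case: (sg); ring.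
have eeta x : l < x < r -> eta <= e x.
  move=> /andP[lx xr]; rewrite -ep' /e ler_expR /p' /p.
  by case: (sg) => /=; [rewrite ler_pM2l//|rewrite ler_nM2l ?oppr_lt0//]; lra.
have N2E : N2 = (1 - eta ^+ 2) / (2 * t).
  pose F x := (s / (2 * t)) * (e x * e x).
  have dF (x : R) : is_derive x (1 : R) F (e x ^+ 2).
    apply: (is_derive_congr (is_deriveZ (s / (2 * t)) (is_deriveM (de x) (de x)))) => //.
    rewrite /GRing.scale/= cE.
    transitivity ((s * s) * (e x) ^+ 2); last by rewrite s2 mul1r.
    by field; rewrite gt_eqF.
  rewrite /N2 (Rintegral_is_derive lr dF); last first.
    exact: continuous_sqr.
  rewrite /F -!expr2; move: ep ep'; rewrite /p /p' /s.
  by case: (sg) => -> ->; field; rewrite gt_eqF.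
have N20 : 0 < N2.
  rewrite N2E divr_gt0 ?mulr_gt0// subr_gt0 expr_lt1//; first lra.
  exact: ltW.
split => //.
(* This is [(g' - s t G q)^2 >= 0] for [q = e - eta], with [q^2 <= e^2] used in the last term. The
   summand [g x * (c * e x)] completes the first bracket to the derivative of [g q] and is
   compensated by the moment term. *)
have ptw x : `]l, r[%classic x ->
    2 * s * t * G * (derive1 g x * (e x - eta) + g x * (c * e x))
     - 2 * t ^+ 2 * G * (g x * e x) - t ^+ 2 * G ^+ 2 * e x ^+ 2 <= derive1 g x ^+ 2.
  rewrite /= in_itv/= => /eeta ee.
  have h1 : 0 <= (derive1 g x - s * t * G * (e x - eta)) ^+ 2 by exact: sqr_ge0.
  have h2 : (e x - eta) ^+ 2 <= e x ^+ 2.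
    rewrite ler_pXn2r ?nnegrE ?subr_ge0//; last exact/ltW/e0.
    by rewrite lerBlDr lerDl ltW.
  rewrite -subr_ge0 cE.
  have -> : derive1 g x ^+ 2 - (2 * s * t * G * (derive1 g x * (e x - eta) + g x * (s * t * e x)) -
      2 * t ^+ 2 * G * (g x * e x) - t ^+ 2 * G ^+ 2 * e x ^+ 2) =
    (derive1 g x - s * t * G * (e x - eta)) ^+ 2 +
    t ^+ 2 * G ^+ 2 * (e x ^+ 2 - (s * s) * (e x - eta) ^+ 2) +
    2 * (1 - s * s) * t ^+ 2 * G * (g x * e x) by ring.
  rewrite s2 subrr mulr0 !mul0r addr0 mul1r addr_ge0// mulr_ge0 ?subr_ge0//.
  by rewrite mulr_ge0// sqr_ge0.
have dq (x : R) : is_derive x (1 : R) (fun x => g x * (e x - eta))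
    (derive1 g x * (e x - eta) + g x * (c * e x)).
  have dgx : is_derive x (1 : R) g (derive1 g x).
    by rewrite derive1E; apply: DeriveDef.
  apply: (is_derive_congr (is_deriveM dgx (is_deriveB (de x) (is_derive_cst eta x 1)))) => //.
  by rewrite /GRing.scale/= subr0 addrC -[(e - cst eta) x]/(e x - eta) [in LHS](mulrC (e x - eta)).
have cq : continuous (fun x => derive1 g x * (e x - eta) + g x * (c * e x)).
  move=> x; apply: cvgD; apply: cvgM.
  - exact: cg.
  - by apply: cvgB; [exact: ce|exact: cvg_cst].
  - exact: cgg.
  - by apply: cvgM; [exact: cvg_cst|exact: ce].
have cX : continuous (fun x => g x * e x).
  by move=> x; apply: cvgM; [exact: cgg|exact: ce].
have ce2 : continuous (fun x => e x ^+ 2) by exact: continuous_sqr.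
have cg2 : continuous (fun x => derive1 g x ^+ 2) by exact: continuous_sqr.
pose L x := 2 * s * t * G * (derive1 g x * (e x - eta) + g x * (c * e x))
     - 2 * t ^+ 2 * G * (g x * e x) - t ^+ 2 * G ^+ 2 * e x ^+ 2.
have cL : continuous L.
  move=> x; rewrite /L; apply: cvgB; last by apply: cvgM; [exact: cvg_cst|exact: ce2].
  by apply: cvgB; (apply: cvgM; first exact: cvg_cst); [exact: cq|exact: cX].
have mD : @measurable _ (measurableTypeR R) `]l, r[%classic by exact: measurable_itv.
set J := Rintegral mu _ (fun x => derive1 g x ^+ 2).
have : Rintegral mu `]l, r[%classic L <= J.
  by apply: le_Rintegral => //; exact: continuous_integrable_oo.
have i1 := continuous_integrable_oo l r cq.
have i2 := continuous_integrable_oo l r cX.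
have i3 := continuous_integrable_oo l r ce2.
have cZ (k : R) (f : R -> R) : continuous f -> continuous (fun x => k * f x).
  by move=> cf x; apply: cvgM; [exact: cvg_cst|exact: cf].
have iZ (k : R) (f : R -> R) : continuous f ->
   mu.-integrable `]l, r[%classic (EFin \o (fun x => k * f x)).
  by move=> cf; apply: continuous_integrable_oo; exact: cZ.
rewrite /L RintegralB//; [|apply: continuous_integrable_oo|exact: iZ]; last first.
  by move=> x; apply: cvgB; [exact: (cZ _ _ cq)|exact: (cZ _ _ cX)].
rewrite RintegralB//; [|exact: iZ..].
rewrite !RintegralZl// (Rintegral_is_derive lr dq cq) -/N2 -/X.
have -> : g r * (e r - eta) - g l * (e l - eta) = s * G * (1 - eta).
  rewrite /G /s; move: ep ep'; rewrite /p /p'.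
  by case: (sg) => -> ->; ring.
move=> HJ.
(* The coefficient of [G ^ 2] once [t * G ^ 2] is set aside. Minimizing [A G^2 - 2 t^2 G X] over [G]
   costs [t^4 X^2 / A]. As [eta] tends to 0, [A] tends to [t / 2] and this cost to [t^2 X^2 / N2],
   so [K] can be close to 1. *)
pose A := 2 * t * (1 - eta) - t ^+ 2 * N2 - t.
have A0 : t * (1 / 2 - 2 * eta) <= A.
  rewrite /A N2E.
  have -> : t ^+ 2 * ((1 - eta ^+ 2) / (2 * t)) = t * (1 - eta ^+ 2) / 2.
    by field; rewrite gt_eqF.
  have : 0 <= t * eta ^+ 2 by rewrite mulr_ge0 ?sqr_ge0// ltW.
  lra.
have HA : A * G ^+ 2 - 2 * t ^+ 2 * G * X + t * G ^+ 2 <= J.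
  apply: le_trans HJ; rewrite /A le_eqVlt; apply/orP; left; apply/eqP.
  transitivity (2 * (s * s) * t * (1 - eta) * G ^+ 2 - 2 * t ^+ 2 * G * X - t ^+ 2 * G ^+ 2 * N2).
    by rewrite s2; ring.
  ring.
have A1 : 0 < A.
  by apply: lt_le_trans A0; rewrite mulr_gt0//; lra.
have HC : t ^+ 4 / A <= K * t ^+ 2 / N2.
  rewrite ler_pdivrMr// mulrAC ler_pdivlMr//.
  have h1 : t ^+ 2 * N2 <= t / 2.
    rewrite N2E.
    have -> : t ^+ 2 * ((1 - eta ^+ 2) / (2 * t)) = t * (1 - eta ^+ 2) / 2.
      by field; rewrite gt_eqF.
    have : 0 <= t * eta ^+ 2 by rewrite mulr_ge0 ?sqr_ge0// ltW.
    lra.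
  have -> : t ^+ 4 * N2 = t ^+ 2 * (t ^+ 2 * N2) by ring.
  have -> : K * t ^+ 2 * A = t ^+ 2 * (K * A) by ring.
  rewrite ler_pM2l ?exprn_gt0//; apply: (le_trans h1).
  have K0 : 0 < K.
    by rewrite -(pmulr_lgt0 (x := 1 - 4 * eta)); [exact: lt_le_trans K1|lra].
  apply: (@le_trans _ _ (K * (t * (1 / 2 - 2 * eta)))); last by rewrite ler_pM2l.
  have : t <= t * (K * (1 - 4 * eta)) by rewrite -[leLHS]mulr1 ler_pM2l.
  lra.
have HQ : 0 <= A * G ^+ 2 - 2 * t ^+ 2 * G * X + t ^+ 4 / A * X ^+ 2.
  have -> : A * G ^+ 2 - 2 * t ^+ 2 * G * X + t ^+ 4 / A * X ^+ 2 =
     (A * G - t ^+ 2 * X) ^+ 2 / A by field; rewrite gt_eqF.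
  by rewrite divr_ge0 ?sqr_ge0// ltW.
have HX : t ^+ 4 / A * X ^+ 2 <= K * t ^+ 2 / N2 * X ^+ 2.
  by rewrite ler_wpM2r ?sqr_ge0.
have -> : K * t ^+ 2 * (X ^+ 2 / N2) = K * t ^+ 2 / N2 * X ^+ 2 by ring.
lra.
Qed.

End endpoint_inequality.

(** * Projections acting on one coordinate *)

Section update.
Variable R : realType.

Definition rV_upd n (i : 'I_n) (x : 'rV[R]_n) (t : R) : 'rV[R]_n :=
  \row_j if j == i then t else x ord0 j.

Lemma rV_upd_ins n (i : 'I_n.+1) s t (y : 'rV[R]_n) :
  rV_upd i (rV_ins i (s, y)) t = rV_ins i (t, y).
Proof.
apply/rowP => j; rewrite mxE; case: (unliftP i j) => [k|] ->.
  by rewrite eq_sym (negbTE (neq_lift _ _)) !rV_ins_lift.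
by rewrite eqxx rV_ins_eq.
Qed.

Lemma rV_upd_eq n (i : 'I_n) (x : 'rV[R]_n) t : rV_upd i x t ord0 i = t.
Proof. by rewrite mxE eqxx. Qed.

Lemma rV_upd_neq n (i j : 'I_n) (x : 'rV[R]_n) t : j != i ->
  rV_upd i x t ord0 j = x ord0 j.
Proof. by move=> ji; rewrite mxE (negbTE ji). Qed.

Lemma rV_upd_upd n (i : 'I_n) (x : 'rV[R]_n) s t :
  rV_upd i (rV_upd i x s) t = rV_upd i x t.
Proof. by apply/rowP => j; rewrite !mxE; case: eqP. Qed.

Lemma rV_updC n (i j : 'I_n) (x : 'rV[R]_n) s t : i != j ->
  rV_upd j (rV_upd i x s) t = rV_upd i (rV_upd j x t) s.
Proof.
move=> ij; apply/rowP => k; rewrite !mxE.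
by case: (eqVneq k i) => [->|//]; rewrite (negbTE ij).
Qed.

Lemma rV_upd_cons n (i : 'I_n) s t (y : 'rV[R]_n) :
  rV_upd (lift ord0 i) (rV_ins ord0 (s, y)) t = rV_ins ord0 (s, rV_upd i y t).
Proof.
apply/rowP => j; rewrite mxE; case: (unliftP ord0 j) => [k|] ->.
  by rewrite !rV_ins_lift /= mxE (inj_eq lift_inj).
by rewrite (negbTE (neq_lift _ _)) !rV_ins_eq.
Qed.

Lemma measurable_rV_upd n (i : 'I_n) :
  measurable_fun setT (fun p : 'rV[R]_n * R => rV_upd i p.1 p.2).
Proof.
apply: measurable_fun_coordP => j.
case: (eqVneq j i) => [->|ji].
  rewrite (_ : (fun x => _) = snd); first exact: measurable_snd.
  by apply/funext => p; rewrite rV_upd_eq.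
rewrite (_ : (fun x => _) = (fun x : 'rV[R]_n => x ord0 j) \o fst).
  by apply: measurableT_comp; [exact: measurable_coord|exact: measurable_fst].
by apply/funext => p; rewrite rV_upd_neq.
Qed.

End update.

(** * Rank-one operators in a single coordinate *)

Section partial_projection.
Variable R : realType.
Local Notation mu := (@lebesgue_measure R).
Local Notation bmf := bounded_measurable.

Section fixed_dim.
Variables (n : nat) (a : 'I_n -> R).
Local Notation I i := (Rintegral mu (box_itv a i)).

Lemma bmf_itv_integrable i (f : R -> R) : bmf f ->
  mu.-integrable (box_itv a i) (EFin \o f).
Proof.
move=> bf; apply: bmf_integrable => //.
- exact: measurable_box_itv.
- exact: box_itv_lty.
Qed.

Lemma itv_RintegralB i (f g : R -> R) : bmf f -> bmf g ->
  I i (fun t => f t - g t) = I i f - I i g.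
Proof.
move=> bf bg; apply: RintegralB; [exact: measurable_box_itv|exact: bmf_itv_integrable..].
Qed.

Lemma itv_RintegralZ i r (f : R -> R) : bmf f -> I i (fun t => r * f t) = r * I i f.
Proof.
move=> bf; apply: RintegralZl; [exact: measurable_box_itv|exact: bmf_itv_integrable].
Qed.

Lemma bmf_upd i (phi : 'rV[R]_n -> R) x : bmf phi -> bmf (fun t => phi (rV_upd i x t)).
Proof.
move=> bp; apply: (bmf_comp _ bp).
exact: (measurableT_comp (@measurable_rV_upd R n i) (measurable_pair1 x)).
Qed.

(** The rank-one operator of [f] in coordinate [i], the identity in the others. It is defined at
    every point, so the algebraic relations below are equalities of functions, not merely almost
    everywhere ones. *)
Definition partial_op (f : R -> R) i (phi : 'rV[R]_n -> R) (x : 'rV[R]_n) : R :=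
  f (x ord0 i) * I i (fun t => phi (rV_upd i x t) * f t).

Lemma bmf_coord (f : R -> R) (i : 'I_n) : bmf f -> bmf (fun x : 'rV[R]_n => f (x ord0 i)).
Proof. by move=> bf; apply: (bmf_comp _ bf); exact: measurable_coord. Qed.

Lemma bmf_partial_op f i phi : bmf f -> bmf phi -> bmf (partial_op f i phi).
Proof.
move=> bf bp; apply: bmfM; first exact: bmf_coord.
apply: (@bmf_Rintegral R _ _ 'rV[R]_n (measurableTypeR R) mu (box_itv a i)
  (fun p => phi (rV_upd i p.1 p.2) * f p.2)).
- exact: measurable_box_itv.
- exact: box_itv_lty.
- apply: bmfM; last by apply: (bmf_comp _ bf); exact: measurable_snd.
  exact: (bmf_comp (@measurable_rV_upd R n i) bp).
Qed.

Lemma partial_opB f i phi chi : bmf f -> bmf phi -> bmf chi ->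
  partial_op f i (phi - chi) = partial_op f i phi - partial_op f i chi.
Proof.
move=> bf bp bc; apply/funext => x; rewrite /partial_op !fctE -mulrBr -itv_RintegralB.
- by under eq_Rintegral do rewrite mulrBl.
- by apply: bmfM => //; exact: bmf_upd.
- by apply: bmfM => //; exact: bmf_upd.
Qed.

Lemma partial_op_op f g i phi x : bmf f -> bmf g -> bmf phi ->
  partial_op f i (partial_op g i phi) x =
  f (x ord0 i) * (I i (fun t => g t * f t) * I i (fun t => phi (rV_upd i x t) * g t)).
Proof.
move=> bf bg bp; rewrite /partial_op; congr (_ * _).
rewrite [RHS]mulrC -itv_RintegralZ; last exact: bmfM.
apply: eq_Rintegral => t _; rewrite rV_upd_eq.
under eq_Rintegral do rewrite rV_upd_upd.
by rewrite mulrAC [LHS]mulrC.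
Qed.

(** Both orders are the double integral of [phi] against [f] and [g] in two different coordinates,
    and Fubini exchanges them. *)
Lemma partial_opC f g i j phi : i != j -> bmf f -> bmf g -> bmf phi ->
  partial_op f i (partial_op g j phi) = partial_op g j (partial_op f i phi).
Proof.
move=> ij bf bg bp; apply/funext => x; rewrite /partial_op.
have bF : bmf (fun p : R * R => phi (rV_upd j (rV_upd i x p.1) p.2) * (f p.1 * g p.2)).
  apply: bmfM.
    apply: (bmf_comp _ bp).
    have m1 : measurable_fun setT (fun p : R * R => (x, p.1)).
      by apply/measurable_fun_pair => //; exact: measurable_fst.
    have m2 : measurable_fun setT (fun p : R * R => (rV_upd i x p.1, p.2)).
      apply/measurable_fun_pair => /=; last exact: measurable_snd.
      exact: (measurableT_comp (@measurable_rV_upd R n i) m1).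
    exact: (measurableT_comp (@measurable_rV_upd R n j) m2).
  by apply: bmfM; [apply: (bmf_comp _ bf); exact: measurable_fst|
                   apply: (bmf_comp _ bg); exact: measurable_snd].
have ex := Rintegral_exchange (m1 := mu) (m2 := mu) (measurable_box_itv a i)
  (measurable_box_itv a j) (box_itv_lty a i) (box_itv_lty a j) bF.
have bU k (h : R -> R) (z : 'rV[R]_n) : bmf h -> bmf (fun t => phi (rV_upd k z t) * h t).
  by move=> bh; apply: bmfM; [exact: bmf_upd|exact: bh].
have -> : I i (fun t => g ((rV_upd i x t) ord0 j) * I j (fun s => phi (rV_upd j (rV_upd i x t) s) * g s) * f t) =
   g (x ord0 j) * I i (fun t => I j (fun s => phi (rV_upd j (rV_upd i x t) s) * (f t * g s))).
  rewrite -itv_RintegralZ; last first.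
    apply: (@bmf_Rintegral R _ _ (measurableTypeR R) (measurableTypeR R) mu (box_itv a j) _ _ _ bF).
    - exact: measurable_box_itv.
    - exact: box_itv_lty.
  apply: eq_Rintegral => t _; rewrite rV_upd_neq 1?eq_sym// -mulrA; congr (_ * _).
  rewrite mulrC -itv_RintegralZ; last exact: bU.
  by apply: eq_Rintegral => s _; rewrite mulrCA.
rewrite ex /=.
have -> : I j (fun t => f ((rV_upd j x t) ord0 i) * I i (fun s => phi (rV_upd i (rV_upd j x t) s) * f s) * g t) =
   f (x ord0 i) * I j (fun t => I i (fun s => phi (rV_upd j (rV_upd i x s) t) * (f s * g t))).
  rewrite -itv_RintegralZ; last first.
    have bF' : bmf (fun p : R * R => phi (rV_upd j (rV_upd i x p.2) p.1) * (f p.2 * g p.1)).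
      exact: (bmf_comp (@measurable_swap _ _ R R) bF).
    apply: (@bmf_Rintegral R _ _ (measurableTypeR R) (measurableTypeR R) mu (box_itv a i) _ _ _ bF').
    - exact: measurable_box_itv.
    - exact: box_itv_lty.
  apply: eq_Rintegral => t _; rewrite rV_upd_neq// -mulrA; congr (_ * _).
  rewrite mulrC -itv_RintegralZ; last exact: bU.
  by apply: eq_Rintegral => s _; rewrite (rV_updC x s t ij); ring.
by rewrite mulrCA.
Qed.

Definition ip (phi chi : 'rV[R]_n -> R) : R :=
  Rintegral (lebesgue_rV R n) (box a) (fun x => phi x * chi x).

Lemma bmf_box_integrable phi : bmf phi ->
  (lebesgue_rV R n).-integrable (box a) (EFin \o phi).
Proof.
move=> bp; apply: bmf_integrable => //; [exact: measurable_box|exact: box_lty].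
Qed.

Lemma ipC phi chi : ip phi chi = ip chi phi.
Proof. by apply: eq_Rintegral => x _; rewrite mulrC. Qed.

Lemma ipBl phi chi xi : bmf phi -> bmf chi -> bmf xi ->
  ip (phi - chi) xi = ip phi xi - ip chi xi.
Proof.
move=> bp bc bx; rewrite /ip -RintegralB; [|exact: measurable_box|..].
- by apply: eq_Rintegral => x _; rewrite mulrBl.
- by apply: bmf_box_integrable; exact: bmfM.
- by apply: bmf_box_integrable; exact: bmfM.
Qed.

Lemma ipDl phi chi xi : bmf phi -> bmf chi -> bmf xi ->
  ip (phi + chi) xi = ip phi xi + ip chi xi.
Proof.
move=> bp bc bx; rewrite /ip -RintegralD; [|exact: measurable_box|..].
- by apply: eq_Rintegral => x _; rewrite mulrDl.
- by apply: bmf_box_integrable; exact: bmfM.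
- by apply: bmf_box_integrable; exact: bmfM.
Qed.

Lemma ip_ge0 phi : 0 <= ip phi phi.
Proof. by apply: Rintegral_ge0 => x _; rewrite -expr2 sqr_ge0. Qed.

End fixed_dim.

Definition moment n (a : 'I_n.+1 -> R) (f : R -> R) i (phi : 'rV[R]_n.+1 -> R) (y : 'rV[R]_n) :=
  Rintegral mu (box_itv a i) (fun t => phi (rV_ins i (t, y)) * f t).

Lemma bmf_moment n (a : 'I_n.+1 -> R) f i phi : bmf f -> bmf phi -> bmf (moment a f i phi).
Proof.
move=> bf bp.
apply: (@bmf_Rintegral R _ _ 'rV[R]_n (measurableTypeR R) mu (box_itv a i)
  (fun p => phi (rV_ins i (p.2, p.1)) * f p.2)).
- exact: measurable_box_itv.
- exact: box_itv_lty.
- apply: bmfM; last by apply: (bmf_comp _ bf); exact: measurable_snd.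
  apply: (bmf_comp _ bp).
  exact: (measurableT_comp (@measurable_rV_ins R n i) (@measurable_swap _ _ 'rV[R]_n R)).
Qed.

(** Slicing in direction [i] makes the form of the operator factor through the moments. Symmetry
    becomes visible, and the problem drops by one dimension. *)
Lemma ip_partial_op n (a : 'I_n.+1 -> R) f i phi chi : bmf f -> bmf phi -> bmf chi ->
  ip a (partial_op a f i phi) chi = ip (box_del a i) (moment a f i phi) (moment a f i chi).
Proof.
move=> bf bp bc; rewrite /ip (@Rintegral_box_ins R n a i); last first.
  by apply: bmfM => //; exact: bmf_partial_op.
apply: eq_Rintegral => y _.
rewrite -[moment a f i phi y * _]itv_RintegralZ; last first.
  apply: bmfM => //; apply: (bmf_comp _ bc).
  exact: (measurableT_comp (@measurable_rV_ins R n i) (measurable_pair2 y)).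
apply: eq_Rintegral => t _; rewrite /partial_op rV_ins_eq /=.
under eq_Rintegral do rewrite rV_upd_ins.
by rewrite -/(moment a f i phi y); ring.
Qed.

End partial_projection.

(** * Products of commuting projections *)

Section commuting_projections.
Variables (R : realType) (V : zmodType) (B : V -> Prop) (f : V -> V -> R).
Hypotheses (BB : forall u v, B u -> B v -> B (u - v))
  (fC : forall u v, f u v = f v u)
  (fBl : forall u v w, B u -> B v -> B w -> f (u - v) w = f u w - f v w)
  (f_ge0 : forall u, 0 <= f u u).
Variables (I : eqType) (P : I -> V -> V).
Hypotheses (PB : forall i u, B u -> B (P i u))
  (PBl : forall i u v, B u -> B v -> P i (u - v) = P i u - P i v)
  (Psym : forall i u v, B u -> B v -> f (P i u) v = f u (P i v))
  (Pidem : forall i u, B u -> P i (P i u) = P i u)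
  (PC : forall i j u, B u -> P i (P j u) = P j (P i u)).

Definition compose_ops (s : seq I) (u : V) : V := foldr P u s.

Let compB s u : B u -> B (compose_ops s u).
Proof. by move=> Bu; elim: s => //= i s IH; exact: PB. Qed.

Lemma compose_opsC i s u : B u -> P i (compose_ops s u) = compose_ops s (P i u).
Proof.
by move=> Bu; elim: s => //= j s IH; rewrite PC ?IH//; exact: compB.
Qed.

Let compBl s u v : B u -> B v ->
  compose_ops s (u - v) = compose_ops s u - compose_ops s v.
Proof.
by move=> Bu Bv; elim: s => //= j s IH; rewrite IH PBl//; exact: compB.
Qed.

Let f_compl i u : B u -> f (u - P i u) (u - P i u) = f u u - f (P i u) u.
Proof.
move=> Bu; have BPu := PB i Bu.
have Buv : B (u - P i u) by exact: BB.
have e1 : f (P i u) (P i u) = f (P i u) u by rewrite -Psym ?Pidem.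
rewrite fBl// (fC u) (fC (P i u) (u - _)) !fBl// (fC u (P i u)) e1; ring.
Qed.

Let f_proj i u : B u -> f (P i u) (P i u) = f (P i u) u.
Proof. by move=> Bu; rewrite -Psym ?Pidem//; exact: PB. Qed.

Let contr i u : B u -> f (P i u) (P i u) <= f u u.
Proof. by move=> Bu; rewrite f_proj// -subr_ge0 -f_compl. Qed.

Let comp_contr s u : B u -> f (compose_ops s u) (compose_ops s u) <= f u u.
Proof.
by move=> Bu; elim: s => //= i s IH; apply: le_trans IH; apply: contr; exact: compB.
Qed.

(** For commuting projections, 1 - P_1...P_m <= sum (1 - P_i). One factor is added at a time: with
    [w] the image of [u] under the earlier factors, [|w|^2 - |P_i w|^2 = |(1 - P_i) w|^2], and
    [(1 - P_i) w] is the image of [(1 - P_i) u] under the same factors, which are contractions. *)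
Lemma compose_ops_defect s u : B u ->
  f u u - f (compose_ops s u) (compose_ops s u) <=
  \sum_(i <- s) (f u u - f (P i u) u).
Proof.
move=> Bu; elim: s => [|i s IH] /=; first by rewrite big_nil subrr.
rewrite big_cons; set w := compose_ops s u.
have Bw : B w by exact: compB.
have -> : f u u - f (P i w) (P i w) = (f w w - f (P i w) w) + (f u u - f w w).
  by rewrite f_proj//; ring.
apply: lerD => //; rewrite -!f_compl//.
have -> : w - P i w = compose_ops s (u - P i u).
  by rewrite compBl ?compose_opsC//; exact: PB.
by apply: comp_contr; apply: BB => //; exact: PB.
Qed.

Lemma compose_ops_sym s u v : B u -> B v ->
  f (compose_ops s u) v = f u (compose_ops s v).
Proof.
move=> Bu; elim: s v => //= i s IH v Bv.
by rewrite Psym ?IH ?compose_opsC//; [exact: PB|exact: compB].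
Qed.

Lemma compose_ops_fixed s i u : B u -> i \in s ->
  P i (compose_ops s u) = compose_ops s u.
Proof.
move=> Bu; elim: s => //= j s IH; rewrite inE => /predU1P[->|si].
  by rewrite Pidem//; exact: compB.
by rewrite PC ?IH//; exact: compB.
Qed.

End commuting_projections.

(** * Tensor products and Parseval's identity *)

Section tensor.
Variable R : realType.
Local Notation mu := (@lebesgue_measure R).
Local Notation bmf := bounded_measurable.

Definition orthonormal_pair n (a : 'I_n -> R) (f : 'I_n -> bool -> R -> R) : Prop :=
  forall i s, bmf (f i s) /\
    forall r, Rintegral mu (box_itv a i) (fun t => f i s t * f i r t) = (s == r)%:R.

Definition coord_proj n (a : 'I_n -> R) (f : 'I_n -> bool -> R -> R) i
    (phi : 'rV[R]_n -> R) : 'rV[R]_n -> R :=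
  partial_op a (f i true) i phi + partial_op a (f i false) i phi.

Fixpoint tensors n : ('I_n -> bool -> R -> R) -> seq ('rV[R]_n -> R) :=
  match n with
  | 0 => fun=> [:: fun=> 1]
  | m.+1 => fun f => [seq (fun x : 'rV[R]_m.+1 => f ord0 s (x ord0 ord0) *
      Psi (rV_uncons x).2) | s <- [:: true; false],
      Psi <- tensors (fun k => f (lift ord0 k))]
  end.

Lemma size_tensors n (f : 'I_n -> bool -> R -> R) : size (tensors f) = (2 ^ n)%N.
Proof. by elim: n f => //= n IH f; rewrite !size_cat !size_map IH addn0 addnn -mul2n expnS. Qed.

Section fixed_dim.
Variables (n : nat) (a : 'I_n -> R) (f : 'I_n -> bool -> R -> R).
Hypothesis ofn : orthonormal_pair a f.

Let bf i s : bmf (f i s). Proof. by have [] := ofn i s. Qed.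

Let bop i s phi : bmf phi -> bmf (partial_op a (f i s) i phi).
Proof. exact: bmf_partial_op. Qed.

Lemma bmf_coord_proj i phi : bmf phi -> bmf (coord_proj a f i phi).
Proof. by move=> bp; apply: bmfD; exact: bop. Qed.

Lemma coord_projB i phi chi : bmf phi -> bmf chi ->
  coord_proj a f i (phi - chi) = coord_proj a f i phi - coord_proj a f i chi.
Proof. by move=> bp bc; rewrite /coord_proj !partial_opB// addrACA opprD. Qed.

Let partial_opD g i phi chi : bmf g -> bmf phi -> bmf chi ->
  partial_op a g i (phi + chi) = partial_op a g i phi + partial_op a g i chi.
Proof.
move=> bg bp bc; apply: (addIr (- partial_op a g i chi)).
rewrite -partial_opB//; last exact: bmfD.
by rewrite !addrK.
Qed.

Lemma partial_op_orth i s r phi : bmf phi ->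
  partial_op a (f i s) i (partial_op a (f i r) i phi) =
  if s == r then partial_op a (f i s) i phi else 0.
Proof.
move=> bp; apply/funext => x; rewrite partial_op_op//.
have [_ ->] := ofn i r; case: (eqVneq s r) => [->|sr].
  by rewrite mul1r.
by rewrite mul0r mulr0.
Qed.

Lemma coord_proj_idem i phi : bmf phi ->
  coord_proj a f i (coord_proj a f i phi) = coord_proj a f i phi.
Proof.
move=> bp; rewrite {1}/coord_proj /coord_proj.
rewrite !partial_opD//; try exact: bop.
by rewrite !partial_op_orth//= addr0 add0r.
Qed.

Lemma coord_projC i j phi : bmf phi ->
  coord_proj a f i (coord_proj a f j phi) = coord_proj a f j (coord_proj a f i phi).
Proof.
move=> bp; have [<-//|ij] := eqVneq i j.
rewrite /coord_proj !partial_opD//; try exact: bop.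
by rewrite !(@partial_opC R n a _ _ i j)// addrACA.
Qed.

End fixed_dim.

Lemma coord_proj_sym n (a : 'I_n -> R) f i phi chi : orthonormal_pair a f ->
  bmf phi -> bmf chi ->
  ip a (coord_proj a f i phi) chi = ip a phi (coord_proj a f i chi).
Proof.
case: n a f i phi chi => [|n] a f i phi chi ofn bp bc; first by case: i.
have bf s : bmf (f i s) by have [] := ofn i s.
have bo s g : bmf g -> bmf (partial_op a (f i s) i g) by exact: bmf_partial_op.
have E s : ip a (partial_op a (f i s) i phi) chi = ip a (partial_op a (f i s) i chi) phi.
  apply: (etrans (ip_partial_op a i (bf s) bp bc)).
  by apply: esym; apply: (etrans (ip_partial_op a i (bf s) bc bp)); exact: ipC.
rewrite [RHS]ipC /coord_proj ipDl//; try exact: bo.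
rewrite [RHS]ipDl//; try exact: bo.
by rewrite !E.
Qed.

(** An operator in another coordinate passes under the moment in coordinate zero by Fubini. Hence
    the moments of a fixed vector are fixed in the lower dimension, which feeds the induction of
    [ip_fixed]. *)
Lemma moment_partial_op n (a : 'I_n.+1 -> R) g h (i : 'I_n) chi y :
  bmf g -> bmf h -> bmf chi ->
  partial_op (box_del a ord0) g i (moment a h ord0 chi) y =
  moment a h ord0 (partial_op a g (lift ord0 i) chi) y.
Proof.
move=> bg bh bc; rewrite /partial_op /moment.
have bF : bmf (fun p : R * R => chi (rV_ins ord0 (p.2, rV_upd i y p.1)) * (h p.2 * g p.1)).
  apply: bmfM.
    apply: (bmf_comp _ bc).
    have m1 : measurable_fun setT (fun p : R * R => (y, p.1)).
      by apply/measurable_fun_pair => //; exact: measurable_fst.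
    have m2 : measurable_fun setT (fun p : R * R => (p.2, rV_upd i y p.1)).
      apply/measurable_fun_pair => /=; first exact: measurable_snd.
      exact: (measurableT_comp (@measurable_rV_upd R n i) m1).
    exact: (measurableT_comp (@measurable_rV_ins R n ord0) m2).
  by apply: bmfM; [apply: (bmf_comp _ bh); exact: measurable_snd|
                   apply: (bmf_comp _ bg); exact: measurable_fst].
have ex := Rintegral_exchange (m1 := mu) (m2 := mu) (measurable_box_itv (box_del a ord0) i)
  (measurable_box_itv a ord0) (box_itv_lty (box_del a ord0) i) (box_itv_lty a ord0) bF.
transitivity (g (y ord0 i) * Rintegral mu (box_itv (box_del a ord0) i) (fun t =>
   Rintegral mu (box_itv a ord0) (fun s => chi (rV_ins ord0 (s, rV_upd i y t)) * (h s * g t)))).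
  congr (_ * _); apply: eq_Rintegral => t _.
  rewrite mulrC -itv_RintegralZ; last first.
    apply: bmfM; last exact: bh.
    apply: (bmf_comp _ bc).
    exact: (measurableT_comp (@measurable_rV_ins R n ord0) (measurable_pair2 _)).
  by apply: eq_Rintegral => s _; ring.
rewrite ex /= -itv_RintegralZ; last first.
  have bF' : bmf (fun p : R * R => chi (rV_ins ord0 (p.1, rV_upd i y p.2)) * (h p.1 * g p.2)).
    exact: (bmf_comp (@measurable_swap _ _ R R) bF).
  apply: (@bmf_Rintegral R _ _ (measurableTypeR R) (measurableTypeR R) mu (box_itv (box_del a ord0) i) _ _ _ bF').
  - exact: measurable_box_itv.
  - exact: box_itv_lty.
apply: eq_Rintegral => s _; rewrite rV_ins_lift /= -mulrA; congr (_ * _).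
rewrite mulrC -itv_RintegralZ; last first.
  by apply: bmfM; [exact: bmf_upd|exact: bg].
by apply: eq_Rintegral => t _; rewrite rV_upd_cons; ring.
Qed.

Lemma orthonormal_pair_lift n (a : 'I_n.+1 -> R) f : orthonormal_pair a f ->
  orthonormal_pair (box_del a ord0) (fun k => f (lift ord0 k)).
Proof. by move=> ofn i s; exact: (ofn (lift ord0 i)). Qed.

Lemma measurable_rV_uncons2 n :
  measurable_fun setT (fun x : 'rV[R]_n.+1 => (rV_uncons x).2).
Proof. exact: (measurableT_comp measurable_snd (@measurable_rV_uncons R n)). Qed.

Lemma Forall_map (S T : Type) (h : S -> T) (Q : T -> Prop) (s : seq S) :
  List.Forall (Q \o h) s -> List.Forall Q (map h s).
Proof. by elim: s => //= x s IH H; inversion_clear H; constructor => //; exact: IH. Qed.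

Lemma Forall_impl (T : Type) (Q Q' : T -> Prop) (s : seq T) :
  (forall x, Q x -> Q' x) -> List.Forall Q s -> List.Forall Q' s.
Proof.
by move=> QQ'; elim: s => //= x s IH H; inversion_clear H; constructor; auto.
Qed.

Lemma eq_bigr_Forall (T : Type) (Q : T -> Prop) (F G : T -> R) (s : seq T) :
  List.Forall Q s -> (forall x, Q x -> F x = G x) ->
  \sum_(x <- s) F x = \sum_(x <- s) G x.
Proof.
move=> Qs FG; elim: s Qs => [|x s IH] H; first by rewrite !big_nil.
by inversion_clear H; rewrite !big_cons FG// IH.
Qed.

Lemma bmf_tensors n (a : 'I_n -> R) f : orthonormal_pair a f ->
  List.Forall (@bounded_measurable R _ _) (tensors f).
Proof.
elim: n a f => [|n IH] a f ofn /=.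
  by constructor => //; exact: bmf_cst.
have H s : List.Forall (@bounded_measurable R _ _) [seq (fun x : 'rV[R]_n.+1 => f ord0 s (x ord0 ord0) *
      Psi (rV_uncons x).2) | Psi <- tensors (fun k => f (lift ord0 k))].
  apply: Forall_map; apply: (Forall_impl _ (IH _ _ (orthonormal_pair_lift ofn))).
  move=> Psi bP /=; apply: bmfM; last exact: (bmf_comp (@measurable_rV_uncons2 n) bP).
  by apply: bmf_coord; have [] := ofn ord0 s.
by apply/List.Forall_app; split => //; apply/List.Forall_app; split.
Qed.

Lemma rV_uncons_ins0 n t (y : 'rV[R]_n) : rV_uncons (rV_ins ord0 (t, y)) = (t, y).
Proof. by rewrite rV_ins0 rV_uncons_consK. Qed.

(** Parseval on the common range of all projections. Since the projection in coordinate zero fixes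
    [chi], the norm splits into the norms of the two moments in that coordinate; these are fixed by
    the remaining projections, and induction expands each of them. *)
Lemma ip_fixed n (a : 'I_n -> R) f chi : orthonormal_pair a f -> bmf chi ->
  (forall i, coord_proj a f i chi = chi) ->
  ip a chi chi = \sum_(Psi <- tensors f) ip a chi Psi ^+ 2.
Proof.
elim: n a f chi => [|n IH] a f chi ofn bc fx.
  rewrite /= big_seq1.
  have cE x : chi x = chi 0 by congr chi; apply/rowP => -[].
  (* In dimension zero the space is one point of mass one, and the only tensor is the constant 1. *)
  have E r : Rintegral (lebesgue_rV R 0) (box a) (cst r) = r.
    rewrite Rintegral_cst; last exact: measurable_box.
    have b0 : box a 0 by case.
    by rewrite [X in _ * fine X](lebesgue_rV0 b0) /= mulr1.
  have -> : ip a chi chi = chi 0 * chi 0.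
    by rewrite -[RHS]E; apply: eq_Rintegral => x _ /=; rewrite cE.
  have -> : ip a chi (fun=> 1) = chi 0; last by rewrite expr2.
  by rewrite -[RHS]E; apply: eq_Rintegral => x _ /=; rewrite cE mulr1.
pose f' k := f (lift ord0 k); pose a' := box_del a ord0.
have of' : orthonormal_pair a' f' := orthonormal_pair_lift ofn.
have bf i s : bmf (f i s) by have [] := ofn i s.
have bf' i s : bmf (f' i s) by exact: bf.
pose m s := moment a (f ord0 s) ord0 chi.
have bm s : bmf (m s) by exact: bmf_moment.
have bo i s : bmf (partial_op a (f i s) i chi) by exact: bmf_partial_op.
have mfx s i : coord_proj a' f' i (m s) = m s.
  apply/funext => y; rewrite {1}/coord_proj fctE !moment_partial_op//.
  rewrite -[RHS]/(moment a (f ord0 s) ord0 chi y) -[in RHS](fx (lift ord0 i)).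
  rewrite /moment -RintegralD; [|exact: measurable_box_itv|..].
  - by apply: eq_Rintegral => t _; rewrite /coord_proj fctE mulrDl.
  - apply: bmf_itv_integrable; apply: bmfM => //; apply: (bmf_comp _ (bo _ _)).
    exact: (measurableT_comp (@measurable_rV_ins R n ord0) (measurable_pair2 _)).
  - apply: bmf_itv_integrable; apply: bmfM => //; apply: (bmf_comp _ (bo _ _)).
    exact: (measurableT_comp (@measurable_rV_ins R n ord0) (measurable_pair2 _)).
have E r : ip a (partial_op a (f ord0 r) ord0 chi) chi =
    \sum_(Psi <- tensors f') ip a chi (fun x : 'rV[R]_n.+1 =>
      f ord0 r (x ord0 ord0) * Psi (rV_uncons x).2) ^+ 2.
  rewrite ip_partial_op// -/(m r) (IH a' f')//.
  apply: (eq_bigr_Forall (bmf_tensors of')) => Psi bP; congr (_ ^+ 2).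
  rewrite [RHS]/ip (@Rintegral_box_ins R n a ord0); last first.
    apply: bmfM => //; apply: bmfM; first exact: bmf_coord.
    exact: (bmf_comp (@measurable_rV_uncons2 n) bP).
  apply: eq_Rintegral => z _; rewrite mulrC -itv_RintegralZ; last first.
    apply: bmfM => //; apply: (bmf_comp _ bc).
    exact: (measurableT_comp (@measurable_rV_ins R n ord0) (measurable_pair2 _)).
  by apply: eq_Rintegral => u _; rewrite rV_ins_eq rV_uncons_ins0/=; ring.
rewrite -{1}(fx ord0) /coord_proj ipDl// !E /= !big_cat /= !big_map big_nil addr0.
by [].
Qed.

End tensor.

(** * Normalized exponentials at the two ends of an interval *)

Section end_functions.
Variable R : realType.
Local Notation mu := (@lebesgue_measure R).
Local Notation bmf := bounded_measurable.

Definition half_itv (a : R) (s : bool) : set R :=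
  if s then `]0, a[%classic else `]- a, 0[%classic.

Definition end_exp (a t : R) (s : bool) (x : R) : R :=
  expR ((if s then t else - t) * (x - (if s then a else - a))).

Definition end_norm2 a t s := Rintegral mu (half_itv a s) (fun x => end_exp a t s x ^+ 2).

(** The supports for the two values of [s] are disjoint, which makes the pair exactly orthonormal;
    uncut exponentials would overlap. *)
Definition end_fun a t s : R -> R :=
  (fun x => end_exp a t s x / Num.sqrt (end_norm2 a t s)) \_ (half_itv a s).

Lemma end_exp_continuous a t s : continuous (end_exp a t s).
Proof. exact: continuous_expR_affine. Qed.

Lemma half_itv_sub a s : 0 < a -> half_itv a s `<=` `]- a, a[%classic.
Proof.
move=> a0; case: s => x /=; rewrite !in_itv/=; lra.
Qed.

Lemma measurable_half_itv a s : @measurable _ (measurableTypeR R) (half_itv a s).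
Proof. by case: s; exact: measurable_itv. Qed.

Lemma continuous_bounded_half a s (f : R -> R) : continuous f ->
  bounded_on (half_itv a s) f.
Proof.
move=> cf.
have /continuous_compact /(_ (@segment_compact _ _ _)) : {within `[- a, a], continuous f}.
  exact: continuous_subspaceT.
move=> /compact_bounded[M [_ HM]]; exists (M + 1) => x xa.
apply: (HM (M + 1)); first by rewrite ltrDl.
exists x => //; move: xa; rewrite /half_itv /=; case: (s); rewrite /= !in_itv/=; lra.
Qed.

Lemma bmf_patch_half a s (f : R -> R) : continuous f -> bmf (f \_ (half_itv a s)).
Proof.
move=> cf; apply: bounded_on_patch; first exact: measurable_half_itv.
  exact: continuous_measurable_fun.
exact: continuous_bounded_half.
Qed.

Lemma bmf_end_fun a t s : bmf (end_fun a t s).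
Proof.
apply: bmf_patch_half => x; apply: cvgM; last exact: cvg_cst.
exact: end_exp_continuous.
Qed.

Lemma half_integrable a s (f : R -> R) : continuous f ->
  mu.-integrable (half_itv a s) (EFin \o f).
Proof. by move=> cf; case: s; rewrite /half_itv; exact: continuous_integrable_oo. Qed.

Lemma Rintegral_half a s (f : R -> R) : 0 < a ->
  Rintegral mu `]- a, a[%classic (f \_ (half_itv a s)) = Rintegral mu (half_itv a s) f.
Proof.
move=> a0; rewrite -Rintegral_mkcondr setIidr//; exact: half_itv_sub.
Qed.

Section fixed.
Variables (a t K : R).
Hypotheses (a0 : 0 < a) (t0 : 0 < t) (eta4 : 4 * expR (- t * a) < 1)
  (K1 : 1 <= K * (1 - 4 * expR (- t * a))).

Let half_endpoint s (g : R -> R) :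
  (forall x : R, derivable g x 1) -> continuous (derive1 g) ->
  0 < end_norm2 a t s /\
  t * g (if s then a else - a) ^+ 2 <=
    Rintegral mu (half_itv a s) (fun x => derive1 g x ^+ 2) +
    K * t ^+ 2 * (Rintegral mu (half_itv a s) (fun x => g x * end_exp a t s x) ^+ 2
       / end_norm2 a t s).
Proof.
move=> dg cg.
have a1 : - a < 0 by rewrite oppr_lt0.
have ea : expR (- t * (0 - - a)) = expR (- t * a) by rewrite sub0r opprK.
case: s; rewrite /half_itv /end_norm2 /end_exp.
  have := @endpoint_le R g 0 a t true K a0 t0; cbv zeta iota; rewrite subr0 => H.
  exact: (H eta4 K1 dg cg).
have := @endpoint_le R g (- a) 0 t false K a1 t0; cbv zeta iota; rewrite ea => H.
exact: (H eta4 K1 dg cg).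
Qed.

(** [endpoint_le] delivers the positivity along with its inequality; it is extracted by applying it
    to the zero function. *)
Lemma end_norm2_gt0 s : 0 < end_norm2 a t s.
Proof.
have d0 (x : R) : derivable (cst 0 : R -> R) x 1 by exact: derivable_cst.
have E : derive1 (cst 0 : R -> R) = cst 0.
  by apply/funext => x; rewrite derive1_cst.
by have [] := half_endpoint s d0; first by rewrite E; exact: cst_continuous.
Qed.

Lemma end_fun_moment s (g : R -> R) : continuous g ->
  Rintegral mu `]- a, a[%classic (fun x => g x * end_fun a t s x) =
  Rintegral mu (half_itv a s) (fun x => g x * end_exp a t s x) / Num.sqrt (end_norm2 a t s).
Proof.
move=> cg; rewrite -RintegralZr; last first.
- apply: half_integrable.
  by move=> x; apply: cvgM; [exact: cg|exact: end_exp_continuous].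
- exact: measurable_half_itv.
rewrite -Rintegral_half//; apply: eq_Rintegral => x _.
by rewrite /end_fun !patchE; case: ifP => _; rewrite ?mulr0// mulrA.
Qed.

(** [endpoint_le] on each half-interval; the gradient terms add up to at most the whole because the
    halves do not overlap. *)
Lemma endpoints_le (g : R -> R) :
  (forall x : R, derivable g x 1) -> continuous (derive1 g) ->
  t * (g a ^+ 2 + g (- a) ^+ 2) <=
    Rintegral mu `]- a, a[%classic (fun x => derive1 g x ^+ 2) +
    K * t ^+ 2 * (Rintegral mu `]- a, a[%classic (fun x => g x * end_fun a t true x) ^+ 2 +
                  Rintegral mu `]- a, a[%classic (fun x => g x * end_fun a t false x) ^+ 2).
Proof.
move=> dg cg.
have cgg : continuous g by exact: derivable_continuous.
have sq (X N : R) : 0 < N -> (X / Num.sqrt N) ^+ 2 = X ^+ 2 / N.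
  by move=> N0; rewrite exprMn exprVn sqr_sqrtr// ltW.
have M s : Rintegral mu `]- a, a[%classic (fun x => g x * end_fun a t s x) ^+ 2 =
   Rintegral mu (half_itv a s) (fun x => g x * end_exp a t s x) ^+ 2 / end_norm2 a t s.
  by rewrite end_fun_moment; [exact: (sq _ _ (end_norm2_gt0 s))|exact: cgg].
have c2 : continuous (fun x => derive1 g x ^+ 2) by exact: continuous_sqr.
have fin (A1 A2 A X1 X2 Y1 Y2 G1 G2 c : R) : Y1 = X1 -> Y2 = X2 ->
    t * G1 <= A1 + c * X1 -> t * G2 <= A2 + c * X2 -> A1 + A2 <= A ->
    t * (G1 + G2) <= A + c * (Y1 + Y2) by move=> -> ->; lra.
apply: (fin _ _ _ _ _ _ _ _ _ _ (M true) (M false)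
  (proj2 (half_endpoint true dg cg)) (proj2 (half_endpoint false dg cg))).
have ia s : mu.-integrable `]- a, a[%classic
    (EFin \o ((fun x => derive1 g x ^+ 2) \_ (half_itv a s))).
  apply: bmf_integrable; [exact: measurable_itv|exact: (box_itv_lty (fun=> a) (ord0 : 'I_1))|].
  exact: bmf_patch_half.
rewrite -!Rintegral_half// -RintegralD; [|exact: measurable_itv|exact: ia..].
apply: le_Rintegral; [exact: measurable_itv|..|].
- apply: bmf_integrable; [exact: measurable_itv|exact: (box_itv_lty (fun=> a) (ord0 : 'I_1))|].
  by apply: bmfD; exact: bmf_patch_half.
- exact: continuous_integrable_oo.
- have dj x : half_itv a true x -> half_itv a false x -> False.
    by rewrite /half_itv /= !in_itv/=; lra.
  move=> x _; rewrite /patch.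
  have [xr|_] := boolP (x \in half_itv a true); last first.
    by rewrite add0r; case: ifP => _; [exact: lexx|exact: sqr_ge0].
  have [xs|_] := boolP (x \in half_itv a false); last by rewrite addr0.
  by case: (dj x); [exact: set_mem xr|exact: set_mem xs].
Qed.

Lemma end_fun_orthonormal s r :
  Rintegral mu `]- a, a[%classic (fun x => end_fun a t s x * end_fun a t r x) = (s == r)%:R.
Proof.
case: (eqVneq s r) => [<-|sr].
  have -> : Rintegral mu `]- a, a[%classic (fun x => end_fun a t s x * end_fun a t s x) =
     Rintegral mu `]- a, a[%classic
       ((fun x => end_exp a t s x ^+ 2 / end_norm2 a t s) \_ (half_itv a s)).
    apply: eq_Rintegral => x _; rewrite /end_fun /patch.
    case: ifP => _; rewrite ?mul0r// -expr2 exprMn exprVn sqr_sqrtr//.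
    by apply: ltW; exact: end_norm2_gt0.
  have N0 := end_norm2_gt0 s; have N1 : end_norm2 a t s != 0 by rewrite gt_eqF.
  rewrite (Rintegral_half _ _ a0) RintegralZr; [exact: (divff N1)|exact: measurable_half_itv|].
  by apply: half_integrable; apply: continuous_sqr; exact: end_exp_continuous.
have -> : Rintegral mu `]- a, a[%classic (fun x => end_fun a t s x * end_fun a t r x) =
    Rintegral mu `]- a, a[%classic (cst 0).
  have dj x : half_itv a s x -> half_itv a r x -> False.
    by rewrite /half_itv; case: (s) (r) sr => -[]//= _; rewrite !in_itv/=; lra.
  apply: eq_Rintegral => x _; rewrite /end_fun /patch /cst.
  have [xr|] := boolP (x \in half_itv a r); last by rewrite mulr0.
  have [xs|] := boolP (x \in half_itv a s); last by rewrite mul0r.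
  by case: (dj x); [exact: set_mem xs|exact: set_mem xr].
by rewrite Rintegral_cst; [rewrite mul0r|exact: measurable_itv].
Qed.

End fixed.
End end_functions.

(** * The boundary inequality on the box for real C^1 functions *)

Section energy.
Variable R : realType.
Local Notation mu := (@lebesgue_measure R).
Local Notation bmf := bounded_measurable.

Variables (n : nat) (a : 'I_n.+1 -> R) (t K : R).
Hypotheses (a0 : forall i, 0 < a i) (t0 : 0 < t) (K0 : 0 <= K)
  (eta4 : forall i, 4 * expR (- t * a i) < 1)
  (K1 : forall i, 1 <= K * (1 - 4 * expR (- t * a i))).

Let f (i : 'I_n.+1) s := end_fun (a i) t s.

Let fon : orthonormal_pair a f.
Proof.
move=> i s; split; first exact: bmf_end_fun.
by move=> r; exact: (end_fun_orthonormal (a0 i) t0 (eta4 i) (K1 i)).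
Qed.

Let P := coord_proj a f.
Let C := compose_ops P (enum 'I_n.+1).

(** [C] is applied to the tensors so that the symmetry [<C u, Psi> = <u, C Psi>] alone turns
    coefficients of [C u] into coefficients of [u]. *)
Definition end_tensors : seq ('rV[R]_n.+1 -> R) := [seq C Psi | Psi <- tensors f].

Lemma size_end_tensors : size end_tensors = (2 ^ n.+1)%N.
Proof. by rewrite size_map size_tensors. Qed.

Let bB (u v : 'rV[R]_n.+1 -> R) : bmf u -> bmf v -> bmf (u - v).
Proof. exact: bmfB. Qed.

Let bP i u : bmf u -> bmf (P i u). Proof. exact: bmf_coord_proj. Qed.

Let bC s u : bmf u -> bmf (compose_ops P s u).
Proof. by move=> bu; elim: s => //= i s IH; exact: bP. Qed.

Lemma bmf_end_tensors : List.Forall (@bounded_measurable R _ _) end_tensors.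
Proof.
apply: Forall_map; apply: (Forall_impl _ (bmf_tensors fon)) => Psi.
exact: bC.
Qed.

Let Psym i u v : bmf u -> bmf v -> ip a (P i u) v = ip a u (P i v).
Proof. exact: coord_proj_sym. Qed.
Let PBl i u v : bmf u -> bmf v -> P i (u - v) = P i u - P i v.
Proof. exact: coord_projB. Qed.
Let Pidem i u : bmf u -> P i (P i u) = P i u.
Proof. exact: coord_proj_idem. Qed.
Let PC i j u : bmf u -> P i (P j u) = P j (P i u).
Proof. exact: coord_projC. Qed.

(** [compose_ops_defect] rearranged to sum P_i <= (d - 1) + C with [d = n.+1]; the norm of [C u], a
    vector fixed by every [P i], is expanded by [ip_fixed]. *)
Lemma projection_sum_le (u : 'rV[R]_n.+1 -> R) : bmf u ->
  \sum_i ip a (P i u) u <= n%:R * ip a u u + \sum_(Psi <- end_tensors) ip a u Psi ^+ 2.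
Proof.
move=> bu.
have := compose_ops_defect bB (ipC a) (@ipBl R _ a) (@ip_ge0 R _ a) bP PBl Psym Pidem PC
  (enum 'I_n.+1) bu.
rewrite -/(C u) big_enum /= sumrB sumr_const card_ord.
rewrite (ip_fixed fon (bC _ bu)); last first.
  by move=> i; apply: (compose_ops_fixed bP Pidem PC) => //; rewrite mem_enum.
have -> : \sum_(Psi <- tensors f) ip a (C u) Psi ^+ 2 =
   \sum_(Psi <- end_tensors) ip a u Psi ^+ 2.
  rewrite big_map; apply: (eq_bigr_Forall (bmf_tensors fon)) => Psi bPsi.
  by rewrite (compose_ops_sym bP Psym PC).
have -> : \sum_(i in 'I_n.+1) ip a (P i u) u = \sum_i ip a (P i u) u by exact: eq_bigl.
rewrite mulrS -(mulr_natl (ip a u u) n); lra.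
Qed.

Section function.
Variable phi : 'rV[R]_n.+1 -> R.
Hypotheses (cphi : continuous phi)
  (dphi : forall i x, derivable phi x (dir R i))
  (cdphi : forall i, continuous ('D_(dir R i) phi : 'rV[R]_n.+1 -> R)).

Let u := phi \_ (box a).

Let bu : bmf u.
Proof.
apply: bounded_on_patch; [exact: measurable_box|exact: continuous_measurable_rV|].
have [M HM] := @continuous_bounded_box _ _ a _ cphi.
by exists M => x /box_closed_box/HM.
Qed.

(** The inequality [endpoints_le] on the segments in direction [i], integrated over the face; the
    squared moments integrate to the form of [P i]. *)
Lemma energy_coord i :
  t * Rintegral (lebesgue_rV R n) (box (box_del a i))
    (fun y => phi (rV_ins i (a i, y)) ^+ 2 + phi (rV_ins i (- a i, y)) ^+ 2) <=
  Rintegral (lebesgue_rV R n.+1) (box a) (fun x => 'D_(dir R i) phi x ^+ 2) +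
  K * t ^+ 2 * ip a (P i u) u.
Proof.
pose D x := 'D_(dir R i) phi x ^+ 2.
have cD : continuous D by exact: continuous_sqr.
have bD : bmf (D \_ (box a)).
  apply: bounded_on_patch; [exact: measurable_box|exact: continuous_measurable_rV|].
  have [M HM] := @continuous_bounded_box _ _ a _ cD.
  by exists M => x /box_closed_box/HM.
pose J y := Rintegral mu (box_itv a i) (fun s => (D \_ (box a)) (rV_ins i (s, y))).
have bJ : bmf J.
  apply: (@bmf_Rintegral R _ _ 'rV[R]_n (measurableTypeR R) mu (box_itv a i)
    (fun p => (D \_ (box a)) (rV_ins i (p.2, p.1)))).
  - exact: measurable_box_itv.
  - exact: box_itv_lty.
  - apply: (bmf_comp _ bD).
    exact: (measurableT_comp (@measurable_rV_ins R n i) (@measurable_swap _ _ 'rV[R]_n R)).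
have -> : Rintegral (lebesgue_rV R n.+1) (box a) (fun x => 'D_(dir R i) phi x ^+ 2) =
    Rintegral (lebesgue_rV R n) (box (box_del a i)) J.
  rewrite -(Rintegral_box_ins a i bD); apply: eq_Rintegral => x xa.
  by rewrite /patch xa.
pose m s := moment a (f i s) i u.
have bf s : bmf (f i s) by have [] := fon i s.
have bm s : bmf (m s) by exact: bmf_moment.
have bo s : bmf (partial_op a (f i s) i u) by exact: bmf_partial_op.
have -> : ip a (P i u) u = Rintegral (lebesgue_rV R n) (box (box_del a i))
    (fun y => m true y * m true y + m false y * m false y).
  apply: (etrans (ipDl _ (bo true) (bo false) bu)).
  have E s : ip a (partial_op a (f i s) i u) u = ip (box_del a i) (m s) (m s).
    exact: ip_partial_op.
  apply: (etrans (congr2 +%R (E true) (E false))).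
  by apply: esym; apply: RintegralD; [exact: measurable_box|apply: bmf_box_integrable; exact: bmfM..].
have bb s : bmf ((fun y => phi (rV_ins i (if s then a i else - a i, y)) ^+ 2) \_ (box (box_del a i))).
  apply: bounded_on_patch; first exact: measurable_box.
    have c2 : continuous (fun x => phi x ^+ 2) by exact: continuous_sqr.
    apply: (measurableT_comp (continuous_measurable_rV c2)).
    exact: (measurableT_comp (@measurable_rV_ins R n i) (measurable_pair1 _)).
  have [M HM] := @continuous_bounded_box _ _ a _ (continuous_sqr cphi).
  exists M => y ya; apply: HM; apply: closed_box_ins => //.
  by have := a0 i; case: (s); lra.
have ii s : (lebesgue_rV R n).-integrable (box (box_del a i))
    (EFin \o (fun y => phi (rV_ins i (if s then a i else - a i, y)) ^+ 2)).
  apply: eq_integrable (bmf_box_integrable (box_del a i) (bb s)); first exact: measurable_box.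
  by move=> y ya /=; rewrite /patch ya.
rewrite -RintegralZl; [|exact: measurable_box|]; last first.
  have := integrableD (measurable_box _) (ii true) (ii false).
  by apply: eq_integrable => //; exact: measurable_box.
have bmm : bmf (fun y => m true y * m true y + m false y * m false y).
  by apply: bmfD; exact: bmfM.
rewrite -RintegralZl; [|exact: measurable_box|exact: bmf_box_integrable].
rewrite -RintegralD; [|exact: measurable_box|exact: bmf_box_integrable|]; last first.
  by apply: bmf_box_integrable; exact: bmfZ.
apply: le_Rintegral; [exact: measurable_box|..].
- have := integrableD (measurable_box _) (ii true) (ii false).
  move=> /(integrableZl (measurable_box _) t).
  by apply: eq_integrable => //; exact: measurable_box.
- by apply: bmf_box_integrable; apply: bmfD => //; exact: bmfZ.
move=> y ya.
pose g s := phi (rV_ins i (s, y)).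
have dg (s : R) : derivable g s 1 by exact: derivable_slice.
have Eg : derive1 g = fun s => 'D_(dir R i) phi (rV_ins i (s, y)).
  by apply/funext => s; rewrite derive_slice.
have cg : continuous (derive1 g).
  rewrite Eg => s.
  exact: (continuous_comp (@continuous_rV_ins R n i y s) (@cdphi i (rV_ins i (s, y)))).
have EJ : Rintegral mu `]- a i, a i[%classic (fun x => derive1 g x ^+ 2) = J y.
  apply: eq_Rintegral => s sa; rewrite Eg /patch ifT//.
  by apply/mem_set/box_ins; split => //; exact: set_mem.
have E s : Rintegral mu `]- a i, a i[%classic (fun x => g x * end_fun (a i) t s x) = m s y.
  apply: eq_Rintegral => r ra; rewrite /u /patch ifT//.
  by apply/mem_set/box_ins; split => //; exact: set_mem.
have aux (T L L' c p q p' q' : R) : L' = L -> p' = p -> q' = q ->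
    T <= L' + c * (p' ^+ 2 + q' ^+ 2) -> T <= L + c * (p * p + q * q).
  by move=> -> -> ->; rewrite !expr2.
exact: (aux _ _ _ _ _ _ _ _ EJ (E true) (E false)
  (endpoints_le (a0 i) t0 (eta4 i) (K1 i) dg cg)).
Qed.

Lemma energy_le :
  t * \sum_i Rintegral (lebesgue_rV R n) (box (box_del a i))
    (fun y => phi (rV_ins i (a i, y)) ^+ 2 + phi (rV_ins i (- a i, y)) ^+ 2) <=
  \sum_i Rintegral (lebesgue_rV R n.+1) (box a) (fun x => 'D_(dir R i) phi x ^+ 2) +
  K * t ^+ 2 * (n%:R * Rintegral (lebesgue_rV R n.+1) (box a) (fun x => phi x ^+ 2) +
    \sum_(Psi <- end_tensors)
      Rintegral (lebesgue_rV R n.+1) (box a) (fun x => phi x * Psi x) ^+ 2).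
Proof.
have E1 : Rintegral (lebesgue_rV R n.+1) (box a) (fun x => phi x ^+ 2) = ip a u u.
  by apply: eq_Rintegral => x xa; rewrite /u /patch xa expr2.
have E2 Psi : Rintegral (lebesgue_rV R n.+1) (box a) (fun x => phi x * Psi x) = ip a u Psi.
  by apply: eq_Rintegral => x xa; rewrite /u /patch xa.
rewrite E1; under [X in _ <= _ + _ * (_ + X)]eq_bigr do rewrite E2.
have H := projection_sum_le bu.
have Kt : 0 <= K * t ^+ 2 by rewrite mulr_ge0// sqr_ge0.
have := ler_wpM2l Kt H; rewrite mulr_sumr => H'.
apply: le_trans (lerD (lexx _) H').
rewrite mulr_sumr -big_split /=; apply: ler_sum => i _; exact: energy_coord.
Qed.

End function.
End energy.

(** * Complex-valued square-integrable functions *)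

Arguments Cre : simpl never.
Arguments Cim : simpl never.
Arguments Cmk : simpl never.
Arguments Cconj : simpl never.

Section complex_algebra.
Variable R : realType.
Local Notation C := (Cplx R).
Implicit Types x y : C.

Lemma C_eq x y : Cre x = Cre y -> Cim x = Cim y -> x = y.
Proof. by case: x y => [a b] [c d]; rewrite /Cre /Cim /= => -> ->. Qed.

Lemma Cre_mk (a b : R) : Cre (Cmk a b) = a. Proof. by []. Qed.
Lemma Cim_mk (a b : R) : Cim (Cmk a b) = b. Proof. by []. Qed.
Lemma CreD x y : Cre (x + y) = Cre x + Cre y. Proof. by case: x y => [a b] [c d]. Qed.
Lemma CimD x y : Cim (x + y) = Cim x + Cim y. Proof. by case: x y => [a b] [c d]. Qed.
Lemma CreN x : Cre (- x) = - Cre x. Proof. by case: x => [a b]. Qed.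
Lemma CimN x : Cim (- x) = - Cim x. Proof. by case: x => [a b]. Qed.
Lemma CreM x y : Cre (x * y) = Cre x * Cre y - Cim x * Cim y.
Proof. by case: x y => [a b] [c d]. Qed.
Lemma CimM x y : Cim (x * y) = Cre x * Cim y + Cim x * Cre y.
Proof. by case: x y => [a b] [c d]. Qed.
Lemma Cre_conj x : Cre (Cconj x) = Cre x. Proof. by case: x. Qed.
Lemma Cim_conj x : Cim (Cconj x) = - Cim x. Proof. by case: x. Qed.
Lemma Cre0 : Cre (0 : C) = 0. Proof. by []. Qed.
Lemma Cim0 : Cim (0 : C) = 0. Proof. by []. Qed.
Lemma Cre1 : Cre (1 : C) = 1. Proof. by []. Qed.
Lemma Cim1 : Cim (1 : C) = 0. Proof. by []. Qed.

Definition CE := (Cre_mk, Cim_mk, CreD, CimD, CreN, CimN, CreM, CimM, Cre_conj,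
  Cim_conj, Cre0, Cim0, Cre1, Cim1).

Lemma Cre_sum (I : Type) (s : seq I) (P : pred I) (F : I -> C) :
  Cre (\sum_(i <- s | P i) F i) = \sum_(i <- s | P i) Cre (F i).
Proof. by apply: (big_morph (@Cre R) CreD). Qed.

Lemma Cmod_sqr x : Cmod x ^+ 2 = Cre x ^+ 2 + Cim x ^+ 2.
Proof.
case: x => a b; rewrite /Cmod /Cre /Cim /= sqr_sqrtr//.
by rewrite addr_ge0// sqr_ge0.
Qed.

Lemma Cmod_ge0 x : 0 <= Cmod x.
Proof. by case: x => a b; rewrite /Cmod /= sqrtr_ge0. Qed.

Lemma CconjD x y : Cconj (x + y) = Cconj x + Cconj y.
Proof. by apply: C_eq; rewrite !CE ?opprD. Qed.
Lemma CconjM x y : Cconj (x * y) = Cconj x * Cconj y.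
Proof. by apply: C_eq; rewrite !CE; ring. Qed.
Lemma Cconj_sum (I : Type) (s : seq I) (P : pred I) (F : I -> C) :
  Cconj (\sum_(i <- s | P i) F i) = \sum_(i <- s | P i) Cconj (F i).
Proof.
apply: (big_morph (@Cconj R) CconjD); by apply: C_eq; rewrite !CE ?oppr0.
Qed.

Definition ccvg (z : nat -> C) (l : C) : Prop :=
  Cre (z k) @[k --> \oo] --> Cre l /\ Cim (z k) @[k --> \oo] --> Cim l.

Lemma ccvg_cst l : ccvg (fun=> l) l.
Proof. by split; exact: cvg_cst. Qed.

Lemma ccvgD z1 l1 z2 l2 : ccvg z1 l1 -> ccvg z2 l2 ->
  ccvg (fun k => z1 k + z2 k) (l1 + l2).
Proof.
move=> [a b] [c d]; split; rewrite !CE; under eq_fun do rewrite !CE; exact: cvgD.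
Qed.

Lemma ccvgM z1 l1 z2 l2 : ccvg z1 l1 -> ccvg z2 l2 ->
  ccvg (fun k => z1 k * z2 k) (l1 * l2).
Proof.
move=> [a b] [c d]; split; rewrite !CE; under eq_fun do rewrite !CE.
  by apply: cvgB; exact: cvgM.
by apply: cvgD; exact: cvgM.
Qed.

Lemma ccvg_conj z l : ccvg z l -> ccvg (fun k => Cconj (z k)) (Cconj l).
Proof.
move=> [a b]; split; rewrite !CE.
  by under eq_fun do rewrite Cre_conj.
under eq_fun do rewrite Cim_conj.
exact: cvgN.
Qed.

Lemma ccvg_sum (I : Type) (s : seq I) (z : I -> nat -> C) (l : I -> C) :
  (forall i, ccvg (z i) (l i)) ->
  ccvg (fun k => \sum_(i <- s) z i k) (\sum_(i <- s) l i).
Proof.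
move=> H; elim: s => [|i s IH].
  by rewrite big_nil; under eq_fun do rewrite big_nil; exact: ccvg_cst.
by rewrite big_cons; under eq_fun do rewrite big_cons; exact: ccvgD.
Qed.

Lemma ccvg_unique z l l' : ccvg z l -> ccvg z l' -> l = l'.
Proof.
move=> [a b] [c d]; apply: C_eq.
  exact: (cvg_unique _ a c).
exact: (cvg_unique _ b d).
Qed.

End complex_algebra.

(** * Real square-integrable functions *)

Section real_L2.
Context d (T : measurableType d) (R : realType) (mu : {measure set T -> \bar R}).
Variable D : set T.
Hypotheses (mD : measurable D) (muD : (mu D < +oo)%E).
Implicit Types f g h : T -> R.

Definition rL2 f : Prop :=
  measurable_fun D f /\ mu.-integrable D (EFin \o (fun x => f x ^+ 2)).

Definition rdot f g : R := Rintegral mu D (fun x => f x * g x).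

Lemma rL2_prod f g : rL2 f -> rL2 g -> mu.-integrable D (EFin \o (fun x => f x * g x)).
Proof.
move=> [mf f2] [mg g2].
apply: (@le_integrable _ _ _ mu D mD _
  (EFin \o (fun x => f x ^+ 2 + g x ^+ 2))).
- by apply/measurable_EFinP; exact: measurable_funM.
- move=> x _; rewrite /= lee_fin normrM.
  rewrite [leRHS]ger0_norm ?addr_ge0 ?sqr_ge0//.
  rewrite -(real_normK (num_real (f x))) -(real_normK (num_real (g x))).
  have := sqr_ge0 (`|f x| - `|g x|); have := sqr_ge0 (`|f x| + `|g x|); lra.
- by have := integrableD mD f2 g2; apply: eq_integrable.
Qed.

Lemma rL2_cst r : rL2 (cst r).
Proof.
split; first exact: measurable_cst.
exact: (integrable_cst_lty mD muD (r ^+ 2)).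
Qed.

Lemma rL2D f g : rL2 f -> rL2 g -> rL2 (fun x => f x + g x).
Proof.
move=> f2 g2; have fg := rL2_prod f2 g2; case: f2 g2 => [mf f2] [mg g2].
split; first exact: measurable_funD.
have := integrableD mD (integrableD mD f2 (integrableZl mD 2 fg)) g2.
apply: eq_integrable => // x _ /=; rewrite -!EFinM -!EFinD; congr EFin; ring.
Qed.

Lemma rL2Z r f : rL2 f -> rL2 (fun x => r * f x).
Proof.
move=> [mf f2]; split; first exact: measurable_funM.
have := integrableZl mD (r ^+ 2) f2.
by apply: eq_integrable => // x _ /=; rewrite -!EFinM exprMn.
Qed.

Lemma rL2N f : rL2 f -> rL2 (fun x => - f x).
Proof.
by move=> f2; have := rL2Z (-1) f2; under eq_fun do rewrite mulN1r.
Qed.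

Lemma rL2B f g : rL2 f -> rL2 g -> rL2 (fun x => f x - g x).
Proof. by move=> f2 g2; apply: rL2D => //; exact: rL2N. Qed.

Lemma rL2_bounded f : measurable_fun setT f -> bounded_on D f -> rL2 f.
Proof.
move=> mf [M HM]; split; first exact: (measurable_funS measurableT).
apply: bounded_integrable => //.
  under eq_fun do rewrite expr2; exact: measurable_funM.
by exists (M * M) => x /HM fM; rewrite expr2 normrM ler_pM.
Qed.

Lemma rdotC f g : rdot f g = rdot g f.
Proof. by apply: eq_Rintegral => x _; rewrite mulrC. Qed.

Lemma rdotDl f g h : rL2 f -> rL2 g -> rL2 h ->
  rdot (fun x => f x + g x) h = rdot f h + rdot g h.
Proof.
move=> f2 g2 h2; rewrite /rdot -RintegralD//; [|exact: rL2_prod..].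
by apply: eq_Rintegral => x _; rewrite mulrDl.
Qed.

Lemma rdotZl r f h : rL2 f -> rL2 h -> rdot (fun x => r * f x) h = r * rdot f h.
Proof.
move=> f2 h2; rewrite /rdot -RintegralZl//; last exact: rL2_prod.
by apply: eq_Rintegral => x _; rewrite mulrA.
Qed.

Lemma rdotNl f h : rL2 f -> rL2 h -> rdot (fun x => - f x) h = - rdot f h.
Proof.
by move=> f2 h2; rewrite -mulN1r -rdotZl//; apply: eq_Rintegral => x _; rewrite mulN1r.
Qed.

Lemma rdotBl f g h : rL2 f -> rL2 g -> rL2 h ->
  rdot (fun x => f x - g x) h = rdot f h - rdot g h.
Proof.
by move=> f2 g2 h2; rewrite rdotDl//; [rewrite rdotNl|exact: rL2N].
Qed.

Lemma rdot_ge0 f : 0 <= rdot f f.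
Proof. by apply: Rintegral_ge0 => x _; rewrite -expr2 sqr_ge0. Qed.

Lemma cauchy_schwarz f g : rL2 f -> rL2 g ->
  rdot f g ^+ 2 <= rdot f f * rdot g g.
Proof.
move=> f2 g2.
have H s : 0 <= rdot f f + 2 * s * rdot f g + s ^+ 2 * rdot g g.
  pose sg := fun x => s * g x; have sg2 : rL2 sg := rL2Z s g2.
  have e1 : rdot sg f = s * rdot f g by rewrite rdotZl// (rdotC g).
  have e2 : rdot sg sg = s ^+ 2 * rdot g g.
    by rewrite [LHS]rdotZl// (rdotC g sg) rdotZl// mulrA expr2.
  have fsg2 := rL2D f2 sg2.
  have := rdot_ge0 (fun x => f x + sg x).
  rewrite rdotDl// (rdotC f) (rdotC sg (fun x => f x + sg x)) !rdotDl// (rdotC f sg) e1 e2.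
  lra.
have [g0|g0] := eqVneq (rdot g g) 0; last first.
  have gp : 0 < rdot g g by rewrite lt_neqAle eq_sym g0 rdot_ge0.
  (* The minimizer of the quadratic polynomial [H]. *)
  have := H (- rdot f g / rdot g g).
  have -> : rdot f f + 2 * (- rdot f g / rdot g g) * rdot f g +
     (- rdot f g / rdot g g) ^+ 2 * rdot g g =
     (rdot f f * rdot g g - rdot f g ^+ 2) / rdot g g by field.
  by rewrite pmulr_lge0 ?invr_gt0// subr_ge0.
rewrite g0 mulr0.
have [->|b0] := eqVneq (rdot f g) 0; first by rewrite expr0n.
(* With a vanishing leading coefficient [H] is affine in [s], and this [s] gives it the value -1. *)
have := H (- (1 + rdot f f) / (2 * rdot f g)).
rewrite g0 mulr0 addr0.
have -> : rdot f f + 2 * (- (1 + rdot f f) / (2 * rdot f g)) * rdot f g = - 1 by field.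
by rewrite ler0N1.
Qed.

Definition rL2_cvg (fs : nat -> T -> R) f : Prop :=
  rdot (fun x => fs k x - f x) (fun x => fs k x - f x) @[k --> \oo] --> 0.

Lemma rL2_cvg_dot fs f h : (forall k, rL2 (fs k)) -> rL2 f -> rL2 h ->
  rL2_cvg fs f -> rdot (fs k) h @[k --> \oo] --> rdot f h.
Proof.
move=> fs2 f2 h2 cf.
have c0 : Num.sqrt (rdot (fun x => fs k x - f x) (fun x => fs k x - f x) * rdot h h)
    @[k --> \oo] --> 0.
  rewrite -[X in _ --> X]sqrtr0; apply: continuous_cvg; first exact: sqrt_continuous.
  by rewrite -(mul0r (rdot h h)); apply: cvgMl.
have H k : `|rdot (fs k) h - rdot f h| <=
    Num.sqrt (rdot (fun x => fs k x - f x) (fun x => fs k x - f x) * rdot h h).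
  rewrite -rdotBl// -sqrtr_sqr ler_wsqrtr// cauchy_schwarz//; exact: rL2B.
apply/cvgrPdist_le => e e0.
move/cvgrPdist_le : c0 => /(_ e e0); apply: filterS => k.
rewrite sub0r normrN ger0_norm ?sqrtr_ge0// => /(le_trans (H k)).
by rewrite distrC.
Qed.

Lemma rL2_cvg_sqr fs f : (forall k, rL2 (fs k)) -> rL2 f ->
  rL2_cvg fs f -> rdot (fs k) (fs k) @[k --> \oo] --> rdot f f.
Proof.
move=> fs2 f2 cf.
have E k : rdot (fs k) (fs k) = rdot (fun x => fs k x - f x) (fun x => fs k x - f x)
    + 2 * rdot (fs k) f - rdot f f.
  have fb : rL2 (fun x => fs k x - f x) by exact: rL2B.
  rewrite rdotBl// (rdotC (fs k) (fun x => fs k x - f x)) (rdotC f (fun x => fs k x - f x)).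
  rewrite !rdotBl// (rdotC f (fs k)); ring.
under eq_fun do rewrite E.
have l0 : 0 + 2 * rdot f f - rdot f f = rdot f f by ring.
have c1 : 2 * rdot (fs k) f @[k --> \oo] --> 2 * rdot f f.
  by apply: cvgMr; exact: rL2_cvg_dot.
have c2 := cvgB (cvgD cf c1) (@cvg_cst _ (rdot f f) _ \oo _).
rewrite l0 in c2; exact: c2.
Qed.

Lemma rdot_eq0 f : rL2 f -> rdot f f = 0 -> {ae mu, forall x, D x -> f x = 0}.
Proof.
move=> [mf f2] f0.
have H : ae_eq mu D (EFin \o (fun x => f x ^+ 2)) (cst 0%E).
  apply/(ae_eq_integral_abs mu mD); first by case/integrableP: f2.
  rewrite (eq_integral (EFin \o (fun x => f x * f x))); last first.
    by move=> x _ /=; rewrite ger0_norm ?sqr_ge0// expr2.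
  rewrite -[LHS]fineK; first by congr EFin.
  by apply: integrable_fin_num => //; under eq_fun do rewrite -expr2.
apply: filterS H => x H Dx; have := H Dx.
by move=> /= [] /eqP; rewrite sqrf_eq0 => /eqP.
Qed.

End real_L2.

(** * The complex L^2 inner product and L^2 limits *)

Section complex_L2.
Variables (R : realType) (n : nat) (D : set 'rV[R]_n).
Hypotheses (mD : measurable D) (muD : (lebesgue_rV R n D < +oo)%E).
Local Notation C := (Cplx R).
Local Notation mu := (lebesgue_rV R n).
Implicit Types u v w f g : 'rV[R]_n -> C.
Local Notation re u := (@Cre R \o u).
Local Notation im u := (@Cim R \o u).

Definition cintegrable f : Prop :=
  mu.-integrable D (EFin \o re f) /\ mu.-integrable D (EFin \o im f).

Lemma cintD f g : cintegrable f -> cintegrable g ->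
  cint D (fun x => f x + g x) = cint D f + cint D g.
Proof.
move=> [f1 f2] [g1 g2]; apply: C_eq; rewrite /cint !CE.
  rewrite -RintegralD; [|exact: mD|exact: f1|exact: g1].
  by apply: eq_Rintegral => x _ /=; rewrite !CE.
rewrite -RintegralD; [|exact: mD|exact: f2|exact: g2].
by apply: eq_Rintegral => x _ /=; rewrite !CE.
Qed.

Lemma cint_sum (I : Type) (s : seq I) (F : I -> 'rV[R]_n -> C) :
  (forall i, cintegrable (F i)) ->
  cintegrable (fun x => \sum_(i <- s) F i x) /\
  cint D (fun x => \sum_(i <- s) F i x) = \sum_(i <- s) cint D (F i).
Proof.
move=> H; elim: s => [|i s [IH1 IH2]].
  rewrite big_nil; split.
    split; (under eq_fun do rewrite /= big_nil); exact: (integrable_cst_lty mD muD 0).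
  apply: C_eq; rewrite /cint !CE.
    rewrite -[RHS](mul0r (fine (mu D))) -Rintegral_cst//.
    by apply: eq_Rintegral => x _ /=; rewrite big_nil.
  rewrite -[RHS](mul0r (fine (mu D))) -Rintegral_cst//.
  by apply: eq_Rintegral => x _ /=; rewrite big_nil.
have [h1 h2] := H i; case: (IH1) => i1 i2; split.
  split.
    have := integrableD mD h1 i1; apply: eq_integrable => // x _ /=.
    by rewrite big_cons !CE.
  have := integrableD mD h2 i2; apply: eq_integrable => // x _ /=.
  by rewrite big_cons !CE.
rewrite big_cons -IH2 -cintD//; congr cint.
by apply/funext => x; rewrite big_cons.
Qed.

Lemma L2P u : L2 D u <-> rL2 mu D (re u) /\ rL2 mu D (im u).
Proof.
have E x : Cmod (u x) ^+ 2 = re u x ^+ 2 + im u x ^+ 2 by rewrite Cmod_sqr.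
split=> [[m1 m2 uoo]|[[m1 i1] [m2 i2]]].
  have iu : mu.-integrable D (EFin \o (fun x => Cmod (u x) ^+ 2)).
    apply/integrableP; split.
      apply/measurable_EFinP; under eq_fun do rewrite E.
      by apply: measurable_funD; exact: measurable_funX.
    apply: le_lt_trans uoo; rewrite /sqnorm le_eqVlt; apply/orP; left; apply/eqP.
    by apply: eq_integral => x _ /=; rewrite ger0_norm ?sqr_ge0.
  split; split => //.
    apply: (le_integrable mD _ _ iu).
      by apply/measurable_EFinP; exact: measurable_funX.
    by move=> x _ /=; rewrite lee_fin E !ger0_norm ?addr_ge0 ?sqr_ge0// lerDl sqr_ge0.
  apply: (le_integrable mD _ _ iu).
    by apply/measurable_EFinP; exact: measurable_funX.
  by move=> x _ /=; rewrite lee_fin E !ger0_norm ?addr_ge0 ?sqr_ge0// lerDr sqr_ge0.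
split => //.
have /integrableP[_] := integrableD mD i1 i2; apply: le_lt_trans.
rewrite /sqnorm le_eqVlt; apply/orP; left; apply/eqP.
by apply: eq_integral => x _ /=; rewrite E ger0_norm// addr_ge0 ?sqr_ge0.
Qed.

Definition L2norm2 u : R := rdot mu D (re u) (re u) + rdot mu D (im u) (im u).

Lemma sqnormE u : L2 D u -> sqnorm D u = (L2norm2 u)%:E.
Proof.
move=> /L2P[u1 u2]; have [_ i1] := u1; have [_ i2] := u2.
rewrite /L2norm2 /rdot -RintegralD; [|exact: mD|exact: rL2_prod..].
rewrite /sqnorm /Rintegral fineK; last first.
  apply: integrable_fin_num => //.
  by have := integrableD mD (rL2_prod mD u1 u1) (rL2_prod mD u2 u2); apply: eq_integrable.
by apply: eq_integral => x _; rewrite Cmod_sqr !expr2.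
Qed.

Lemma L2norm2_ge0 u : 0 <= L2norm2 u.
Proof. by apply: addr_ge0; exact: rdot_ge0. Qed.

Lemma L2D u v : L2 D u -> L2 D v -> L2 D (fun x => u x + v x).
Proof.
move=> /L2P[u1 u2] /L2P[v1 v2]; apply/L2P; split.
  rewrite (_ : re _ = fun x => re u x + re v x); first exact: rL2D.
  by apply/funext => x /=; rewrite CE.
rewrite (_ : im _ = fun x => im u x + im v x); first exact: rL2D.
by apply/funext => x /=; rewrite CE.
Qed.

Lemma L2Z (c : C) u : L2 D u -> L2 D (fun x => c * u x).
Proof.
move=> /L2P[u1 u2]; apply/L2P; split.
  rewrite (_ : re _ = fun x => Cre c * re u x - Cim c * im u x).
    by apply: rL2B => //; exact: rL2Z.
  by apply/funext => x /=; rewrite CE.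
rewrite (_ : im _ = fun x => Cre c * im u x + Cim c * re u x).
  by apply: rL2D => //; exact: rL2Z.
by apply/funext => x /=; rewrite CE.
Qed.

Lemma L2_cst (c : C) : L2 D (fun=> c).
Proof.
apply/L2P; split; exact: rL2_cst.
Qed.

Lemma L2_sum (I : Type) (s : seq I) (F : I -> 'rV[R]_n -> C) :
  (forall i, L2 D (F i)) -> L2 D (fun x => \sum_(i <- s) F i x).
Proof.
move=> H; elim: s => [|i s IH].
  under eq_fun do rewrite big_nil; exact: L2_cst.
under eq_fun do rewrite big_cons; exact: L2D.
Qed.

Lemma L2B u v : L2 D u -> L2 D v -> L2 D (fun x => u x - v x).
Proof.
move=> u2 v2; have := L2D u2 (L2Z (-1) v2).
by under eq_fun do rewrite mulN1r.
Qed.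

Lemma L2norm2D_le u v : L2 D u -> L2 D v ->
  L2norm2 (fun x => u x + v x) <= 2 * L2norm2 u + 2 * L2norm2 v.
Proof.
move=> /L2P[u1 u2] /L2P[v1 v2].
have H (f g : 'rV[R]_n -> R) : rL2 mu D f -> rL2 mu D g ->
    rdot mu D (fun x => f x + g x) (fun x => f x + g x) <= 2 * rdot mu D f f + 2 * rdot mu D g g.
  move=> f2 g2; have := rdot_ge0 mu D (fun x => f x - g x).
  rewrite rdotBl//; last exact: rL2B.
  rewrite (rdotC mu D f) (rdotC mu D g) !rdotBl//.
  rewrite rdotDl//; last exact: rL2D.
  rewrite (rdotC mu D f (fun x => f x + g x)) (rdotC mu D g (fun x => f x + g x)) !rdotDl//.
  rewrite (rdotC mu D g f); lra.
have E1 : re (fun x => u x + v x) = fun x => re u x + re v x.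
  by apply/funext => x /=; rewrite CE.
have E2 : im (fun x => u x + v x) = fun x => im u x + im v x.
  by apply/funext => x /=; rewrite CE.
rewrite {1}/L2norm2 E1 E2; have := H _ _ u1 v1; have := H _ _ u2 v2.
by rewrite /L2norm2; lra.
Qed.

Definition hdot u v : C := cint D (fun x => u x * Cconj (v x)).

Lemma hdot_cintegrable u v : L2 D u -> L2 D v ->
  cintegrable (fun x => u x * Cconj (v x)).
Proof.
move=> /L2P[u1 u2] /L2P[v1 v2]; split.
  have := integrableD mD (rL2_prod mD u1 v1) (rL2_prod mD u2 v2).
  by apply: eq_integrable => // x _ /=; rewrite !CE mulrN opprK.
have := integrableB mD (rL2_prod mD u2 v1) (rL2_prod mD u1 v2).
by apply: eq_integrable => // x _ /=; rewrite !CE -EFinB mulrN addrC.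
Qed.

Lemma hdotE u v : L2 D u -> L2 D v ->
  hdot u v = Cmk (rdot mu D (re u) (re v) + rdot mu D (im u) (im v))
                 (rdot mu D (im u) (re v) - rdot mu D (re u) (im v)).
Proof.
move=> /L2P[u1 u2] /L2P[v1 v2]; apply: C_eq; rewrite /hdot /cint !CE.
  rewrite /rdot -RintegralD; [|exact: mD|exact: rL2_prod..].
  by apply: eq_Rintegral => x _ /=; rewrite !CE mulrN opprK.
rewrite /rdot -RintegralB; [|exact: mD|exact: rL2_prod..].
by apply: eq_Rintegral => x _ /=; rewrite !CE mulrN addrC.
Qed.

Lemma hdotDl u v w : L2 D u -> L2 D v -> L2 D w ->
  hdot (fun x => u x + v x) w = hdot u w + hdot v w.
Proof.
move=> u2 v2 w2; rewrite /hdot -cintD; [|exact: hdot_cintegrable..].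
by congr cint; apply/funext => x; rewrite mulrDl.
Qed.

Lemma hdotC u v : L2 D u -> L2 D v -> hdot v u = Cconj (hdot u v).
Proof.
move=> u2 v2; rewrite !hdotE//; apply: C_eq; rewrite !CE.
  by rewrite (rdotC mu D (re v)) (rdotC mu D (im v)).
by rewrite opprB (rdotC mu D (re v)) (rdotC mu D (im v)).
Qed.

Lemma hdotZl c u w : L2 D u -> L2 D w -> hdot (fun x => c * u x) w = c * hdot u w.
Proof.
move=> u2 w2; have cu2 := L2Z c u2; rewrite !hdotE//.
case/L2P: u2 => u1 u2; case/L2P: w2 => w1 w2.
have E1 : re (fun x => c * u x) = fun x => Cre c * re u x - Cim c * im u x.
  by apply/funext => x /=; rewrite CE.
have E2 : im (fun x => c * u x) = fun x => Cre c * im u x + Cim c * re u x.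
  by apply/funext => x /=; rewrite CE.
have z1 r : rL2 mu D (fun x => r * re u x) by exact: rL2Z.
have z2 r : rL2 mu D (fun x => r * im u x) by exact: rL2Z.
apply: C_eq; rewrite !CE E1 E2 !rdotBl// !rdotDl// !rdotZl//; ring.
Qed.

Lemma hdot_suml (I : Type) (s : seq I) (F : I -> 'rV[R]_n -> C) w :
  (forall i, L2 D (F i)) -> L2 D w ->
  hdot (fun x => \sum_(i <- s) F i x) w = \sum_(i <- s) hdot (F i) w.
Proof.
move=> F2 w2; rewrite /hdot -(cint_sum s (fun i => hdot_cintegrable (F2 i) w2)).2.
by congr cint; apply/funext => x; rewrite mulr_suml.
Qed.

Lemma hdot_norm u : L2 D u -> hdot u u = Cmk (L2norm2 u) 0.
Proof.
by move=> u2; rewrite hdotE// (rdotC mu D (im u)) subrr.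
Qed.

Lemma L2norm2Z c u : L2 D u -> L2norm2 (fun x => c * u x) = Cmod c ^+ 2 * L2norm2 u.
Proof.
move=> u2; have cu2 := L2Z c u2.
have : Cre (hdot (fun x => c * u x) (fun x => c * u x)) = Cmod c ^+ 2 * L2norm2 u.
  rewrite hdotZl// (hdotC cu2 u2) hdotZl// hdot_norm// !CE Cmod_sqr; ring.
by rewrite hdot_norm.
Qed.

Lemma L2norm2_eq0 u : L2 D u -> L2norm2 u = 0 -> {ae mu, forall x, D x -> u x = 0}.
Proof.
move=> /L2P[u1 u2] /eqP; rewrite paddr_eq0 ?rdot_ge0// => /andP[/eqP e1 /eqP e2].
have h1 := rdot_eq0 mD u1 e1; have h2 := rdot_eq0 mD u2 e2.
apply: filterS2 h1 h2 => x h1 h2 Dx; apply: C_eq.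
  exact: h1.
exact: h2.
Qed.

Lemma ae_hdot u v w : L2 D u -> L2 D v -> L2 D w ->
  {ae mu, forall x, D x -> u x = v x} -> hdot u w = hdot v w.
Proof.
move=> u2 v2 w2 uv.
have E (p : C -> R) : (mu.-integrable D (EFin \o (p \o (fun x => u x * Cconj (w x))))) ->
  (mu.-integrable D (EFin \o (p \o (fun x => v x * Cconj (w x))))) ->
  Rintegral mu D (p \o (fun x => u x * Cconj (w x))) =
  Rintegral mu D (p \o (fun x => v x * Cconj (w x))).
  move=> /integrableP[m1 _] /integrableP[m2 _]; rewrite /Rintegral; congr fine.
  apply: ae_eq_integral => //.
  by apply: filterS uv => x H Dx /=; rewrite H.
have [a1 a2] := hdot_cintegrable u2 w2; have [b1 b2] := hdot_cintegrable v2 w2.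
by rewrite /hdot /cint; congr Cmk; exact: E.
Qed.

Lemma L2_cvgP (fs : nat -> 'rV[R]_n -> C) f : (forall k, L2 D (fs k)) -> L2 D f ->
  L2_cvg D fs f <-> L2norm2 (fun x => fs k x - f x) @[k --> \oo] --> 0.
Proof.
move=> fs2 f2; rewrite /L2_cvg.
have -> : (fun k => sqnorm D (fun x => fs k x - f x)) =
    EFin \o (fun k => L2norm2 (fun x => fs k x - f x)).
  by apply/funext => k /=; rewrite sqnormE//; exact: L2B.
by split => [/fine_cvgP[_]//|H]; apply: cvg_EFin => //; exact: nearW.
Qed.

Lemma L2_cvg_re (fs : nat -> 'rV[R]_n -> C) f : (forall k, L2 D (fs k)) -> L2 D f ->
  L2_cvg D fs f -> rL2_cvg mu D (fun k => re (fs k)) (re f) /\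
                   rL2_cvg mu D (fun k => im (fs k)) (im f).
Proof.
move=> fs2 f2 /(L2_cvgP fs2 f2) H.
have E1 k : re (fun x => fs k x - f x) = fun x => re (fs k) x - re f x.
  by apply/funext => x /=; rewrite !CE.
have E2 k : im (fun x => fs k x - f x) = fun x => im (fs k) x - im f x.
  by apply/funext => x /=; rewrite !CE.
split; rewrite /rL2_cvg.
  apply: (squeeze_cvgr _ (cvg_cst 0) H); apply: nearW => k.
  by rewrite rdot_ge0 /L2norm2 E1 lerDl rdot_ge0.
apply: (squeeze_cvgr _ (cvg_cst 0) H); apply: nearW => k.
by rewrite rdot_ge0 /L2norm2 E2 lerDr rdot_ge0.
Qed.

Lemma L2_cvg_hdot (fs : nat -> 'rV[R]_n -> C) f h : (forall k, L2 D (fs k)) ->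
  L2 D f -> L2 D h -> L2_cvg D fs f -> ccvg (fun k => hdot (fs k) h) (hdot f h).
Proof.
move=> fs2 f2 h2 /(L2_cvg_re fs2 f2)[c1 c2].
have [h_1 h_2] := (L2P h).1 h2; have [f_1 f_2] := (L2P f).1 f2.
have fsr k : rL2 mu D (re (fs k)) by have [] := (L2P _).1 (fs2 k).
have fsi k : rL2 mu D (im (fs k)) by have [] := (L2P _).1 (fs2 k).
split.
  under eq_fun do rewrite hdotE// Cre_mk; rewrite hdotE// Cre_mk.
  apply: cvgD; exact: rL2_cvg_dot.
under eq_fun do rewrite hdotE// Cim_mk; rewrite hdotE// Cim_mk.
apply: cvgB; exact: rL2_cvg_dot.
Qed.

Lemma L2_cvg_norm2 (fs : nat -> 'rV[R]_n -> C) f : (forall k, L2 D (fs k)) ->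
  L2 D f -> L2_cvg D fs f -> L2norm2 (fs k) @[k --> \oo] --> L2norm2 f.
Proof.
move=> fs2 f2 /(L2_cvg_re fs2 f2)[c1 c2].
have [f_1 f_2] := (L2P f).1 f2.
have fsr k : rL2 mu D (re (fs k)) by have [] := (L2P _).1 (fs2 k).
have fsi k : rL2 mu D (im (fs k)) by have [] := (L2P _).1 (fs2 k).
by apply: cvgD; exact: rL2_cvg_sqr.
Qed.

Lemma L2_cvgD (fs gs : nat -> 'rV[R]_n -> C) f g : (forall k, L2 D (fs k)) -> L2 D f ->
  (forall k, L2 D (gs k)) -> L2 D g -> L2_cvg D fs f -> L2_cvg D gs g ->
  L2_cvg D (fun k x => fs k x + gs k x) (fun x => f x + g x).
Proof.
move=> fs2 f2 gs2 g2 /(L2_cvgP fs2 f2) cf /(L2_cvgP gs2 g2) cg.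
apply/L2_cvgP; [by move=> k; exact: L2D|exact: L2D|].
have c0 : 2 * L2norm2 (fun x => fs k x - f x) + 2 * L2norm2 (fun x => gs k x - g x)
    @[k --> \oo] --> (2 * 0 + 2 * 0 : R) by apply: cvgD; exact: cvgMr.
rewrite !mulr0 addr0 in c0.
apply: (squeeze_cvgr _ (cvg_cst 0) c0); apply: nearW => k.
rewrite L2norm2_ge0/=; apply: le_trans (L2norm2D_le (L2B (fs2 k) f2) (L2B (gs2 k) g2)).
rewrite le_eqVlt; apply/orP; left; apply/eqP; congr L2norm2.
by apply/funext => x; ring.
Qed.

Lemma L2_cvgZ c (fs : nat -> 'rV[R]_n -> C) f : (forall k, L2 D (fs k)) -> L2 D f ->
  L2_cvg D fs f -> L2_cvg D (fun k x => c * fs k x) (fun x => c * f x).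
Proof.
move=> fs2 f2 /(L2_cvgP fs2 f2) cf.
apply/L2_cvgP; [by move=> k; exact: L2Z|exact: L2Z|].
have c0 : Cmod c ^+ 2 * L2norm2 (fun x => fs k x - f x) @[k --> \oo] --> (Cmod c ^+ 2 * 0 : R).
  exact: cvgMr.
rewrite mulr0 in c0.
rewrite (_ : (fun k => _) = fun k => Cmod c ^+ 2 * L2norm2 (fun x => fs k x - f x)) //.
apply/funext => k; rewrite -L2norm2Z; last exact: L2B.
by congr L2norm2; apply/funext => x; rewrite mulrBr.
Qed.

Lemma L2_cvg_const u : L2 D u -> L2_cvg D (fun=> u) u.
Proof.
move=> u2; apply/L2_cvgP => //.
rewrite (_ : L2norm2 _ = 0); first exact: cvg_cst.
have := L2norm2Z 0 u2; rewrite Cmod_sqr Cre0 Cim0 expr0n/= addr0 mul0r.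
by move=> <-; congr L2norm2; apply/funext => x; rewrite subrr mul0r.
Qed.

End complex_L2.

(** * Smooth functions and the Robin form *)

Section smooth.
Variable R : realType.
Local Notation C := (Cplx R).
Local Notation re u := (@Cre R \o u).
Local Notation im u := (@Cim R \o u).

Definition real_C1 n (p : 'rV[R]_n -> R) : Prop :=
  [/\ continuous p, forall i x, derivable p x (dir R i) &
      forall i, continuous ('D_(dir R i) p : 'rV[R]_n -> R)].

Lemma Ck1P n (p : 'rV[R]_n -> R) : Ck 1 p <-> real_C1 p.
Proof.
split=> [[cp H]|[cp dp cdp]]; first by split => // i; have [d1 []] := H i.
by split => // i; split => //; split.
Qed.

Lemma C1_re n (F : 'rV[R]_n -> C) : C1 F -> real_C1 (re F).
Proof. by case=> /Ck1P. Qed.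

Lemma C1_im n (F : 'rV[R]_n -> C) : C1 F -> real_C1 (im F).
Proof. by case=> _ /Ck1P. Qed.

Section C1_algebra.
Variable n : nat.
Implicit Types (p q : 'rV[R]_n -> R) (F G : 'rV[R]_n -> C).

Lemma real_C1_is_derive p i x : real_C1 p -> is_derive x (dir R i) p ('D_(dir R i) p x).
Proof. by case=> _ dp _; apply: DeriveDef. Qed.

Lemma real_C1D p q : real_C1 p -> real_C1 q -> real_C1 (fun x => p x + q x) /\
  forall i x, 'D_(dir R i) (fun x => p x + q x) x = 'D_(dir R i) p x + 'D_(dir R i) q x.
Proof.
move=> p1 q1.
have D i x : is_derive x (dir R i) (fun x => p x + q x) ('D_(dir R i) p x + 'D_(dir R i) q x).
  exact: (is_deriveD (real_C1_is_derive i x p1) (real_C1_is_derive i x q1)).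
have E i : 'D_(dir R i) (fun x => p x + q x) = fun x => 'D_(dir R i) p x + 'D_(dir R i) q x.
  by apply/funext => x; exact: (@derive_val _ _ _ _ _ _ _ (D i x)).
case: p1 q1 => cp _ dp [cq _ dq]; split; [split|by move=> i x; exact: (congr1 (@^~ x) (E i))].
- by move=> x; exact: (cvgD (@cp x) (@cq x)).
- by move=> i x; exact: (@ex_derive _ _ _ _ _ _ _ (D i x)).
- by move=> i; rewrite E => x; exact: (cvgD (@dp i x) (@dq i x)).
Qed.

Lemma real_C1Z r p : real_C1 p -> real_C1 (fun x => r * p x) /\
  forall i x, 'D_(dir R i) (fun x => r * p x) x = r * 'D_(dir R i) p x.
Proof.
move=> p1.
have D i x : is_derive x (dir R i) (fun x => r * p x) (r * 'D_(dir R i) p x).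
  exact: (is_deriveZ r (real_C1_is_derive i x p1)).
have E i : 'D_(dir R i) (fun x => r * p x) = fun x => r * 'D_(dir R i) p x.
  by apply/funext => x; exact: (@derive_val _ _ _ _ _ _ _ (D i x)).
case: p1 => cp _ dp; split; [split|by move=> i x; exact: (congr1 (@^~ x) (E i))].
- by move=> x; exact: (cvgMr (@cp x)).
- by move=> i x; exact: (@ex_derive _ _ _ _ _ _ _ (D i x)).
- by move=> i; rewrite E => x; exact: (cvgMr (@dp i x)).
Qed.

Lemma C1P F : C1 F <-> real_C1 (re F) /\ real_C1 (im F).
Proof. by split=> -[/Ck1P ? /Ck1P ?]. Qed.

Lemma C1D F G : C1 F -> C1 G -> C1 (fun x => F x + G x) /\
  forall i, cpartial i (fun x => F x + G x) = fun x => cpartial i F x + cpartial i G x.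
Proof.
move=> /C1P[F1 F2] /C1P[G1 G2].
have [a1 b1] := real_C1D F1 G1; have [a2 b2] := real_C1D F2 G2.
have Er : re (fun x => F x + G x) = fun x => re F x + re G x.
  by apply/funext => x /=; rewrite CE.
have Ei : im (fun x => F x + G x) = fun x => im F x + im G x.
  by apply/funext => x /=; rewrite CE.
split; first by apply/C1P; rewrite Er Ei.
move=> i; apply/funext => x; rewrite /cpartial Er Ei b1 b2.
by apply: C_eq; rewrite !CE.
Qed.

Lemma C1Z c F : C1 F -> C1 (fun x => c * F x) /\
  forall i, cpartial i (fun x => c * F x) = fun x => c * cpartial i F x.
Proof.
move=> /C1P[F1 F2].
have [a1 b1] := real_C1Z (Cre c) F1; have [a2 b2] := real_C1Z (- Cim c) F2.
have [a3 b3] := real_C1Z (Cre c) F2; have [a4 b4] := real_C1Z (Cim c) F1.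
have [a5 b5] := real_C1D a1 a2; have [a6 b6] := real_C1D a3 a4.
have Er : re (fun x => c * F x) = fun x => Cre c * re F x + - Cim c * im F x.
  by apply/funext => x /=; rewrite CE mulNr.
have Ei : im (fun x => c * F x) = fun x => Cre c * im F x + Cim c * re F x.
  by apply/funext => x /=; rewrite CE.
split; first by apply/C1P; rewrite Er Ei.
move=> i; apply/funext => x; rewrite /cpartial Er Ei b5 b6 b1 b2 b3 b4.
by apply: C_eq; rewrite !CE ?mulNr.
Qed.

End C1_algebra.

Lemma C1_cst (c : C) m : C1 (fun _ : 'rV[R]_m => c).
Proof.
have D (r : R) i (x : 'rV[R]_m) : 'D_(dir R i) (cst r : 'rV[R]_m -> R) x = 0.
  by rewrite derive_cst.
have H (r : R) : real_C1 (cst r : 'rV[R]_m -> R).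
  split; [exact: cst_continuous|by move=> j x; exact: derivable_cst|].
  move=> j; rewrite (_ : (fun x => _) = cst 0); first exact: cst_continuous.
  by apply/funext => x; exact: D.
by apply/C1P; split; exact: H.
Qed.

Lemma cpartial_cst (c : C) m (i : 'I_m) : cpartial i (fun _ : 'rV[R]_m => c) = fun=> 0.
Proof.
have D (r : R) (x : 'rV[R]_m) : 'D_(dir R i) (cst r : 'rV[R]_m -> R) x = 0.
  by rewrite derive_cst.
by apply/funext => x; apply: C_eq; exact: D.
Qed.

Section box.
Variables (n : nat) (a : 'I_n.+1 -> R).
Hypothesis a0 : forall i, 0 < a i.
Implicit Types (i : 'I_n.+1) (p q : 'rV[R]_n.+1 -> R) (F W U V : 'rV[R]_n.+1 -> C).

Definition face_end i (s : bool) : R := if s then a i else - a i.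

Lemma face_pointE i s y : face_point a i s y = rV_ins i (face_end i s, y).
Proof. by []. Qed.

Lemma face_end_itv i s : - a i <= face_end i s <= a i.
Proof. by have := a0 i; rewrite /face_end; case: s; lra. Qed.

Lemma continuous_rL2_box p : continuous p -> rL2 (lebesgue_rV R n.+1) (box a) p.
Proof.
move=> cp; apply: rL2_bounded; [exact: measurable_box|exact: box_lty| |].
  exact: continuous_measurable_rV.
by have [M HM] := @continuous_bounded_box _ _ a _ cp; exists M => x /box_closed_box/HM.
Qed.

Lemma continuous_rL2_face i s p : continuous p ->
  rL2 (lebesgue_rV R n) (face_domain a i) (p \o face_point a i s).
Proof.
move=> cp; apply: rL2_bounded; [exact: measurable_box|exact: box_lty| |].
  apply: (measurableT_comp (continuous_measurable_rV cp)).
  exact: (measurableT_comp (@measurable_rV_ins R n i) (measurable_pair1 (face_end i s))).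
have [M HM] := @continuous_bounded_box _ _ a _ cp; exists M => y ya.
by apply: HM; apply: closed_box_ins => //; exact: face_end_itv.
Qed.

(** [box_divergence] for the product of [p] and [q]. *)
Lemma real_ibp i p q : real_C1 p -> real_C1 q ->
  rdot (lebesgue_rV R n.+1) (box a) ('D_(dir R i) p) q +
  rdot (lebesgue_rV R n.+1) (box a) p ('D_(dir R i) q) =
  rdot (lebesgue_rV R n) (face_domain a i)
    (p \o face_point a i true) (q \o face_point a i true) -
  rdot (lebesgue_rV R n) (face_domain a i)
    (p \o face_point a i false) (q \o face_point a i false).
Proof.
move=> [cp dp cdp] [cq dq cdq].
pose G x := p x * q x.
have dG x : is_derive x (dir R i) (p * q) (p x * 'D_(dir R i) q x + q x * 'D_(dir R i) p x).
  have h1 : is_derive x (dir R i) p ('D_(dir R i) p x) by apply: DeriveDef.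
  have h2 : is_derive x (dir R i) q ('D_(dir R i) q x) by apply: DeriveDef.
  exact: is_deriveM.
have DG : 'D_(dir R i) (p * q) = fun x => p x * 'D_(dir R i) q x + q x * 'D_(dir R i) p x.
  by apply/funext => x; exact: derive_val.
have cDG : continuous ('D_(dir R i) (p * q) : 'rV[R]_n.+1 -> R).
  rewrite DG => x.
  exact: (cvgD (cvgM (@cp x) (@cdq i x)) (cvgM (@cq x) (@cdp i x))).
have := box_divergence (a0 i) (fun x => ex_derive (is_derive := dG x)) cDG.
rewrite DG => E.
rewrite /rdot -RintegralD; [|exact: measurable_box|..].
- transitivity (Rintegral (lebesgue_rV R n.+1) (box a)
    (fun x => p x * 'D_(dir R i) q x + q x * 'D_(dir R i) p x)).
    by apply: eq_Rintegral => x _; rewrite addrC [in RHS](mulrC (q x)).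
  apply: (etrans E); rewrite -RintegralB; [by []|exact: measurable_box|..];
  apply: rL2_prod; try exact: measurable_box; exact: continuous_rL2_face.
- by apply: rL2_prod; [exact: measurable_box|exact: continuous_rL2_box..].
- by apply: rL2_prod; [exact: measurable_box|exact: continuous_rL2_box..].
Qed.

Lemma C1_L2 F : C1 F -> L2 (box a) F.
Proof.
move=> cF; apply/(L2P (measurable_box a)); split.
  by case: (C1_re cF) => c _ _; exact: continuous_rL2_box.
by case: (C1_im cF) => c _ _; exact: continuous_rL2_box.
Qed.

Lemma C1_L2_partial i F : C1 F -> L2 (box a) (cpartial i F).
Proof.
move=> cF; apply/(L2P (measurable_box a)); split.
  by case: (C1_re cF) => _ _ c; exact: continuous_rL2_box (c i).
by case: (C1_im cF) => _ _ c; exact: continuous_rL2_box (c i).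
Qed.

Lemma C1_L2_face i s F : C1 F -> L2 (face_domain a i) (F \o face_point a i s).
Proof.
move=> cF; apply/(L2P (measurable_box (box_del a i))); split.
  by case: (C1_re cF) => c _ _; exact: (continuous_rL2_face i s c).
by case: (C1_im cF) => c _ _; exact: (continuous_rL2_face i s c).
Qed.

Definition fdot i s F W : C :=
  hdot (face_domain a i) (F \o face_point a i s) (W \o face_point a i s).

Lemma hdot_ibp i F W : C1 F -> C1 W ->
  hdot (box a) (cpartial i F) W =
  fdot i true F W - fdot i false F W - hdot (box a) F (cpartial i W).
Proof.
move=> cF cW.
have aux (x1 x2 x3 x4 y1 y2 y3 y4 z1 z2 z3 z4 w1 w2 w3 w4 : R) :
    x1 + y1 = z1 - w1 -> x2 + y2 = z2 - w2 -> x3 + y3 = z3 - w3 -> x4 + y4 = z4 - w4 ->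
    Cmk (x1 + x2) (x3 - x4) =
    Cmk (z1 + z2) (z3 - z4) - Cmk (w1 + w2) (w3 - w4) - Cmk (y1 + y2) (y3 - y4).
  by move=> h1 h2 h3 h4; apply: C_eq; rewrite !CE; lra.
have mb := measurable_box a; have mf := measurable_box (box_del a i).
rewrite /fdot (hdotE mb (C1_L2_partial i cF) (C1_L2 cW)).
rewrite (hdotE mb (C1_L2 cF) (C1_L2_partial i cW)).
rewrite (hdotE mf (C1_L2_face i true cF) (C1_L2_face i true cW)).
rewrite (hdotE mf (C1_L2_face i false cF) (C1_L2_face i false cW)).
apply: aux.
- exact: (real_ibp i (C1_re cF) (C1_re cW)).
- exact: (real_ibp i (C1_im cF) (C1_im cW)).
- exact: (real_ibp i (C1_im cF) (C1_re cW)).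
- exact: (real_ibp i (C1_re cF) (C1_im cW)).
Qed.

Definition admissible (u : 'rV[R]_n.+1 -> C) (g : 'I_n.+1 -> 'rV[R]_n.+1 -> C)
  (t : 'rV[R]_n.+1 -> C) : Prop := H1 (box a) u g /\ trace a u g t.

Lemma admissible_L2 u g t : admissible u g t ->
  [/\ L2 (box a) u, forall i, L2 (box a) (g i) &
      forall i s, L2 (face_domain a i) (t \o face_point a i s)].
Proof.
by move=> [[u2 H] [t2 _]]; split => // i; have [] := H i.
Qed.

Definition bdot (t1 t2 : 'rV[R]_n.+1 -> C) : C :=
  \sum_(i < n.+1) \sum_(s : bool) fdot i s t1 t2.

Definition gdot (g1 g2 : 'I_n.+1 -> 'rV[R]_n.+1 -> C) : C :=
  \sum_(i < n.+1) hdot (box a) (g1 i) (g2 i).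

Lemma robin_formE (alpha : C) u g t u' g' t' : admissible u g t -> admissible u' g' t' ->
  robin_form a alpha g t g' t' = gdot g g' + alpha * bdot t t'.
Proof.
move=> /admissible_L2[u2 g2 t2] /admissible_L2[u2' g2' t2']; rewrite /robin_form.
have mb := measurable_box a; have bl := box_lty a; congr (_ + _).
  have H i : cintegrable (box a) (fun x => g i x * Cconj (g' i x)).
    exact: hdot_cintegrable.
  by have [_ ->] := cint_sum mb bl (index_enum _) H.
rewrite /bint /bdot mulr_sumr; apply: eq_bigr => i _.
rewrite mulr_sumr; apply: eq_bigr => s _.
rewrite /fdot -(hdotZl (measurable_box (box_del a i)) _ (t2 i s) (t2' i s)).
by [].
Qed.

Let mb := measurable_box a.
Let bl := box_lty a.
Let mf i := measurable_box (box_del a i).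

Lemma weak_partial_lin i (c : C) u g u' g' : L2 (box a) u -> L2 (box a) g ->
  L2 (box a) u' -> L2 (box a) g' ->
  weak_partial (box a) i u g -> weak_partial (box a) i u' g' ->
  weak_partial (box a) i (fun x => c * u x + u' x) (fun x => c * g x + g' x).
Proof.
move=> u2 g2 u2' g2' w w' psi tpsi.
have z : rL2 (lebesgue_rV R n.+1) (box a) (cst 0) by exact: rL2_cst.
have [c1 _ c3] : real_C1 psi by case: tpsi => /(_ 1%N)/Ck1P.
have l1 : L2 (box a) (fun x => Cmk ('D_(dir R i) psi x) 0).
  by apply/(L2P mb); split; [exact: (continuous_rL2_box (c3 i))|exact: z].
have l2 : L2 (box a) (fun x => Cmk (psi x) 0).
  by apply/(L2P mb); split; [exact: continuous_rL2_box|exact: z].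
have cE (f : 'rV[R]_n.+1 -> C) (h : 'rV[R]_n.+1 -> R) :
    cint (box a) (fun x => f x * Cmk (h x) 0) = hdot (box a) f (fun x => Cmk (h x) 0).
  rewrite /hdot; congr cint; apply/funext => x; congr (_ * _).
  by apply: C_eq; rewrite !CE ?oppr0.
have cu2 := L2Z mb c u2; have cg2 := L2Z mb c g2.
have e1 := w psi tpsi; have e2 := w' psi tpsi; rewrite !cE in e1 e2 *.
rewrite (hdotDl mb cu2 u2' l1) (hdotZl mb c u2 l1) e1 e2.
by rewrite (hdotDl mb cg2 g2' l2) (hdotZl mb c g2 l2) opprD mulrN.
Qed.

Lemma admissible_lin (c : C) u g t u' g' t' : admissible u g t -> admissible u' g' t' ->
  admissible (fun x => c * u x + u' x) (fun i x => c * g i x + g' i x)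
    (fun x => c * t x + t' x).
Proof.
move=> A A'; have [u2 g2 t2] := admissible_L2 A; have [u2' g2' t2'] := admissible_L2 A'.
case: A => [[_ w] [_ [phi [p1 p2 p3 p4]]]]; case: A' => [[_ w'] [_ [phi' [p1' p2' p3' p4']]]].
have cu2 := L2Z mb c u2; have cg2 i := L2Z mb c (g2 i).
have ct2 i s := L2Z (mf i) c (t2 i s).
split; first split; first exact: (L2D mb cu2 u2').
  move=> i; split; first exact: (L2D mb (cg2 i) (g2' i)).
  by apply: weak_partial_lin => //; [have [] := w i|have [] := w' i].
split; first by move=> i s; exact: (L2D (mf i) (ct2 i s) (t2' i s)).
have f2 k := C1_L2 (p1 k); have f2' k := C1_L2 (p1' k).
have cf2 k := L2Z mb c (f2 k).
have [H1 H2] : (forall k, C1 (fun x => c * phi k x + phi' k x)) /\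
    forall i k, cpartial i (fun x => c * phi k x + phi' k x) =
      fun x => c * cpartial i (phi k) x + cpartial i (phi' k) x.
  have H k := C1D (C1Z c (p1 k)).1 (p1' k).
  split => [k|i k]; first by have [] := H k.
  by have [_ ->] := H k; have [_ ->] := C1Z c (p1 k).
exists (fun k x => c * phi k x + phi' k x); split => //.
- exact: (L2_cvgD mb cf2 cu2 f2' u2' (L2_cvgZ mb c f2 u2 p2) p2').
- move=> i; rewrite (_ : (fun k => _) = fun k x => c * cpartial i (phi k) x + cpartial i (phi' k) x).
    have h2 k := C1_L2_partial i (p1 k); have h2' k := C1_L2_partial i (p1' k).
    have ch2 k := L2Z mb c (h2 k).
    exact: (L2_cvgD mb ch2 (cg2 i) h2' (g2' i) (L2_cvgZ mb c h2 (g2 i) (p3 i)) (p3' i)).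
  by apply/funext => k; exact: H2.
- move=> i s.
  have h2 k := C1_L2_face i s (p1 k); have h2' k := C1_L2_face i s (p1' k).
  have ch2 k := L2Z (mf i) c (h2 k).
  exact: (L2_cvgD (mf i) ch2 (ct2 i s) h2' (t2' i s)
    (L2_cvgZ (mf i) c h2 (t2 i s) (p4 i s)) (p4' i s)).
Qed.

End box.
End smooth.

(** * The Robin Laplacian on classical functions *)

Section robin_operator.
Variable R : realType.
Local Notation C := (Cplx R).
Local Notation re u := (@Cre R \o u).
Local Notation im u := (@Cim R \o u).
Variables (n : nat) (a : 'I_n.+1 -> R).
Hypothesis a0 : forall i, 0 < a i.
Implicit Types (i : 'I_n.+1) (u v w f : 'rV[R]_n.+1 -> C).

Let mb := measurable_box a.
Let bl := box_lty a.
Let mf i := measurable_box (box_del a i).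

Lemma hdot0r m (D : set 'rV[R]_m) (u : 'rV[R]_m -> C) : measurable D ->
  hdot D u (fun=> 0) = 0.
Proof.
move=> mD; rewrite /hdot /cint; apply: C_eq; rewrite !CE.
  rewrite -[RHS](mul0r (fine (lebesgue_rV R m D))) -Rintegral_cst//.
  by apply: eq_Rintegral => x _ /=; rewrite !CE oppr0 !mulr0 subrr.
rewrite -[RHS](mul0r (fine (lebesgue_rV R m D))) -Rintegral_cst//.
by apply: eq_Rintegral => x _ /=; rewrite !CE oppr0 !mulr0 addr0.
Qed.

(** Integration by parts gives the weak derivatives, the face terms vanishing because a test
    function is supported inside the open box; the constant sequence shows that the boundary values
    are a trace. *)
Lemma admissible_C1 u : C1 u -> admissible a u (fun i => cpartial i u) u.
Proof.
move=> cu.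
have u2 := C1_L2 a cu; have g2 i := C1_L2_partial a i cu.
have t2 i s := C1_L2_face a0 i s cu.
split; first split => //.
  move=> i; split; first exact: g2.
  move=> psi [cpsi [K [_ Kb] psi0]].
  pose W x : C := Cmk (psi x) 0.
  have rp : real_C1 psi by have /Ck1P := cpsi 1%N.
  have [_ z1] : real_C1 (re (fun _ : 'rV[R]_n.+1 => 0)) /\ real_C1 (im (fun _ : 'rV[R]_n.+1 => 0)).
    exact: (C1P _).1 (C1_cst 0 n.+1).
  have cW : C1 W by apply/C1P; split.
  have EW : cpartial i W = fun x => Cmk ('D_(dir R i) psi x) 0.
    by apply/funext => x; rewrite /cpartial (derive_cst (0 : R)).
  have F0 s : fdot a i s u W = 0.
    rewrite /fdot (_ : W \o _ = fun=> 0); first exact: (hdot0r _ (mf i)).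
    apply/funext => y; rewrite /W /= psi0// => /Kb /(_ i).
    rewrite face_pointE rV_ins_eq /= /face_end; have := a0 i; case: (s); lra.
  have E (f : 'rV[R]_n.+1 -> C) (h : 'rV[R]_n.+1 -> R) :
      cint (box a) (fun x => f x * Cmk (h x) 0) = hdot (box a) f (fun x => Cmk (h x) 0).
    rewrite /hdot; congr cint; apply/funext => x; congr (_ * _).
    by apply: C_eq; rewrite !CE ?oppr0.
  rewrite !E -/W (hdot_ibp a0 i cu cW) !F0 EW subrr sub0r opprK.
  by [].
split; first exact: t2.
exists (fun=> u); split => //.
- exact: (L2_cvg_const mb u2).
- by move=> i; exact: (L2_cvg_const mb (g2 i)).
- by move=> i s; exact: (L2_cvg_const (mf i) (t2 i s)).
Qed.

Lemma L2_cvg_hdotr m (D : set 'rV[R]_m) (fs : nat -> 'rV[R]_m -> C) (f h : 'rV[R]_m -> C) :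
  measurable D -> (forall k, L2 D (fs k)) -> L2 D f -> L2 D h -> L2_cvg D fs f ->
  ccvg (fun k => hdot D h (fs k)) (hdot D h f).
Proof.
move=> mD fs2 f2 h2 /(L2_cvg_hdot mD fs2 f2 h2)/ccvg_conj.
rewrite -(hdotC mD f2 h2).
by under eq_fun => k do rewrite -(hdotC mD (fs2 k) h2).
Qed.

(** With a C^1 function in place of [v] the identity is Green's formula, the boundary condition
    cancelling the face terms. Both sides converge along the C^1 sequence that defines the trace of
    [v], which gives the general case. *)
Lemma classical_robin (alpha : C) u f : C1 u -> (forall i, C1 (cpartial i u)) ->
  L2 (box a) f ->
  (forall x, f x = - \sum_i cpartial i (cpartial i u) x) ->
  (forall i (s : bool) y, (if s then cpartial i u (face_point a i s y)
      else - cpartial i u (face_point a i s y)) + alpha * u (face_point a i s y) = 0) ->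
  robin_laplacian a alpha u f.
Proof.
move=> cu c2u f2 fE bc; split => //.
exists (fun i => cpartial i u), u.
have A := admissible_C1 cu; have [Ah At] := A; split => // v gv tv hv tv'.
have Av : admissible a v gv tv by split.
rewrite (robin_formE alpha A Av).
have [v2 gv2 tv2] := admissible_L2 Av.
have [_ [phi [p1 p2 p3 p4]]] := tv'.
have u2 := C1_L2 a cu; have g2 i := C1_L2_partial a i cu.
have t2 i s := C1_L2_face a0 i s cu.
have k2 k := C1_L2 a (p1 k); have kg2 i k := C1_L2_partial a i (p1 k).
have kt2 i s k := C1_L2_face a0 i s (p1 k).
have c_1 : ccvg (fun k => hdot (box a) f (phi k)) (hdot (box a) f v).
  exact: (L2_cvg_hdotr mb k2 v2 f2 p2).
have c_2 : ccvg (fun k => gdot a (fun i => cpartial i u) (fun i => cpartial i (phi k)) +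
    alpha * bdot a u (phi k)) (gdot a (fun i => cpartial i u) gv + alpha * bdot a u tv).
  apply: ccvgD.
    apply: (@ccvg_sum R _ (index_enum _) (fun i k => hdot (box a) (cpartial i u) (cpartial i (phi k))) (fun i => hdot (box a) (cpartial i u) (gv i))) => i.
    exact: (L2_cvg_hdotr mb (kg2 i) (gv2 i) (g2 i) (p3 i)).
  apply: ccvgM; first exact: ccvg_cst.
  apply: (@ccvg_sum R _ (index_enum _) (fun i k => \sum_(s : bool) fdot a i s u (phi k)) (fun i => \sum_(s : bool) fdot a i s u tv)) => i.
  apply: (@ccvg_sum R _ (index_enum _) (fun s k => fdot a i s u (phi k)) (fun s => fdot a i s u tv)) => s.
  exact: (L2_cvg_hdotr (mf i) (kt2 i s) (tv2 i s) (t2 i s) (p4 i s)).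
rewrite -[RHS]/(hdot (box a) f v).
apply: (ccvg_unique c_2); suff -> : (fun k => gdot a (fun i => cpartial i u)
    (fun i => cpartial i (phi k)) + alpha * bdot a u (phi k)) =
    fun k => hdot (box a) f (phi k) by [].
apply/funext => k.
have gg2 i := C1_L2_partial a i (c2u i).
have -> : hdot (box a) f (phi k) = - \sum_i hdot (box a) (cpartial i (cpartial i u)) (phi k).
  have fS : f = fun x => -1 * \sum_i cpartial i (cpartial i u) x.
    by apply/funext => x; rewrite fE mulN1r.
  rewrite fS (hdotZl mb (-1) (L2_sum mb bl _ gg2) (k2 k)).
  by rewrite (hdot_suml mb bl _ gg2 (k2 k)) mulN1r.
rewrite /gdot /bdot mulr_sumr -big_split -sumrN; apply: eq_bigr => i _ /=.
(* The outer normal changes sign between opposite faces: d_i u = - alpha u where x_i = a_i, and d_i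
   u = alpha u where x_i = - a_i. *)
have B (s : bool) : fdot a i s (cpartial i u) (phi k) =
    (if s then - alpha else alpha) * fdot a i s u (phi k).
  rewrite /fdot; have -> : cpartial i u \o face_point a i s =
      fun y => (if s then - alpha else alpha) * (u \o face_point a i s) y.
    apply/funext => y /=; have := bc i s y; case: (s) => /eqP.
      by rewrite addr_eq0 => /eqP ->; rewrite mulNr.
    by rewrite addrC subr_eq0 => /eqP ->.
  exact: (hdotZl (mf i) _ (t2 i s) (kt2 i s k)).
rewrite (hdot_ibp a0 i (c2u i) (p1 k)) (B true) (B false) big_bool /=.
by rewrite mulNr mulrDr !opprB opprK; ring.
Qed.

End robin_operator.

(** * Upper bound for the number of eigenvalues *)

Lemma cvg_bigsum (K : numFieldType) (T : Type) (F : set_system T) (I : Type) (s : seq I)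
  (P : pred I) (z : I -> T -> K) (l : I -> K) : Filter F ->
  (forall i, z i x @[x --> F] --> l i) ->
  \sum_(i <- s | P i) z i x @[x --> F] --> \sum_(i <- s | P i) l i.
Proof.
move=> FF H; elim: s => [|i s IH].
  by rewrite big_nil; under eq_fun do rewrite big_nil; exact: cvg_cst.
rewrite big_cons; under eq_fun do rewrite big_cons; case: (P i) => //.
exact: cvgD.
Qed.

(** * Lower bound for the Robin form at a negative parameter *)

Section complex_energy.
Variable R : realType.
Local Notation C := (Cplx R).
Local Notation re u := (@Cre R \o u).
Local Notation im u := (@Cim R \o u).
Variables (n : nat) (a : 'I_n.+1 -> R) (t K : R).
Hypotheses (a0 : forall i, 0 < a i) (t0 : 0 < t) (K0 : 0 <= K)
  (eta4 : forall i, 4 * expR (- t * a i) < 1)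
  (K1 : forall i, 1 <= K * (1 - 4 * expR (- t * a i))).
Local Notation mu := (lebesgue_rV R n.+1).
Local Notation nu := (lebesgue_rV R n).

Let mb := measurable_box a.
Let bl := box_lty a.
Let mf i := measurable_box (box_del a i).
Let Ts := end_tensors a t.

Lemma real_energy_le (p : 'rV[R]_n.+1 -> R) : real_C1 p ->
  t * \sum_(i < n.+1) \sum_(s : bool)
     rdot nu (box (box_del a i)) (p \o face_point a i s) (p \o face_point a i s) <=
  \sum_(i < n.+1) rdot mu (box a) ('D_(dir R i) p) ('D_(dir R i) p) +
  K * t ^+ 2 * (n%:R * rdot mu (box a) p p + \sum_(Psi <- Ts) rdot mu (box a) p Psi ^+ 2).
Proof.
move=> [cp dp cdp].
have := energy_le a0 t0 K0 eta4 K1 cp dp cdp.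
have E0 : Rintegral mu (box a) (fun x => p x ^+ 2) = rdot mu (box a) p p.
  by apply: eq_Rintegral => x _; rewrite expr2.
have E1 i : Rintegral mu (box a) (fun x => 'D_(dir R i) p x ^+ 2) =
    rdot mu (box a) ('D_(dir R i) p) ('D_(dir R i) p).
  by apply: eq_Rintegral => x _; rewrite expr2.
have E2 i : Rintegral nu (box (box_del a i))
    (fun y => p (rV_ins i (a i, y)) ^+ 2 + p (rV_ins i (- a i, y)) ^+ 2) =
    \sum_(s : bool)
     rdot nu (box (box_del a i)) (p \o face_point a i s) (p \o face_point a i s).
  rewrite big_bool /= /rdot.
  have r2 s := continuous_rL2_face a0 i s cp.
  have i2 s := rL2_prod (mf i) (r2 s) (r2 s).
  rewrite -(RintegralD (mf i) (i2 true) (i2 false)).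
  by apply: eq_Rintegral => y _; rewrite /= !face_pointE !expr2.
rewrite E0 (eq_bigr _ (fun i _ => E1 i)) (eq_bigr _ (fun i _ => E2 i)).
exact: id.
Qed.

Definition tensor (k : 'I_(2 ^ n.+1)) : 'rV[R]_n.+1 -> R := nth (cst 0) Ts k.

Definition tensor_C k : 'rV[R]_n.+1 -> C := fun x => Cmk (tensor k x) 0.

Lemma tensor_rL2 k : rL2 mu (box a) (tensor k).
Proof.
have /List.Forall_forall H := bmf_end_tensors a0 t0 eta4 K1.
have bm : bounded_measurable (tensor k).
  apply: H; rewrite -/Ts /tensor; have : (k < size Ts)%N by rewrite size_end_tensors.
  elim: Ts (k : nat) => [//|Psi s IH] [|l] /=; first by left.
  by rewrite ltnS => /IH; right.
have [mt [M HM]] := bm; apply: rL2_bounded => //; by exists M.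
Qed.

Lemma tensor_C_L2 k : L2 (box a) (tensor_C k).
Proof.
apply/(L2P mb); split; first exact: tensor_rL2.
by rewrite (_ : im _ = cst 0); [exact: rL2_cst|].
Qed.

(** The form at parameter [- t] is at least [- K t^2] times this quantity, which reduces to
    [(d - 1) |u|^2] when [u] is orthogonal to all tensors. *)
Definition defect (u : 'rV[R]_n.+1 -> C) : R :=
  n%:R * L2norm2 (box a) u + \sum_k Cmod (hdot (box a) u (tensor_C k)) ^+ 2.

Lemma tensor_dot u k : L2 (box a) u ->
  Cmod (hdot (box a) u (tensor_C k)) ^+ 2 =
  rdot mu (box a) (re u) (tensor k) ^+ 2 + rdot mu (box a) (im u) (tensor k) ^+ 2.
Proof.
move=> u2; rewrite (hdotE mb u2 (tensor_C_L2 k)) Cmod_sqr !CE.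
have rz (f : 'rV[R]_n.+1 -> R) : rdot mu (box a) f (im (tensor_C k)) = 0.
  rewrite -[RHS](mul0r (fine (mu (box a)))) -Rintegral_cst//.
  by apply: eq_Rintegral => x _ /=; rewrite !CE mulr0.
by rewrite !rz addr0 subr0.
Qed.

Definition fnorm2 (tr : 'rV[R]_n.+1 -> C) : R :=
  \sum_(i < n.+1) \sum_(s : bool) L2norm2 (face_domain a i) (tr \o face_point a i s).

Lemma C1_energy_le (u : 'rV[R]_n.+1 -> C) : C1 u ->
  t * fnorm2 u <=
  \sum_(i < n.+1) L2norm2 (box a) (cpartial i u) + K * t ^+ 2 * defect u.
Proof.
move=> cu; have u2 := C1_L2 a cu.
have H1 := real_energy_le (C1_re cu); have H2 := real_energy_le (C1_im cu).
have E p : \sum_(Psi <- Ts) rdot mu (box a) p Psi ^+ 2 = \sum_k rdot mu (box a) p (tensor k) ^+ 2.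
  by rewrite (big_nth (cst 0)) size_end_tensors big_mkord.
rewrite !E {E} in H1 H2.
apply: (le_trans (le_trans _ (lerD H1 H2))).
  rewrite -mulrDr -big_split /fnorm2; apply: ler_wpM2l; first exact: ltW.
  rewrite le_eqVlt; apply/orP; left; apply/eqP; apply: eq_bigr => i _.
  by rewrite -big_split.
have -> : \sum_(i < n.+1) L2norm2 (box a) (cpartial i u) =
    \sum_(i < n.+1) rdot mu (box a) ('D_(dir R i) (re u)) ('D_(dir R i) (re u)) +
    \sum_(i < n.+1) rdot mu (box a) ('D_(dir R i) (im u)) ('D_(dir R i) (im u)).
  by rewrite -big_split.
rewrite /defect (eq_bigr _ (fun k _ => tensor_dot k u2)) big_split /= /L2norm2.
have aux (k l x1 x2 p1 p2 q1 q2 : R) :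
    x1 + k * (l * p1 + q1) + (x2 + k * (l * p2 + q2)) <=
    x1 + x2 + k * (l * (p1 + p2) + (q1 + q2)).
  by rewrite le_eqVlt; apply/orP; left; apply/eqP; ring.
exact: aux.
Qed.

(** Boundary norm, gradient norm and [defect] all converge along the C^1 sequence that defines the
    trace, so [C1_energy_le] passes to the limit. *)
Lemma admissible_energy_le u g tr : admissible a u g tr ->
  t * fnorm2 tr <= \sum_(i < n.+1) L2norm2 (box a) (g i) + K * t ^+ 2 * defect u.
Proof.
move=> A; have [u2 g2 t2] := admissible_L2 A.
have [_ [_ [phi [p1 p2 p3 p4]]]] := A.
have f2 k := C1_L2 a (p1 k); have fg2 i k := C1_L2_partial a i (p1 k).
have ft2 i s k := C1_L2_face a0 i s (p1 k).
have c1 : fnorm2 (phi k) @[k --> \oo] --> fnorm2 tr.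
  apply: cvg_bigsum => i; apply: cvg_bigsum => s.
  exact: (L2_cvg_norm2 (mf i) (ft2 i s) (t2 i s) (p4 i s)).
have c2 : \sum_(i < n.+1) L2norm2 (box a) (cpartial i (phi k)) @[k --> \oo] -->
    \sum_(i < n.+1) L2norm2 (box a) (g i).
  by apply: cvg_bigsum => i; exact: (L2_cvg_norm2 mb (fg2 i) (g2 i) (p3 i)).
have c3 : defect (phi k) @[k --> \oo] --> defect u.
  apply: cvgD; first by apply: cvgMr; exact: (L2_cvg_norm2 mb f2 u2 p2).
  apply: cvg_bigsum => k; rewrite Cmod_sqr; under eq_fun do rewrite Cmod_sqr.
  have [h1 h2] := L2_cvg_hdot mb f2 u2 (tensor_C_L2 k) p2.
  by apply: cvgD; rewrite expr2; under eq_fun do rewrite expr2; exact: cvgM.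
have c4 := cvgMr (a := t) c1.
have c5 := cvgD c2 (cvgMr (a := K * t ^+ 2) c3).
apply: (ler_cvg_to (c4 _) (c5 _ _)); apply: nearW => k; exact: (C1_energy_le (p1 k)).
Qed.

Lemma robin_form_ge u g tr : admissible a u g tr ->
  - (K * t ^+ 2 * defect u) <= Cre (robin_form a (Cmk (- t) 0) g tr g tr).
Proof.
move=> A; have [u2 g2 t2] := admissible_L2 A.
rewrite (robin_formE _ A A) !CE.
have -> : Cre (gdot a g g) = \sum_(i < n.+1) L2norm2 (box a) (g i).
  by rewrite /gdot Cre_sum; apply: eq_bigr => i _; rewrite hdot_norm.
have -> : Cre (bdot a tr tr) = fnorm2 tr.
  rewrite /bdot Cre_sum; apply: eq_bigr => i _; rewrite Cre_sum; apply: eq_bigr => s _.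
  by rewrite /fdot (hdot_norm (mf i) (t2 i s)).
have := admissible_energy_le A; rewrite mul0r subr0 mulNr.
by move=> H; rewrite lerBrDr addrC lerBlDr.
Qed.

End complex_energy.

(** * Symmetry of the operator for a real parameter *)

Section counting.
Variable R : realType.
Local Notation C := (Cplx R).
Variables (n : nat) (a : 'I_n.+1 -> R).
Hypothesis a0 : forall i, 0 < a i.
Implicit Types (u v w f g : 'rV[R]_n.+1 -> C).

Let mb := measurable_box a.
Let bl := box_lty a.
Let mf i := measurable_box (box_del a i).

Lemma hdotZr (c : C) u v : L2 (box a) u -> L2 (box a) v ->
  hdot (box a) u (fun x => c * v x) = Cconj c * hdot (box a) u v.
Proof.
move=> u2 v2; have cv2 := L2Z mb c v2.
by rewrite (hdotC mb cv2 u2) (hdotZl mb c v2 u2) CconjM -(hdotC mb v2 u2).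
Qed.

Lemma hdot_sumr m (F : 'I_m -> 'rV[R]_n.+1 -> C) u : (forall i, L2 (box a) (F i)) ->
  L2 (box a) u ->
  hdot (box a) u (fun x => \sum_i F i x) = \sum_i hdot (box a) u (F i).
Proof.
move=> F2 u2; have s2 := L2_sum mb bl (index_enum _) F2.
rewrite (hdotC mb s2 u2) (hdot_suml mb bl _ F2 u2) Cconj_sum.
by apply: eq_bigr => i _; rewrite -(hdotC mb (F2 i) u2).
Qed.

Lemma L2_robin alpha u f : robin_laplacian a alpha u f -> L2 (box a) u /\ L2 (box a) f.
Proof. by move=> [f2 [g [tr [[u2 _] _ _]]]]. Qed.

Lemma robinP alpha u f : robin_laplacian a alpha u f -> exists gu tr,
  admissible a u gu tr /\ forall v gv tv, admissible a v gv tv ->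
    gdot a gu gv + alpha * bdot a tr tv = hdot (box a) f v.
Proof.
move=> [f2 [g [tr [hu htr H]]]]; exists g, tr; split; first by split.
move=> v gv tv Av; have [h1 h2] := Av; rewrite -[RHS]/(cint _ _) -(H _ _ _ h1 h2).
by rewrite (robin_formE _ (conj hu htr) Av).
Qed.

Lemma robin_lin alpha (c : C) u f v g : robin_laplacian a alpha u f ->
  robin_laplacian a alpha v g ->
  robin_laplacian a alpha (fun x => c * u x + v x) (fun x => c * f x + g x).
Proof.
move=> Au Av; have [u2 f2] := L2_robin Au; have [v2 g2] := L2_robin Av.
have cf2 := L2Z mb c f2.
split; first exact: (L2D mb cf2 g2).
case: Au => [_ [gu [tu [hu htu Hu]]]]; case: Av => [_ [gv [tv [hv htv Hv]]]].
have Au : admissible a u gu tu by split.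
have Av : admissible a v gv tv by split.
have A := admissible_lin a0 c Au Av.
exists (fun i x => c * gu i x + gv i x), (fun x => c * tu x + tv x).
have [h1 h2] := A; split => // w gw tw hw htw.
have Aw : admissible a w gw tw by split.
have [w2 gw2 tw2] := admissible_L2 Aw.
rewrite -[RHS]/(hdot (box a) (fun x => c * f x + g x) w).
rewrite (hdotDl mb cf2 g2 w2) (hdotZl mb c f2 w2).
rewrite -[hdot _ f w]/(cint _ _) -[hdot _ g w]/(cint _ _) -(Hu _ _ _ hw htw) -(Hv _ _ _ hw htw).
rewrite (robin_formE _ A Aw) (robin_formE _ Au Aw) (robin_formE _ Av Aw).
have [_ gu2 tu2] := admissible_L2 Au; have [_ gv2 tv2] := admissible_L2 Av.
have -> : gdot a (fun i x => c * gu i x + gv i x) gw = c * gdot a gu gw + gdot a gv gw.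
  rewrite /gdot mulr_sumr -big_split; apply: eq_bigr => i _.
  have cg2 := L2Z mb c (gu2 i).
  by rewrite (hdotDl mb cg2 (gv2 i) (gw2 i)) (hdotZl mb c (gu2 i) (gw2 i)).
have -> : bdot a (fun x => c * tu x + tv x) tw = c * bdot a tu tw + bdot a tv tw.
  rewrite /bdot mulr_sumr -big_split; apply: eq_bigr => i _.
  rewrite mulr_sumr -big_split; apply: eq_bigr => s _.
  have ct2 := L2Z (mf i) c (tu2 i s).
  rewrite /fdot -(hdotZl (mf i) c (tu2 i s) (tw2 i s)).
  exact: (hdotDl (mf i) ct2 (tv2 i s) (tw2 i s)).
ring.
Qed.

Lemma robin0 alpha : robin_laplacian a alpha (fun=> 0) (fun=> 0).
Proof.
apply: (classical_robin a0).
- exact: C1_cst.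
- by move=> i; rewrite cpartial_cst; exact: C1_cst.
- exact: L2_cst mb bl 0.
- by move=> x; rewrite big1 ?oppr0// => i _; rewrite !cpartial_cst.
- by move=> i s y; rewrite cpartial_cst mulr0 addr0; case: s; rewrite ?oppr0.
Qed.

Lemma robin_sum alpha m (c : 'I_m -> C) (U F : 'I_m -> 'rV[R]_n.+1 -> C) :
  (forall i, robin_laplacian a alpha (U i) (F i)) ->
  robin_laplacian a alpha (fun x => \sum_i c i * U i x) (fun x => \sum_i c i * F i x).
Proof.
move=> H; suff : forall s : seq 'I_m, robin_laplacian a alpha
    (fun x => \sum_(i <- s) c i * U i x) (fun x => \sum_(i <- s) c i * F i x) by [].
elim=> [|i s IH].
  under eq_fun do rewrite big_nil.
  under [X in robin_laplacian _ _ _ X]eq_fun do rewrite big_nil; exact: robin0.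
under eq_fun do rewrite big_cons; under [X in robin_laplacian _ _ _ X]eq_fun do rewrite big_cons.
exact: robin_lin.
Qed.

Lemma robin_ae alpha u f w : robin_laplacian a alpha u f -> L2 (box a) w ->
  ae_zero a (fun x => f x - w x) -> robin_laplacian a alpha u w.
Proof.
move=> [f2 [g [tr [h1 h2 H]]]] w2 fw; split => //.
exists g, tr; split => // v gv tv hv htv; rewrite (H _ _ _ hv htv).
have v2 : L2 (box a) v by case: hv.
apply: (ae_hdot mb f2 w2 v2).
by apply: filterS fw => x + xa => /(_ xa)/eqP; rewrite subr_eq0 => /eqP.
Qed.

Section symmetric.
Variable r : R.
Local Notation alpha := (Cmk r 0).

(** For a real parameter the form is Hermitian: the weak identity of [u] is tested with [v], that of
    [v] with [u]. *)
Lemma robin_sym u f v g : robin_laplacian a alpha u f -> robin_laplacian a alpha v g ->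
  hdot (box a) f v = hdot (box a) u g.
Proof.
move=> Au Av; have [u2 f2] := L2_robin Au; have [v2 g2] := L2_robin Av.
have [gu [tu [au Hu]]] := robinP Au; have [gv [tv [av Hv]]] := robinP Av.
have [_ gu2 tu2] := admissible_L2 au; have [_ gv2 tv2] := admissible_L2 av.
rewrite -(Hu _ _ _ av) (hdotC mb g2 u2) -(Hv _ _ _ au) CconjD CconjM; congr (_ + _ * _).
- rewrite /gdot Cconj_sum; apply: eq_bigr => i _.
  exact: (hdotC mb (gv2 i) (gu2 i)).
- by apply: C_eq; rewrite !CE ?oppr0.
rewrite /bdot Cconj_sum; apply: eq_bigr => i _.
rewrite Cconj_sum; apply: eq_bigr => s _.
exact: (hdotC (mf i) (tv2 i s) (tu2 i s)).
Qed.

Lemma L2norm2_ae u : L2 (box a) u -> L2norm2 (box a) u = 0 -> ae_zero a u.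
Proof. move=> u2 H; exact: (L2norm2_eq0 mb u2 H). Qed.

Lemma eigen_orthogonal z z' u v : Cconj z' = z' ->
  robin_laplacian a alpha u (fun x => z * u x) ->
  robin_laplacian a alpha v (fun x => z' * v x) -> z != z' -> hdot (box a) u v = 0.
Proof.
move=> rz Au Av zz'; have [u2 _] := L2_robin Au; have [v2 _] := L2_robin Av.
have := robin_sym Au Av; rewrite (hdotZl mb z u2 v2) (hdotZr _ u2 v2) rz => /eqP.
by rewrite -subr_eq0 -mulrBl mulf_eq0 subr_eq0 (negbTE zz') => /eqP.
Qed.

Lemma eigenvalue_real z : Defs.eigenvalue a alpha z -> Cconj z = z.
Proof.
move=> [u u0 Au]; have [u2 _] := L2_robin Au.
have := robin_sym Au Au; rewrite (hdotZl mb z u2 u2) (hdotZr _ u2 u2) => /eqP.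
rewrite -subr_eq0 -mulrBl mulf_eq0 => /orP[|/eqP H]; first by rewrite subr_eq0 => /eqP.
exfalso; apply: u0; apply: L2norm2_ae => //; move: H; rewrite (hdot_norm mb u2).
by move=> /(congr1 (@Cre R)); rewrite !CE.
Qed.

(** There are no Jordan chains: [w = (A - z) u] is null or an eigenvector by induction, and in the
    second case [<w, w> = <u, (A - z) w> = 0] by symmetry and the reality of [z]. *)
Lemma root_vector_eigen z k u : Cconj z = z -> root_vector a alpha z k u ->
  ae_zero a u \/ robin_laplacian a alpha u (fun x => z * u x).
Proof.
move=> rz; elim: k u => [|k IH] u; first by left.
move=> [w Au /IH wH]; right; have [u2 f2] := L2_robin Au.
have zu2 := L2Z mb z u2.
have w2 : L2 (box a) w.
  have := L2B mb f2 zu2; by under eq_fun do rewrite addrC addKr.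
suff w0 : ae_zero a w.
  apply: (robin_ae Au zu2); apply: filterS w0 => x + xa => /(_ xa) /= ->.
  by rewrite addr0 subrr.
case: wH => [//|Aw]; apply: L2norm2_ae => //.
have := robin_sym Au Aw; rewrite (hdotDl mb zu2 w2 w2) (hdotZl mb z u2 w2) (hdotZr _ u2 w2) rz.
move=> /eqP; rewrite -subr_eq0 addrAC subrr add0r (hdot_norm mb w2) => /eqP.
by move=> /(congr1 (@Cre R)); rewrite !CE.
Qed.

End symmetric.
End counting.

(** * Counting eigenvalues below a level *)

Section counting.
Variable R : realType.
Local Notation C := (Cplx R).
Variables (n : nat) (a : 'I_n.+1 -> R).
Hypothesis a0 : forall i, 0 < a i.

Let mb := measurable_box a.
Let bl := box_lty a.

Section orthogonal_combination.
Variables (r : R) (m : nat) (s : 'I_m -> C) (u : 'I_m -> 'rV[R]_n.+1 -> C).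
Local Notation alpha := (Cmk r 0).
Hypotheses (rs : forall i, Cconj (s i) = s i)
  (Au : forall i, robin_laplacian a alpha (u i) (fun x => s i * u i x)).

Let u2 i : L2 (box a) (u i). Proof. by have [] := L2_robin (Au i). Qed.

Let hdot_comb (c d : 'I_m -> C) :
  hdot (box a) (fun x => \sum_i c i * u i x) (fun x => \sum_i d i * u i x) =
  \sum_i \sum_j c i * Cconj (d j) * hdot (box a) (u i) (u j).
Proof.
have cu2 (e : 'I_m -> C) i := L2Z mb (e i) (u2 i).
have d2 := L2_sum mb bl (index_enum _) (cu2 d).
rewrite (hdot_suml mb bl _ (cu2 c) d2); apply: eq_bigr => i _.
rewrite (hdotZl mb (c i) (u2 i) d2) (hdot_sumr (cu2 d) (u2 i)) mulr_sumr.
by apply: eq_bigr => j _; rewrite (hdotZr _ (u2 i) (u2 j)) mulrA.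
Qed.

Let ortho i j : s i != s j -> hdot (box a) (u i) (u j) = 0.
Proof. by move=> ij; apply: (eigen_orthogonal (rs j) (Au i) (Au j)). Qed.

(** Weighting [c i] by [q i = sqrt (- B - s i)] gives [<A w, w> = - B |w|^2 - |sum_i e_i u_i|^2].
    Different eigenvalues are orthogonal, and inside one eigenvalue the weights [q i] agree, so no
    orthogonal basis has to be chosen there. *)
Lemma rayleigh_le (c : 'I_m -> C) (B : R) : (forall i, Cre (s i) <= - B) ->
  Cre (hdot (box a) (fun x => \sum_i c i * (s i * u i x)) (fun x => \sum_i c i * u i x)) <=
  - B * L2norm2 (box a) (fun x => \sum_i c i * u i x).
Proof.
move=> sB.
pose q i : R := Num.sqrt (- B - Cre (s i)).
have q2 i : q i * q i = - B - Cre (s i) by rewrite -expr2 sqr_sqrtr// subr_ge0.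
pose e i : C := c i * Cmk (q i) 0.
have w2 : L2 (box a) (fun x => \sum_i c i * u i x).
  by apply: (L2_sum mb bl) => i; exact: L2Z.
have v2 : L2 (box a) (fun x => \sum_i e i * u i x).
  by apply: (L2_sum mb bl) => i; exact: L2Z.
have sE i : s i = Cmk (Cre (s i)) 0.
  by apply: C_eq => //; have := congr1 (@Cim R) (rs i); rewrite !CE; lra.
have E : hdot (box a) (fun x => \sum_i c i * (s i * u i x)) (fun x => \sum_i c i * u i x) =
    Cmk (- B) 0 * hdot (box a) (fun x => \sum_i c i * u i x) (fun x => \sum_i c i * u i x) -
    hdot (box a) (fun x => \sum_i e i * u i x) (fun x => \sum_i e i * u i x).
  have -> : (fun x => \sum_i c i * (s i * u i x)) = fun x => \sum_i (c i * s i) * u i x.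
    by apply/funext => x; apply: eq_bigr => i _; rewrite mulrA.
  rewrite !hdot_comb mulr_sumr -sumrB; apply: eq_bigr => i _.
  rewrite mulr_sumr -sumrB; apply: eq_bigr => j _.
  have [sij|/ortho ->] := eqVneq (s i) (s j); last by rewrite !mulr0 subr0.
  have qij : q i = q j by rewrite /q sij.
  have <- : Cmk (- B) 0 - Cmk (q i) 0 * Cmk (q i) 0 = s i.
    by rewrite [RHS]sE; apply: C_eq; rewrite !CE ?q2; ring.
  have -> : Cconj (e j) = Cconj (c j) * Cmk (q i) 0.
    by rewrite /e qij; apply: C_eq; rewrite !CE; ring.
  rewrite /e; ring.
rewrite E (hdot_norm mb w2) (hdot_norm mb v2) !CE mulr0 subr0 gerDl oppr_le0.
exact: L2norm2_ge0.
Qed.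

End orthogonal_combination.

(* In each class of equal [s i], the [u i] are taken from an independent family
   of root vectors. *)
Lemma eigenvalue_list_vectors r m (s : 'I_m -> C) : eigenvalue_list a (Cmk r 0) s ->
  exists u : 'I_m -> 'rV[R]_n.+1 -> C,
  [/\ forall i, Cconj (s i) = s i,
      forall i, robin_laplacian a (Cmk r 0) (u i) (fun x => s i * u i x) &
      forall c : 'I_m -> C, ae_zero a (fun x => \sum_i c i * u i x) -> forall i, c i = 0].
Proof.
move=> [es ms]; have rs i := eigenvalue_real (es i).
pose cl z := [pred j | s j == z].
pose U z := s2val (cid2 (ms z)).
have U1 z k : exists l, root_vector a (Cmk r 0) z l (U z k).
  exact: (s2valP (cid2 (ms z))).
have U2 z : forall c : 'I_#|cl z| -> C,
    ae_zero a (fun x => \sum_k c k * U z k x) -> forall k, c k = 0.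
  exact: (s2valP' (cid2 (ms z))).
have inc i : i \in cl (s i) by rewrite inE.
pose u i := U (s i) (enum_rank_in (inc i) i).
have uE z i (h : i \in cl z) : u i = U z (enum_rank_in h i).
  have e : s i = z by move: h; rewrite inE => /eqP.
  by case: z / e h => h; rewrite /u (bool_irrelevance h (inc i)).
have Au i : robin_laplacian a (Cmk r 0) (u i) (fun x => s i * u i x).
  have [l /(root_vector_eigen (rs i))[z0|//]] := U1 (s i) (enum_rank_in (inc i) i).
  (* If [u i] vanished, the coefficient 1 on this single member would contradict the independence of
     its family. *)
  have := U2 (s i) (fun k => (k == enum_rank_in (inc i) i)%:R).
  have -> : (fun x => \sum_k (k == enum_rank_in (inc i) i)%:R * U (s i) k x) = u i.
    apply/funext => x; rewrite (bigD1 (enum_rank_in (inc i) i))//= eqxx mul1r big1 ?addr0//.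
    by move=> k /negbTE ->; rewrite mul0r.
  by move=> /(_ z0 (enum_rank_in (inc i) i))/eqP; rewrite eqxx oner_eq0.
exists u; split => // c c0 i.
have u2 j : L2 (box a) (u j) by have [] := L2_robin (Au j).
have cu2 (e : 'I_m -> C) j := L2Z mb (e j) (u2 j).
pose z := s i.
pose cz j : C := if s j == z then c j else 0.
pose w x := \sum_j c j * u j x.
pose wz x := \sum_j cz j * u j x.
have w2 : L2 (box a) w by exact: (L2_sum mb bl).
have wz2 : L2 (box a) wz by exact: (L2_sum mb bl).
(* The part [wz] of [w] that belongs to the eigenvalue [z] is orthogonal to the rest, so
   [|wz|^2 = <w, wz> = 0]: the relation splits into one relation for each eigenvalue. *)
have H0 : hdot (box a) w wz = 0.
  rewrite (ae_hdot mb w2 (L2_cst mb bl 0) wz2); last exact: c0.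
  by rewrite (hdotC mb wz2 (L2_cst mb bl 0)) (hdot0r _ mb); apply: C_eq; rewrite !CE ?oppr0.
have E (e : 'I_m -> C) : hdot (box a) (fun x => \sum_j e j * u j x) wz =
    \sum_j \sum_k e j * Cconj (cz k) * hdot (box a) (u j) (u k).
  rewrite (hdot_suml mb bl _ (cu2 e) wz2); apply: eq_bigr => j _.
  rewrite (hdotZl mb (e j) (u2 j) wz2) (hdot_sumr (cu2 cz) (u2 j)) mulr_sumr.
  by apply: eq_bigr => k _; rewrite (hdotZr _ (u2 j) (u2 k)) mulrA.
have H1 : hdot (box a) w wz = hdot (box a) wz wz.
  rewrite !E; apply: eq_bigr => j _; apply: eq_bigr => k _.
  have [sjk|sjk] := eqVneq (s j) (s k); last first.
    by rewrite (eigen_orthogonal (rs k) (Au j) (Au k))// !mulr0.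
  rewrite /cz sjk; case: (s k == z) => //.
  by rewrite (_ : Cconj 0 = 0) ?mulr0//; apply: C_eq; rewrite !CE ?oppr0.
have : ae_zero a wz.
  apply: L2norm2_ae => //; have := H0; rewrite H1 (hdot_norm mb wz2).
  by move=> /(congr1 (@Cre R)); rewrite !CE.
have -> : wz = fun x => \sum_(k < #|cl z|) c (enum_val k) * U z k x.
  apply/funext => x; rewrite /wz (bigID (mem (cl z))) /= addrC big1 ?add0r; last first.
    by move=> j /negbTE; rewrite /cz inE => ->; rewrite mul0r.
  rewrite big_enum_val; apply: eq_bigr => k _.
  have h := enum_valP k; have e : s (enum_val k) == z := h.
  by rewrite /cz e (uE z _ h) enum_valK_in.
move=> /U2/(_ (enum_rank_in (inc i) i)).
by rewrite enum_rankK_in.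
Qed.

Section count.
Variables (t K : R).
Hypotheses (t0 : 0 < t) (K0 : 0 <= K)
  (eta4 : forall i, 4 * expR (- t * a i) < 1)
  (K1 : forall i, 1 <= K * (1 - 4 * expR (- t * a i))).

Lemma eigenvalue_count m (s : 'I_m -> C) (B : R) : eigenvalue_list a (Cmk (- t) 0) s ->
  (forall i, Cre (s i) <= - B) -> K * t ^+ 2 * n%:R < B -> (m <= 2 ^ n.+1)%N.
Proof.
move=> /eigenvalue_list_vectors[u [rs Au indep]] sB KB; rewrite leqNgt; apply/negP => mlt.
have u2 i : L2 (box a) (u i) by have [] := L2_robin (Au i).
pose M : 'M[C]_(m, 2 ^ n.+1) := \matrix_(i, k) hdot (box a) (u i) (tensor_C a t k).
(* There are more rows than columns; a nonzero [c] with [c M = 0] is a combination of eigenvectors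
   orthogonal to all tensors. *)
have : kermx M != 0.
  rewrite kermx_eq0 /row_free neq_ltn (leq_ltn_trans _ mlt)//.
  exact: rank_leq_col.
move=> /rowV0Pn[c /sub_kermxP cM c0].
pose w x := \sum_i c ord0 i * u i x.
have w2 : L2 (box a) w by apply: (L2_sum mb bl) => i; exact: L2Z.
have T2 k := tensor_C_L2 a0 t0 eta4 K1 k.
have wT k : hdot (box a) w (tensor_C a t k) = 0.
  have cu2 i := L2Z mb (c ord0 i) (u2 i).
  rewrite (hdot_suml mb bl _ cu2 (T2 k)).
  have := congr1 (fun N : 'rV[C]_(2 ^ n.+1) => N ord0 k) cM; rewrite !mxE => H; apply: etrans H.
  by apply: eq_bigr => i _; rewrite mxE (hdotZl mb _ (u2 i) (T2 k)).
have Aw := robin_sum a0 (fun i => c ord0 i) Au.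
have [g [tr [adm Hw]]] := robinP Aw.
have := robin_form_ge a0 t0 K0 eta4 K1 adm.
rewrite (robin_formE _ adm adm) (Hw _ _ _ adm) => ge1.
have := le_trans ge1 (rayleigh_le rs Au (fun i => c ord0 i) sB); rewrite -/w.
rewrite /defect big1 ?addr0; last by move=> k _; rewrite wT Cmod_sqr !CE expr0n addr0.
move=> le2.
have w0 : L2norm2 (box a) w = 0.
  apply/eqP; rewrite eq_le L2norm2_ge0 andbT leNgt; apply/negP => w0.
  move: le2; rewrite mulrA mulNr lerN2 ler_pM2r// leNgt => /negP; exact.
move/eqP: c0; apply; apply/rowP => i; rewrite mxE.
by apply: indep; exact: L2norm2_ae.
Qed.

End count.
End counting.

(** * Complex limits and the filter of a sector *)

Section complex_limits.
Variable R : realType.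
Local Notation C := (Cplx R).

Lemma normC (z : C) : `|z| = Cmk (Cmod z) 0. Proof. by []. Qed.

Lemma ltC (x : R) (z : C) : (z < Cmk x 0) = (Cim z == 0) && (Cre z < x).
Proof. by case: z => p q; rewrite [LHS]ltcE /Cim /Cre /= eq_sym. Qed.

Lemma gtC0 (z : C) : (0 < z) = (Cim z == 0) && (0 < Cre z).
Proof. by case: z => p q; rewrite [LHS]ltcE /Cim /Cre /=. Qed.

Lemma CmkK (z : C) : Cim z = 0 -> z = Cmk (Cre z) 0.
Proof. by move=> H; apply: C_eq; rewrite !CE. Qed.

(** The norm of [Cplx R] is itself an element of [Cplx R]; this reduces convergence to estimates of
    the real number [Cmod]. *)
Lemma cvgCP (T : Type) (F : set_system T) (f : T -> C) (l : C) : Filter F ->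
  (f x @[x --> F] --> l) <-> (forall e : R, 0 < e -> \forall x \near F, Cmod (f x - l) < e).
Proof.
move=> FF; split=> [H e e0|H].
  have e0' : 0 < Cmk e 0 by rewrite gtC0 /= eqxx.
  move/cvgrPdistC_lt : H => /(_ _ e0'); apply: filterS => x.
  by rewrite normC ltC => /andP[].
apply/cvgrPdistC_lt => e; rewrite gtC0 => /andP[/eqP/CmkK -> e0].
move: (H _ e0); apply: filterS => x h.
by rewrite normC ltC h eqxx.
Qed.

Lemma CmodM (x y : C) : Cmod (x * y) = Cmod x * Cmod y.
Proof. by apply: Normc.normcM. Qed.

Lemma CmodD (x y : C) : Cmod (x + y) <= Cmod x + Cmod y.
Proof. exact: le_normcD. Qed.

Lemma Cmod_re (x : C) : `|Cre x| <= Cmod x.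
Proof.
by rewrite -ler_sqr ?nnegrE ?Cmod_ge0// real_normK ?num_real// Cmod_sqr lerDl sqr_ge0.
Qed.

Lemma Cmod_im (x : C) : `|Cim x| <= Cmod x.
Proof.
by rewrite -ler_sqr ?nnegrE ?Cmod_ge0// real_normK ?num_real// Cmod_sqr lerDr sqr_ge0.
Qed.

Lemma Cmod_eq0 (x : C) : (Cmod x == 0) = (x == 0).
Proof.
apply/eqP/eqP => [H|->]; last by apply/eqP; rewrite -sqrf_eq0 Cmod_sqr !CE expr0n addr0.
by have := Cmod_re x; have := Cmod_im x; rewrite H !normr_le0 => /eqP h1 /eqP h2;
  apply: C_eq; rewrite !CE.
Qed.

Lemma Cmod0 : Cmod (0 : C) = 0.
Proof. by apply/eqP; rewrite Cmod_eq0. Qed.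

Lemma Cmod1 : Cmod (1 : C) = 1.
Proof. exact: Normc.normc1. Qed.

Lemma CmodV (x : C) : Cmod x^-1 = (Cmod x)^-1.
Proof. exact: Normc.normcV. Qed.

Lemma Cmod_mk (x : R) : Cmod (Cmk x 0) = `|x|.
Proof.
by rewrite -[LHS]ger0_norm ?Cmod_ge0// -[LHS]sqrtr_sqr Cmod_sqr !CE expr0n addr0 sqrtr_sqr.
Qed.

Lemma CmodN (x : C) : Cmod (- x) = Cmod x.
Proof. exact: normcN. Qed.

Lemma natrC (k : nat) : k%:R = Cmk (k%:R) 0 :> C.
Proof.
elim: k => [|k IH]; first by apply: C_eq; rewrite !CE.
by rewrite -addn1 !natrD IH; apply: C_eq; rewrite !CE// addr0.
Qed.

Lemma sector_tailS (phi M N : R) : M <= N -> sector_tail phi N `<=` sector_tail phi M.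
Proof. by move=> MN z [sz Nz]; split => //; exact: le_lt_trans Nz. Qed.

Lemma sector_infty_filter (phi : R) : Filter (sector_infty phi).
Proof.
apply: filter_from_filter; first by exists 0.
move=> M N _ _; exists (Num.max M N) => // z H.
by split; apply: sector_tailS H; rewrite le_max lexx ?orbT.
Qed.

End complex_limits.

(** * At most [2 ^ d] curves *)

Section upper_bound.
Variable R : realType.
Local Notation C := (Cplx R).

Lemma expR_N_le (x : R) : 0 <= x -> (1 + x) * expR (- x) <= 1.
Proof.
move=> x0; rewrite expRN ler_pdivrMr ?expR_gt0// mul1r.
exact: expR_ge1Dx.
Qed.

Lemma eigencurves_count n (a : 'I_n.+1 -> R) (phi : R) m (nu : 'I_m -> C -> C) :
  (forall i, 0 < a i) -> 0 < phi ->
  eigencurves a phi nu -> (forall i, asymptotic_sq phi (- n.+1%:R) (nu i)) ->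
  (m <= 2 ^ n.+1)%N.
Proof.
move=> a0 phi0 [M [ev _]] asy.
have FF := sector_infty_filter phi.
have [d dE] : {d : R | d = n.+1%:R} by exists n.+1%:R.
have d0 : 0 < d by rewrite dE ltr0n.
(* Accuracy asked of the asymptotics: as [(1 - 1/(4 d)) d = d - 1/4], a ratio within [1/(4 d)] of 1
   puts each value below [- (d - 1/4) t^2]. *)
have e0 : 0 < (4 * d)^-1 by rewrite invr_gt0 mulr_gt0.
have N1 i : exists N, forall z, sector_tail phi N z ->
    Cmod (nu i z / (- n.+1%:R * z ^+ 2) - 1) < (4 * d)^-1.
  by have /(cvgCP _ _ FF)/(_ _ e0)[N _ HN] := asy i; exists N.
pose N i := proj1_sig (cid (N1 i)).
have HN i : forall z, sector_tail phi (N i) z -> _ := proj2_sig (cid (N1 i)).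
(* At [- t] all curves are defined ([M]) and close to their asymptotics ([N i]); the terms
   [32 d / a i] bring every [exp (- t a_i)] below [1/(32 d)]. *)
pose t : R := 1 + `|M| + \sum_i `|N i| + \sum_i 32 * d / a i.
have sN : 0 <= \sum_i `|N i| by exact: sumr_ge0.
have sa : 0 <= \sum_i 32 * d / a i.
  by apply: sumr_ge0 => i _; rewrite divr_ge0 ?ltW// mulr_gt0.
have t0 : 0 < t by rewrite /t; have := normr_ge0 M; lra.
have sect r : r < t -> sector_tail phi r (Cmk (- t) 0).
  move=> rt; split; last by rewrite Cmod_mk normrN gtr0_norm.
  exists t, 0; split => //; first by rewrite normr0.
  by rewrite cos0 sin0; apply: C_eq; rewrite !CE; lra.
have tM : M < t by rewrite /t; have := ler_norm M; lra.
have tN i : N i < t.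
  have : `|N i| <= \sum_i `|N i| by rewrite (bigD1 i)//= lerDl sumr_ge0.
  rewrite /t; have := ler_norm (N i); have := normr_ge0 M; lra.
have ta i : 32 * d <= t * a i.
  have : 32 * d / a i <= \sum_i 32 * d / a i.
    by rewrite (bigD1 i)//= lerDl sumr_ge0// => j _; rewrite divr_ge0 ?ltW// mulr_gt0.
  rewrite ler_pdivrMr// => h; apply: (le_trans h); rewrite ler_pM2r//.
  by rewrite /t; have := normr_ge0 M; lra.
have ex i : 32 * d * expR (- t * a i) <= 1.
  have x0 : 0 <= t * a i by rewrite mulr_ge0 ?ltW.
  have := expR_N_le x0; rewrite -mulNr => h; apply: (le_trans _ h).
  rewrite ler_pM2r ?expR_gt0//; have := ta i; lra.
have d1 : 1 <= d by rewrite dE ler1n.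
(* For [eta <= 1/(32 d)], [K (1 - 4 eta) >= (1 + 1/(4 d)) (1 - 1/(8 d)) >= 1], while
   [K (d - 1) < d - 1/4] leaves room below the level [B]. *)
pose K : R := 1 + (4 * d)^-1.
have dd : d * d^-1 = 1 by rewrite divff// gt_eqF.
have KE : K = 1 + d^-1 / 4 by rewrite /K invfM mulrC.
have di0 : 0 < d^-1 by rewrite invr_gt0.
have di1 : d^-1 <= 1 by rewrite invf_le1.
have ex' i : expR (- t * a i) <= d^-1 / 32.
  have := ex i; have := expR_gt0 (- t * a i); move: (expR _) => e e_0 h.
  have : d^-1 * (32 * d * e) <= d^-1 * 1 by rewrite ler_pM2l.
  rewrite (_ : d^-1 * (32 * d * e) = (d * d^-1) * 32 * e); last by ring.
  rewrite dd; lra.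
have K0 : 0 <= K by rewrite KE; lra.
have eta4 i : 4 * expR (- t * a i) < 1 by have := ex' i; lra.
have K1 i : 1 <= K * (1 - 4 * expR (- t * a i)).
  have := ex' i; rewrite KE; have := expR_gt0 (- t * a i); move: (expR _) => e e_0 h.
  apply: (@le_trans _ _ ((1 + d^-1 / 4) * (1 - d^-1 / 8))); last first.
    rewrite ler_wpM2l; lra.
  nra.
have el := ev _ (sect _ tM).
apply: (eigenvalue_count a0 t0 K0 eta4 K1 (B := (d - 1 / 4) * t ^+ 2) el); last first.
  rewrite mulrAC ltr_pM2r ?exprn_gt0// KE.
  have -> : n%:R = d - 1 by rewrite dE -[n.+1]addn1 natrD addrK.
  nra.
move=> i.
have rs : Cconj (nu i (Cmk (- t) 0)) = nu i (Cmk (- t) 0).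
  by have [es _] := el; exact: (eigenvalue_real (es i)).
have := HN i _ (sect _ (tN i)).
set z := nu i _ in rs *.
have im0 : Cim z = 0 by have := congr1 (@Cim R) rs; rewrite !CE; lra.
have t2 : 0 < t ^+ 2 by rewrite exprn_gt0.
have -> : - n.+1%:R * Cmk (- t) 0 ^+ 2 = Cmk (- (d * t ^+ 2)) 0 :> C.
  by rewrite natrC; apply: C_eq; rewrite expr2 !CE -dE; ring.
have -> : z / Cmk (- (d * t ^+ 2)) 0 - 1 = Cmk (- Cre z / (d * t ^+ 2) - 1) 0.
  have nz : Cmk (- (d * t ^+ 2)) 0 != 0 :> C.
    by rewrite -Cmod_eq0 Cmod_mk normr_eq0 oppr_eq0 mulf_neq0// gt_eqF.
  apply: (mulIf nz); rewrite mulrBl divfK// mul1r (CmkK im0).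
  apply: C_eq; rewrite !CE ?mulr0 ?mul0r ?subr0 ?addr0//.
  by field; rewrite !gt_eqF.
rewrite Cmod_mk ltr_norml => /andP[+ _].
rewrite ltrBrDl => h.
have : (1 - (4 * d)^-1) * (d * t ^+ 2) < - Cre z.
  by rewrite -ltr_pdivlMr ?mulr_gt0//; apply: le_lt_trans h; lra.
rewrite (_ : (1 - (4 * d)^-1) * (d * t ^+ 2) = (d - 1 / 4) * t ^+ 2); first by lra.
by field; rewrite gt_eqF.
Qed.

End upper_bound.

(** * Roots of the one-dimensional problem *)

Section complex_exponential.
Variable R : realType.
Local Notation C := (Cplx R).
Local Notation rc x := (Cmk x 0 : C).

Definition cexp (z : C) : C :=
  Cmk (expR (Cre z) * cos (Cim z)) (expR (Cre z) * sin (Cim z)).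

Lemma cexpD z w : cexp (z + w) = cexp z * cexp w.
Proof.
by apply: C_eq; rewrite /cexp !CE expRD ?cosD ?sinD; ring.
Qed.

Lemma cexp0 : cexp 0 = 1.
Proof. by apply: C_eq; rewrite /cexp !CE expR0 ?cos0 ?sin0 !mul1r. Qed.

Lemma cexpN z : cexp z * cexp (- z) = 1.
Proof. by rewrite -cexpD subrr cexp0. Qed.

Lemma Cmod_cexp z : Cmod (cexp z) = expR (Cre z).
Proof.
rewrite -[LHS]ger0_norm ?Cmod_ge0// -[LHS]sqrtr_sqr Cmod_sqr !CE.
by rewrite !exprMn -mulrDr cos2Dsin2 mulr1 sqrtr_sqr gtr0_norm ?expR_gt0.
Qed.

Lemma cexp_neq0 z : cexp z != 0.
Proof. by rewrite -Cmod_eq0 Cmod_cexp gt_eqF ?expR_gt0. Qed.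

Definition cderive (f f' : R -> C) : Prop := forall x : R,
  is_derive x (1 : R) (@Cre R \o f) (Cre (f' x)) /\
  is_derive x (1 : R) (@Cim R \o f) (Cim (f' x)).

Lemma cderive_ext f f' g g' : cderive f f' -> f =1 g -> f' =1 g' -> cderive g g'.
Proof. by move=> H /funext <- /funext <-. Qed.

Lemma cderiveD f f' g g' : cderive f f' -> cderive g g' ->
  cderive (fun x => f x + g x) (fun x => f' x + g' x).
Proof.
move=> F G x; have [f1 f2] := F x; have [g1 g2] := G x.
split; rewrite CE.
  rewrite (_ : _ \o _ = (@Cre R \o f) + (@Cre R \o g)); first exact: is_deriveD.
  by apply/funext => y /=; rewrite CE.
rewrite (_ : _ \o _ = (@Cim R \o f) + (@Cim R \o g)); first exact: is_deriveD.
by apply/funext => y /=; rewrite CE.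
Qed.

Lemma cderiveZ (c : C) f f' : cderive f f' -> cderive (fun x => c * f x) (fun x => c * f' x).
Proof.
move=> F x; have [f1 f2] := F x.
split; rewrite CE.
  rewrite (_ : _ \o _ = (Cre c \*: (@Cre R \o f)) - (Cim c \*: (@Cim R \o f))).
    apply: is_deriveB.
  by apply/funext => y /=; rewrite CE.
rewrite (_ : _ \o _ = (Cre c \*: (@Cim R \o f)) + (Cim c \*: (@Cre R \o f))).
  exact: is_deriveD.
by apply/funext => y /=; rewrite CE.
Qed.

Lemma cderive_cexp (k : C) :
  cderive (fun x => cexp (k * rc x)) (fun x => k * cexp (k * rc x)).
Proof.
move=> x.
have de : is_derive x (1 : R) (fun y : R => expR (Cre k * y)) (Cre k * expR (Cre k * x)).
  by have := is_derive_expR_affine (Cre k) 0 x; rewrite subr0; under eq_fun do rewrite subr0.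
have dl : is_derive x (1 : R) (fun y : R => Cim k * y) (Cim k).
  by apply: is_derive_eq; rewrite [_ *: _]mulr1.
have dc : is_derive x (1 : R) (fun y : R => cos (Cim k * y)) (- Cim k * sin (Cim k * x)).
  rewrite mulNr mulrC -mulNr; exact: (@is_derive1_comp R cos _ x _ _ (is_derive_cos _) dl).
have ds : is_derive x (1 : R) (fun y : R => sin (Cim k * y)) (Cim k * cos (Cim k * x)).
  rewrite mulrC; exact: (@is_derive1_comp R sin _ x _ _ (is_derive_sin _) dl).
split.
  have -> : @Cre R \o (fun x => cexp (k * rc x)) =
      (fun y => expR (Cre k * y)) * (fun y => cos (Cim k * y)).
    by apply/funext => y /=; rewrite /cexp !CE !mulr0 subr0 add0r.
  apply: is_derive_eq; rewrite /cexp !CE !mulr0 subr0 add0r /GRing.scale /=; ring.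
have -> : @Cim R \o (fun x => cexp (k * rc x)) =
    (fun y => expR (Cre k * y)) * (fun y => sin (Cim k * y)).
  by apply/funext => y /=; rewrite /cexp !CE !mulr0 subr0 add0r.
apply: is_derive_eq; rewrite /cexp !CE !mulr0 subr0 add0r /GRing.scale /=; ring.
Qed.

(** The mean value theorem is applied to the real and the imaginary part separately, whence the
    factor 2. *)
Lemma cderive_le f f' (M : R) : cderive f f' ->
  (forall s, 0 <= s <= 1 -> Cmod (f' s) <= M) -> Cmod (f 1 - f 0) <= 2 * M.
Proof.
move=> F fM.
have H (p : C -> R) : (forall z, `|p z| <= Cmod z) ->
    (forall x : R, is_derive x (1 : R) (p \o f) (p (f' x))) -> `|p (f 1) - p (f 0)| <= M.
  move=> pz dp.
  have cp : {within `[0, 1], continuous (p \o f)}.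
    apply: continuous_subspaceT; apply: derivable_continuous => x.
    by have [] := dp x.
  have [c c01 E] := MVT ltr01 (fun x _ => dp x) cp.
  rewrite /= subr0 mulr1 in E; rewrite E; apply: (le_trans (pz _)); apply: fM.
  by move: c01; rewrite in_itv/=; lra.
have h1 := H (@Cre R) (@Cmod_re R) (fun x => (F x).1).
have h2 := H (@Cim R) (@Cmod_im R) (fun x => (F x).2).
set z := f 1 - f 0.
have -> : z = rc (Cre z) + Cmk 0 (Cim z) by apply: C_eq; rewrite !CE ?addr0 ?add0r.
apply: (le_trans (CmodD _ _)).
have -> : Cmod (Cmk 0 (Cim z)) = `|Cim z|.
  by rewrite -[LHS]ger0_norm ?Cmod_ge0// -[LHS]sqrtr_sqr Cmod_sqr !CE expr0n add0r sqrtr_sqr.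
by rewrite Cmod_mk !CE mulr2n mulrDl mul1r lerD.
Qed.

Lemma cexp_B1 z : Cmod (cexp z - 1) <= 2 * (Cmod z * expR (Cmod z)).
Proof.
have := cderive_le (M := Cmod z * expR (Cmod z)) (cderive_cexp z).
rewrite (_ : z * rc 1 = z); last by apply: C_eq; rewrite !CE !mulr0 mulr1 ?subr0 ?add0r.
rewrite (_ : z * rc 0 = 0); last by apply: C_eq; rewrite !CE !mulr0 ?subr0 ?add0r.
rewrite cexp0; apply => s s01; rewrite CmodM ler_wpM2l ?Cmod_ge0// Cmod_cexp ler_expR.
rewrite !CE mulr0 subr0; apply: (le_trans (ler_norm _)); rewrite normrM.
have /andP[s0 s1] := s01; rewrite (ger0_norm s0).
by apply: (le_trans (ler_piMr (normr_ge0 _) s1)); exact: Cmod_re.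
Qed.

(** A second-order Taylor bound: [exp (z s) - z s] has derivative [z (exp (z s) - 1)] in [s], to
    which [cexp_B1] applies. *)
Lemma cexp_B1B z : Cmod z <= 1 -> Cmod (cexp z - 1 - z) <= 4 * expR 1 * Cmod z ^+ 2.
Proof.
move=> z1.
have F : cderive (fun x => cexp (z * rc x) + (- z) * rc x)
    (fun x => z * (cexp (z * rc x) - 1)).
  have D : cderive (fun x => rc x) (fun=> 1).
    by move=> x; split => /=; rewrite !CE; [exact: is_derive_id|exact: is_derive_cst].
  apply: cderive_ext (cderiveD (cderive_cexp z) (cderiveZ (- z) D)) _ _ => // x.
  by rewrite mulrBr !mulr1.
have := cderive_le (M := 2 * expR 1 * Cmod z ^+ 2) F.
have e1 : z * rc 1 = z by apply: C_eq; rewrite !CE !mulr0 mulr1 ?subr0 ?add0r.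
have e0 (w : C) : w * rc 0 = 0 by apply: C_eq; rewrite !CE !mulr0 ?subr0 ?add0r.
have e2 : - z * rc 1 = - z by rewrite mulNr e1.
rewrite e1 e2 !e0 cexp0 addr0 addrAC mulrA (_ : 2 * (2 * expR 1) = 4 * expR 1); last by ring.
apply => s /andP[s0 s1]; rewrite CmodM.
have zs : Cmod (z * rc s) <= Cmod z.
  by rewrite CmodM Cmod_mk (ger0_norm s0) ler_piMr ?Cmod_ge0.
rewrite (_ : 2 * expR 1 * Cmod z ^+ 2 = Cmod z * (2 * (Cmod z * expR 1))); last by ring.
rewrite ler_wpM2l ?Cmod_ge0//; apply: (le_trans (cexp_B1 _)); rewrite ler_pM2l//.
apply: ler_pM; rewrite ?Cmod_ge0 ?expR_ge0//.
by rewrite ler_expR; exact: (le_trans zs).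
Qed.

End complex_exponential.

(** * Contractions of a disc depending on a parameter *)

Section fixed_points.
Variable R : realType.
Local Notation C := (Cplx R).

(** [g n = 2 c / 2^n] is the sum of all step bounds from [n] on, so [u - g] is nondecreasing and
    [u + g] bounds it from above; monotone convergence does the rest. *)
Lemma geometric_steps_cvg (u : R ^nat) (c : R) : 0 <= c ->
  (forall n, `|u n.+1 - u n| <= c * 2^-1 ^+ n) -> cvgn u.
Proof.
move=> c0 H; pose g n : R := 2 * c * 2^-1 ^+ n.
have gS n : g n.+1 = c * 2^-1 ^+ n by rewrite /g exprS; field.
have gD n : g n = 2 * g n.+1 by rewrite gS /g mulrA.
have g0 n : 0 <= g n by rewrite /g mulr_ge0 ?exprn_ge0 ?mulr_ge0 ?invr_ge0.
have H' n : `|u n.+1 - u n| <= g n.+1 by rewrite gS.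
have cg : g n @[n --> \oo] --> 0.
  have := @cvg_geometric R (2 * c) 2^-1; apply.
  by rewrite ger0_norm ?invr_ge0// invf_lt1 ?ltr1n.
have ub n : u n <= u 0%N + 2 * c - g n.
  elim: n => [|n IH]; first by rewrite /g expr0 mulr1 addrK.
  have := H' n; rewrite ler_norml => /andP[_]; have := gD n; lra.
have cv : cvgn (fun n => u n - g n).
  apply: nondecreasing_is_cvgn.
    apply/nondecreasing_seqP => n; have := H' n; rewrite ler_norml => /andP[+ _].
    have := gD n; lra.
  exists (u 0%N + 2 * c) => _ [n _ <-]; have := ub n; have := g0 n; lra.
rewrite (_ : u = fun n => (u n - g n) + g n); last by apply/funext => n; rewrite subrK.
by apply: is_cvgD => //; apply/cvg_ex; exists 0.
Qed.

(** Picard iteration from 0: the contraction factor makes the steps at most [r / 2^n]. *)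
Lemma disc_fixed_point (T : C -> C) (r : R) : 0 <= r ->
  (forall z, Cmod z <= r -> Cmod (T z) <= r) ->
  (forall z w, Cmod z <= r -> Cmod w <= r -> Cmod (T z - T w) <= 2^-1 * Cmod (z - w)) ->
  exists2 z, Cmod z <= r & T z = z.
Proof.
move=> r0 Tr TL; pose x n := iter n T 0.
have xr n : Cmod (x n) <= r.
  elim: n => [|n IH]; last exact: Tr.
  by rewrite Cmod0.
have xS n : Cmod (x n.+1 - x n) <= r * 2^-1 ^+ n.
  elim: n => [|n IH]; first by rewrite expr0 mulr1 subr0; exact: xr.
  apply: (le_trans (TL _ _ (xr n.+1) (xr n))); rewrite exprS mulrCA.
  by apply: ler_wpM2l; [rewrite invr_ge0|exact: IH].
have cre : cvgn (@Cre R \o x).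
  apply: (geometric_steps_cvg r0) => n /=; apply: le_trans (xS n).
  by have := Cmod_re (x n.+1 - x n); rewrite !CE.
have cim : cvgn (@Cim R \o x).
  apply: (geometric_steps_cvg r0) => n /=; apply: le_trans (xS n).
  by have := Cmod_im (x n.+1 - x n); rewrite !CE.
pose l : C := Cmk (limn (@Cre R \o x)) (limn (@Cim R \o x)).
have xl (e : R) : 0 < e -> exists n, Cmod (x n - l) < e /\ Cmod (x n.+1 - l) < e.
  move=> e0; have e2 : 0 < e / 2 by rewrite divr_gt0.
  have /cvgrPdistC_lt/(_ _ e2)[N1 _ HN1] := cre.
  have /cvgrPdistC_lt/(_ _ e2)[N2 _ HN2] := cim.
  have K k : (N1 + N2 <= k)%N -> Cmod (x k - l) < e.
    move=> Nk; have h1 := HN1 k (leq_trans (leq_addr _ _) Nk).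
    have h2 := HN2 k (leq_trans (leq_addl _ _) Nk).
    rewrite -ltr_sqr ?nnegrE ?Cmod_ge0 ?ltW// Cmod_sqr !CE.
    move: h1 h2; rewrite /= !ltr_norml => /andP[a1 a2] /andP[b1 b2].
    nra.
  by exists (N1 + N2)%N; split; apply: K => //; exact: leqW.
have small (z : R) : 0 <= z -> (forall e, 0 < e -> z < e) -> z = 0.
  move=> z0 H; apply/eqP; rewrite eq_le z0 andbT leNgt; apply/negP => /H.
  by rewrite ltxx.
have lr : Cmod l <= r.
  rewrite leNgt; apply/negP; rewrite -subr_gt0 => /xl[n [h _]].
  have := CmodD (l - x n) (x n); rewrite subrK -(CmodN (l - x n)) opprB.
  have := xr n; lra.
exists l => //; apply/eqP; rewrite -subr_eq0 -Cmod_eq0; apply/eqP.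
apply: small; first exact: Cmod_ge0.
move=> e e0; have e2 : 0 < e / 2 by rewrite divr_gt0.
have [n [h1 h2]] := xl _ e2.
have := CmodD (T l - T (x n)) (x n.+1 - l); rewrite addrA subrK.
have := TL _ _ lr (xr n); rewrite -(CmodN (l - x n)) opprB.
change (T (x n)) with (x n.+1); lra.
Qed.

(** [|h k - h l|] is at most half of itself plus half of [|k - l|]. The parameter estimate is asked
    for [|k - l| <= 1] because exponentials are controlled over bounded distances, and local
    estimates suffice for continuity. *)
Lemma fixed_curve (S : set C) (F : C -> C -> C) (r : R) : 0 <= r ->
  (forall k z, S k -> Cmod z <= r -> Cmod (F k z) <= r) ->
  (forall k z w, S k -> Cmod z <= r -> Cmod w <= r ->
     Cmod (F k z - F k w) <= 2^-1 * Cmod (z - w)) ->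
  (forall k l z, S k -> S l -> Cmod (k - l) <= 1 -> Cmod z <= r ->
     Cmod (F k z - F l z) <= 2^-1 * Cmod (k - l)) ->
  exists h : C -> C,
    [/\ forall k, S k -> Cmod (h k) <= r, forall k, S k -> F k (h k) = h k &
        forall k l, S k -> S l -> Cmod (k - l) <= 1 -> Cmod (h k - h l) <= Cmod (k - l)].
Proof.
move=> r0 Fr FL Fk.
have H k : exists z, S k -> Cmod z <= r /\ F k z = z.
  have [Sk|nSk] := pselect (S k); last by exists 0.
  have [z zr Fz] := disc_fixed_point r0 (fun z => Fr k z Sk) (fun z w => FL k z w Sk).
  by exists z.
pose h k := proj1_sig (cid (H k)).
have hP k : S k -> Cmod (h k) <= r /\ F k (h k) = h k := proj2_sig (cid (H k)).
exists h; split.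
- by move=> k /hP[].
- by move=> k /hP[].
- move=> k l Sk Sl kl; have [kr kF] := hP k Sk; have [lr lF] := hP l Sl.
  rewrite -{1}kF -{1}lF.
  have := CmodD (F k (h k) - F k (h l)) (F k (h l) - F l (h l)); rewrite addrA subrK.
  have := FL k _ _ Sk kr lr; have := Fk k l _ Sk Sl kl lr; rewrite kF lF; lra.
Qed.

End fixed_points.

(** * Roots close to the negative of the Robin parameter *)

Section modes.
Variable R : realType.
Local Notation C := (Cplx R).
Local Notation rc x := (Cmk x 0 : C).

(** With [c = cos phi] this contains the negatives of the points of a sector tail ([sector_cone]);
    the lower bound on the real part makes exponentials large. *)
Definition cone (c M : R) : set C := [set k | c * Cmod k <= Cre k /\ M < Cmod k].

(* [k] solves the one-dimensional problem on (-a, a) for the eigenfunction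
   [exp (k x) + s exp (- k x)] and the Robin parameter [- kappa] *)
Definition mode_eq (a : R) (s kappa k : C) : Prop :=
  (k - kappa) * cexp (k * rc a) = s * (k + kappa) * cexp (- (k * rc a)).

Definition mode_curve (a c M : R) (s : C) (base : C -> C) (r : R) (k : C -> C) : Prop :=
  forall x, cone c M x ->
    [/\ mode_eq a s x (k x), Cmod (k x - base x) <= r &
        forall y, cone c M y -> Cmod (x - y) <= 1 -> Cmod (k x - k y) <= 2 * Cmod (x - y)].

Lemma CmodBC (x y : C) : Cmod (x - y) = Cmod (y - x).
Proof. by rewrite -CmodN opprB. Qed.

Lemma CmodB_ge (x y : C) : Cmod x - Cmod y <= Cmod (x - y).
Proof. by have := CmodD (x - y) y; rewrite subrK; lra. Qed.

Lemma expR_ge_sqr (y : R) : 0 <= y -> y ^+ 2 / 4 <= expR y.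
Proof.
move=> y0; have -> : expR y = expR (y / 2) ^+ 2.
  by rewrite expr2 -expRD; congr expR; field.
have := @expR_ge1Dx R (y / 2); move: (expR _) => e; nra.
Qed.

(** Multiplication by [exp (k a)] leaves the single exponential [exp (2 k a)], which is large for
    roots near [kappa] and close to -1 for bounded roots when [kappa] is large. *)
Lemma mode_eqP a s kappa k :
  mode_eq a s kappa k <-> (k - kappa) * cexp (2 * k * rc a) = s * (k + kappa).
Proof.
have E : cexp (2 * k * rc a) = cexp (k * rc a) * cexp (k * rc a).
  by rewrite -cexpD; congr cexp; ring.
rewrite E /mode_eq mulrA; split=> [->|H]; last first.
  apply: (mulIf (cexp_neq0 (k * rc a))); rewrite H -[RHS]mulrA.
  by rewrite [cexp (- _) * _]mulrC cexpN mulr1.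
by rewrite -mulrA [cexp (- _) * _]mulrC cexpN mulr1.
Qed.

Section divergent.
Variables (a c : R) (s : C).
Hypotheses (a0 : 0 < a) (c0 : 0 < c) (s1 : Cmod s = 1).

(** [expR y >= y^2 / 4] at [y = 2 a c |x|] beats any multiple of [|x|]; the factor [E = exp (2 a)]
    pays for the shift [z]. *)
Lemma cone_exp_large (delta : R) : 0 < delta -> exists2 M : R, 1 <= M &
  forall x z, cone c M x -> Cmod z <= 1 ->
    [/\ 0 < Cre (x + z), 1 <= delta * Cmod (cexp (2 * (x + z) * rc a)) &
        Cmod (x + z) <= delta * Cmod (cexp (2 * (x + z) * rc a))].
Proof.
move=> d0; pose E := expR (2 * a).
have E0 : 0 < E := expR_gt0 _.
pose q := 2 * E / (a ^+ 2 * c ^+ 2 * delta).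
have q0 : 0 <= q by rewrite divr_ge0 ?mulr_ge0 ?ltW// ?sqr_ge0// exprn_gt0.
(* [|x| > q] gives [2 |x| <= delta |exp (2 (x + z) a)|], and [c |x| > 1] keeps the real part of
   [x + z] positive. *)
exists (1 + q + c^-1); first by rewrite -addrA lerDl addr_ge0// invr_ge0 ltW.
move=> x z [cx Mx] z1.
set X := Cmod x in cx Mx.
have ci0 : 0 < c^-1 by rewrite invr_gt0.
have X1 : 1 <= X by lra.
have cX : 1 < c * X.
  by rewrite -ltr_pdivrMl// mulr1; lra.
have rez : - 1 <= Cre z.
  by have := le_trans (Cmod_re z) z1; rewrite ler_norml => /andP[].
have qX : 2 * E <= X * (a ^+ 2 * c ^+ 2 * delta).
  by rewrite -ler_pdivrMr ?mulr_gt0 ?exprn_gt0// -/q; lra.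
have lower : (a ^+ 2 * c ^+ 2 * X ^+ 2) <= E * Cmod (cexp (2 * (x + z) * rc a)).
  rewrite Cmod_cexp -expRD.
  have y0 : 0 <= 2 * a * c * X by rewrite !mulr_ge0 ?ltW//; lra.
  apply: (@le_trans _ _ (expR (2 * a * c * X))).
    by apply: le_trans (expR_ge_sqr y0); rewrite le_eqVlt; apply/orP; left; apply/eqP; field.
  rewrite ler_expR (_ : 2 = rc 2); last by rewrite natrC.
  rewrite !CE; nra.
have upper : Cmod (x + z) <= 2 * X by have := CmodD x z; rewrite -/X; lra.
move: lower upper; set W := Cmod (cexp _) => lower upper.
have big : 2 * X <= delta * W.
  rewrite -(ler_pM2l E0); apply: (@le_trans _ _ (delta * (a ^+ 2 * c ^+ 2 * X ^+ 2))); last first.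
    by rewrite [X in _ <= X]mulrCA ler_pM2l.
  have := ler_wpM2r (le_trans ler01 X1) qX.
  by rewrite (_ : X * (a ^+ 2 * c ^+ 2 * delta) * X = delta * (a ^+ 2 * c ^+ 2 * X ^+ 2)); [lra|ring].
split; last exact: (le_trans upper).
- by rewrite !CE; lra.
- by lra.
Qed.

(** Put [k = kappa + z] and [w = exp (2 k a)]. Since [k + kappa = 2 k - z], the equation
    [(k - kappa) w = s (k + kappa)] becomes [z = 2 s k / (w + s)]. In the cone the right-hand side
    is exponentially small, hence a contraction of the unit disc. *)
Lemma divergent_mode : exists M, exists2 k : C -> C,
  mode_curve a c M s id 1 k & forall x, cone c M x -> 0 < Cre (k x).
Proof.
have s0 : s != 0 by rewrite -Cmod_eq0 s1 oner_eq0.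
pose w k := cexp (2 * k * rc a).
pose psi k := 2 * s * k / (w k + s).
have E0 : 0 < expR (6 * a) := expR_gt0 _.
(* Chosen so that [psi] has Lipschitz constant [delta (4 + 32 a exp (6 a)) = 1/2]; here [exp (6 a)]
   bounds [exp (2 a |k - l|)] for points at distance at most 3. *)
pose delta : R := (8 + 64 * a * expR (6 * a))^-1.
have q0 : 0 < a * expR (6 * a) by rewrite mulr_gt0.
have d0 : 0 < delta by rewrite invr_gt0; lra.
have dE : delta * (8 + 64 * (a * expR (6 * a))) = 1.
  by rewrite mulrA mulVf// gt_eqF//; lra.
have aed : 0 < delta * (a * expR (6 * a)) by rewrite mulr_gt0.
have d1 : 8 * delta <= 1 by lra.
have [M M1 HM] := cone_exp_large d0.
have C2 : Cmod (2 : C) = 2 by rewrite natrC Cmod_mk ger0_norm.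
have wpos x z : cone c M x -> Cmod z <= 1 -> [/\ 0 < Cmod (w (x + z)),
    Cmod (w (x + z)) <= 2 * Cmod (w (x + z) + s) & w (x + z) + s != 0].
  move=> Sx z1; have [_ h _] := HM x z Sx z1; rewrite -/(w _) in h.
  have W0 : 0 <= Cmod (w (x + z)) by exact: Cmod_ge0.
  have h8 : 8 <= Cmod (w (x + z)) by nra.
  have h2 : Cmod (w (x + z)) <= 2 * Cmod (w (x + z) + s).
    by have := CmodB_ge (w (x + z)) (- s); rewrite opprK CmodN s1; lra.
  split => //; first by lra.
  by rewrite -Cmod_eq0 gt_eqF//; lra.
have psi_le x z : cone c M x -> Cmod z <= 1 -> Cmod (psi (x + z)) <= 1.
  move=> Sx z1; have [_ _ h] := HM x z Sx z1; have [W0 W2 _] := wpos x z Sx z1.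
  rewrite /psi !CmodM CmodV C2 s1 mulr1 ler_pdivrMr; last by lra.
  rewrite -/(w _) in h; nra.
(* Distance 3 covers both uses: two points of the unit disc for one parameter, and one point for two
   parameters at distance at most 1. *)
have psi_lip x y z t : cone c M x -> cone c M y -> Cmod z <= 1 -> Cmod t <= 1 ->
    Cmod ((x + z) - (y + t)) <= 3 ->
    Cmod (psi (x + z) - psi (y + t)) <= 2^-1 * Cmod ((x + z) - (y + t)).
  move=> Sx Sy z1 t1.
  have [_ h1 h2] := HM x z Sx z1; have [W0 W2 Wn] := wpos x z Sx z1.
  have [_ h1' h2'] := HM y t Sy t1; have [W0' W2' Wn'] := wpos y t Sy t1.
  rewrite -!/(w _) in h1 h2 h1' h2'.
  move: h1 h2 W0 W2 Wn h1' h2' W0' W2' Wn'.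
  move: (x + z) (y + t) => {x Sx z z1 y Sy t t1} k l h1 h2 W0 W2 Wn h1' h2' W0' W2' Wn' kl.
  have -> : psi k - psi l = 2 * s * ((k - l) / (w k + s)) +
      2 * s * (l * (w l - w k) / ((w k + s) * (w l + s))).
    by rewrite /psi; field; rewrite Wn Wn'.
  set d := Cmod (k - l) in kl *; have dd0 : 0 <= d := Cmod_ge0 _.
  have dw : Cmod (w l - w k) <= Cmod (w k) * (4 * a * expR (6 * a) * d).
    have -> : w l - w k = w k * (cexp (2 * (l - k) * rc a) - 1).
      by rewrite mulrBr mulr1 -cexpD; congr (cexp _ - _); ring.
    rewrite CmodM ler_pM2l//; apply: (le_trans (cexp_B1 _)).
    have -> : Cmod (2 * (l - k) * rc a) = 2 * a * d.
      by rewrite !CmodM C2 Cmod_mk (gtr0_norm a0) CmodBC mulrAC.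
    have -> : 4 * a * expR (6 * a) * d = 2 * (2 * a * d * expR (6 * a)) by ring.
    rewrite ler_pM2l// ler_wpM2l//; first by rewrite !mulr_ge0// ltW.
    rewrite ler_expR; nra.
  apply: (le_trans (CmodD _ _)).
  rewrite !CmodM !CmodV !CmodM C2 s1 mulr1 -/d.
  have V0 : 0 < Cmod (w k + s) by lra.
  have V0' : 0 < Cmod (w l + s) by lra.
  have p1 : d / Cmod (w k + s) <= 2 * delta * d.
    rewrite ler_pdivrMr//.
    have h : 1 <= 2 * delta * Cmod (w k + s).
      by have := ler_wpM2l (ltW d0) W2; lra.
    by have := ler_wpM2l dd0 h; lra.
  have p2 : Cmod l * Cmod (w l - w k) / (Cmod (w k + s) * Cmod (w l + s)) <=
      16 * (delta * (a * expR (6 * a))) * d.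
    rewrite ler_pdivrMr ?mulr_gt0//.
    apply: (@le_trans _ _ ((delta * Cmod (w l)) * (Cmod (w k) * (4 * a * expR (6 * a) * d)))).
      by apply: ler_pM => //; exact: Cmod_ge0.
    have : Cmod (w l) * Cmod (w k) <= 4 * (Cmod (w k + s) * Cmod (w l + s)) by nra.
    have g0 : 0 <= 4 * (delta * (a * expR (6 * a))) * d by rewrite mulr_ge0//; lra.
    by move=> /(ler_wpM2l g0); lra.
  have : d * (delta * (8 + 64 * (a * expR (6 * a)))) = d by rewrite dE mulr1.
  lra.
have [|||h [h1 h2 h3]] := @fixed_curve R (cone c M) (fun k z => psi (k + z)) 1 ler01.
- by move=> k z; exact: psi_le.
- move=> k z t Sk z1 t1; have E : z - t = (k + z) - (k + t) by ring.
  rewrite [in X in _ <= _ * Cmod X]E; apply: psi_lip => //; rewrite -E.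
  by have := CmodD z (- t); rewrite CmodN; lra.
- move=> k l z Sk Sl kl z1; have E : k - l = (k + z) - (l + z) by ring.
  by rewrite [in X in _ <= _ * Cmod X]E; apply: psi_lip => //; rewrite -E; lra.
exists M, (fun x => x + h x); last first.
  by move=> x Sx; have [] := HM x (h x) Sx (h1 _ Sx).
move=> x Sx; split.
- apply/mode_eqP; have [_ _ Wn] := wpos x (h x) Sx (h1 _ Sx).
  have := h2 x Sx; rewrite /psi -/(w _) => E.
  have := congr1 (fun z => z * (w (x + h x) + s)) E; rewrite /= divfK// => E'.
  have -> : x + h x - x = h x by ring.
  have -> : h x * w (x + h x) = h x * (w (x + h x) + s) - h x * s by ring.
  by rewrite -E'; ring.
- by rewrite addrC addKr; exact: h1.
- move=> y Sy xy; have -> : x + h x - (y + h y) = (x - y) + (h x - h y) by ring.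
  by have := CmodD (x - y) (h x - h y); have := h3 x y Sx Sy xy; lra.
Qed.

End divergent.
End modes.

(** * Bounded roots close to the zeros of cosh *)

Section bounded_modes.
Variable R : realType.
Local Notation C := (Cplx R).
Local Notation rc x := (Cmk x 0 : C).

Lemma cexp_odd_pi (m : nat) : cexp (Cmk 0 ((2 * m%:R + 1) * pi)) = -1 :> C.
Proof.
elim: m => [|m IH].
  by rewrite mulr0 add0r mul1r; apply: C_eq; rewrite /cexp !CE expR0 mul1r ?cospi ?sinpi ?oppr0.
have -> : Cmk 0 ((2 * m.+1%:R + 1) * pi) = Cmk 0 ((2 * m%:R + 1) * pi) + Cmk 0 (pi *+ 2) :> C.
  by apply: C_eq; rewrite !CE ?addr0// -addn1 natrD mulr2n; ring.
rewrite cexpD IH; apply: C_eq; rewrite /cexp !CE expR0 mul1r ?cos2pi ?sin2pi; ring.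
Qed.

Variables (a c : R).
Hypothesis a0 : 0 < a.

(* the m-th zero of cosh (a z) on the upper imaginary axis *)
Definition even_zero (m : nat) : C := Cmk 0 ((m%:R + 2^-1) * (pi / a)).

Let A2 : C := rc (2 * a).
Let A2_0 : A2 != 0. Proof. by rewrite -Cmod_eq0 Cmod_mk normr_eq0 gt_eqF ?mulr_gt0. Qed.
Let A2E : Cmod A2 = 2 * a. Proof. by rewrite Cmod_mk gtr0_norm ?mulr_gt0. Qed.

(** [z - (exp (A z) - 1) / A] is the Newton step for [exp (A z) = 1] with the slope frozen at the
    root 0; its derivative vanishes there, so it contracts strongly nearby. In the condition on
    [rho], [8 e] comes from the Taylor remainder and [4 e^2] from the variation of the slope. *)
Lemma newton_exp_lip (rho : R) (z w : C) : 0 <= rho -> rho <= 2^-1 ->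
  (8 * expR 1 + 4 * expR 1 ^+ 2) * rho <= 4^-1 ->
  2 * a * Cmod z <= rho -> 2 * a * Cmod w <= rho ->
  Cmod ((z - (cexp (A2 * z) - 1) / A2) - (w - (cexp (A2 * w) - 1) / A2)) <=
    4^-1 * Cmod (z - w).
Proof.
move=> rho0 rho2 rho4 zr wr.
set dl := A2 * (z - w).
have dE : Cmod dl = 2 * a * Cmod (z - w) by rewrite /dl CmodM A2E.
have dr : Cmod dl <= 2 * rho.
  rewrite dE; have := CmodD z (- w); rewrite CmodN => h.
  by have := ler_wpM2l (ltW (mulr_gt0 (ltr0Sn R 1) a0)) h; lra.
have d1 : Cmod dl <= 1 by lra.
have -> : (z - (cexp (A2 * z) - 1) / A2) - (w - (cexp (A2 * w) - 1) / A2) =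
    - (((cexp dl - 1 - dl) + (cexp (A2 * w) - 1) * (cexp dl - 1)) / A2).
  have -> : cexp (A2 * z) = cexp (A2 * w) * cexp dl.
    by rewrite -cexpD; congr cexp; rewrite /dl; ring.
  by rewrite /dl; field.
rewrite CmodN CmodM CmodV A2E ler_pdivrMr ?mulr_gt0//.
rewrite -mulrA [Cmod _ * _]mulrC -dE; apply: (le_trans (CmodD _ _)).
have e1 : 0 < expR 1 :> R := expR_gt0 _.
have D0 : 0 <= Cmod dl := Cmod_ge0 _.
have b1 := cexp_B1B d1.
have b2 : Cmod (cexp dl - 1) <= 2 * expR 1 * Cmod dl.
  apply: (le_trans (cexp_B1 _)); rewrite -mulrA ler_pM2l// mulrC ler_wpM2r//.
  by rewrite ler_expR.
have b3 : Cmod (cexp (A2 * w) - 1) <= 2 * expR 1 * rho.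
  apply: (le_trans (cexp_B1 _)); rewrite CmodM A2E.
  rewrite (_ : 2 * expR 1 * rho = 2 * (rho * expR 1)); last by ring.
  rewrite ler_pM2l//; apply: ler_pM => //; first by rewrite !mulr_ge0 ?Cmod_ge0// ltW.
  by rewrite ler_expR; lra.
rewrite CmodM.
have b4 : Cmod (cexp (A2 * w) - 1) * Cmod (cexp dl - 1) <=
    (2 * expR 1 * rho) * (2 * expR 1 * Cmod dl).
  by apply: ler_pM => //; exact: Cmod_ge0.
have b5 : Cmod dl ^+ 2 <= 2 * rho * Cmod dl by rewrite expr2 ler_wpM2r.
have := ler_wpM2r D0 rho4; have := ler_wpM2l (ltW e1) b5; lra.
Qed.

Lemma bounded_mode (m : nat) (r0 : R) : 0 < r0 -> exists M, exists k : C -> C,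
  mode_curve a c M 1 (fun=> even_zero m) r0 k.
Proof.
move=> r00.
set nu := even_zero m.
have e1 : 0 < expR 1 :> R := expR_gt0 _.
pose L : R := 8 * expR 1 + 4 * expR 1 ^+ 2.
have L0 : 8 * expR 1 <= L by rewrite /L lerDl mulr_ge0 ?sqr_ge0.
have e2 : 2 <= expR 1 :> R by have := @expR_ge1Dx R 1; lra.
pose rho : R := 4^-1 / L.
have Lp : 0 < L by lra.
have rho0 : 0 < rho by rewrite divr_gt0.
have rhoL : L * rho = 4^-1 by rewrite /rho mulrCA divff ?mulr1// gt_eqF.
have rho2 : rho <= 2^-1 by nra.
have [r [rp r1 rr ra]] : exists r, [/\ 0 < r, r <= 1, r <= r0 & 2 * a * r <= rho].
  exists (Num.min 1 (Num.min r0 (rho / (2 * a)))); split.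
  - rewrite !lt_min ltr01 r00; apply: divr_gt0 => //; exact: mulr_gt0.
  - by rewrite ge_min lexx.
  - by rewrite !ge_min lexx orbT.
  - rewrite [X in X <= _]mulrC -ler_pdivlMr ?mulr_gt0//; by rewrite !ge_min lexx !orbT.
pose N : R := Cmod nu + 1.
have N1 : 1 <= N by rewrite lerDr Cmod_ge0.
have ai0 : 0 < a^-1 by rewrite invr_gt0.
(* [2 N] gives [|x| <= 2 |x - k|], [16 / a] makes the Lipschitz constant of [G] in [k] at most 1/4,
   and [4 N / (a r)] makes [|G|] at most [r / 2]. *)
pose M : R := 2 * N + 16 / a + 4 * N / (a * r).
have p1 : 0 < 4 * N / (a * r) by rewrite divr_gt0 ?mulr_gt0//; lra.
pose G x k := rc a^-1 * (k / (x - k)).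
pose P z := z - (cexp (A2 * z) - 1) / A2.
pose F x z := P z + G x (nu + z).
have P0 : P 0 = 0 by rewrite /P mulr0 cexp0 subrr mul0r subr0.
have zr z : Cmod z <= r -> 2 * a * Cmod z <= rho.
  by move=> h; apply: le_trans ra; rewrite ler_pM2l ?mulr_gt0.
have P_lip z w : Cmod z <= r -> Cmod w <= r -> Cmod (P z - P w) <= 4^-1 * Cmod (z - w).
  move=> /zr h1 /zr h2; apply: (newton_exp_lip (ltW rho0) rho2) => //.
  by rewrite -/L rhoL.
have nz z : Cmod z <= r -> Cmod (nu + z) <= N.
  by move=> h; have := CmodD nu z; rewrite /N; lra.
have den x k : M < Cmod x -> Cmod k <= N ->
    [/\ Cmod x <= 2 * Cmod (x - k), 0 < Cmod (x - k) & x - k != 0].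
  rewrite /M => Mx kN; have h := CmodB_ge x k.
  have q : 0 < 16 / a by rewrite divr_gt0.
  have h2 : Cmod x <= 2 * Cmod (x - k) by lra.
  have h0 : 0 < Cmod (x - k) by lra.
  by split => //; rewrite -Cmod_eq0 gt_eqF.
have G_le x k : M < Cmod x -> Cmod k <= N -> Cmod (G x k) <= r / 2.
  move=> Mx kN; have [h h0 _] := den x k Mx kN.
  rewrite /G !CmodM CmodV Cmod_mk (gtr0_norm ai0).
  rewrite mulrA ler_pdivrMr// mulrC -ler_pdivlMr// invrK.
  have q : 4 * N <= Cmod x * (a * r).
    rewrite -ler_pdivrMr ?mulr_gt0//; apply: ltW; apply: le_lt_trans Mx.
    by have q : 0 < 16 / a by [rewrite divr_gt0]; rewrite /M; lra.
  have := ler_wpM2r (ltW (mulr_gt0 a0 rp)) h; lra.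
have G_lip x k l : M < Cmod x -> Cmod k <= N -> Cmod l <= N ->
    Cmod (G x k - G x l) <= 4^-1 * Cmod (k - l).
  move=> Mx kN lN; have [h h0 hn] := den x k Mx kN; have [h' h0' hn'] := den x l Mx lN.
  have -> : G x k - G x l = rc a^-1 * (x * (k - l) / ((x - k) * (x - l))).
    by rewrite /G; field; rewrite hn hn'.
  rewrite !CmodM CmodV !CmodM Cmod_mk (gtr0_norm ai0).
  rewrite mulrA ler_pdivrMr ?mulr_gt0//.
  have x16 : 16 * a^-1 <= Cmod x.
    by apply: ltW; apply: le_lt_trans Mx; rewrite /M; lra.
  have D0 : 0 <= Cmod (k - l) := Cmod_ge0 _.
  have X0 : 0 <= Cmod x := Cmod_ge0 _.
  have hh : Cmod x * Cmod x <= (2 * Cmod (x - k)) * (2 * Cmod (x - l)) by exact: ler_pM.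
  have : 16 * a^-1 * Cmod x <= Cmod x * Cmod x by rewrite ler_wpM2r.
  move=> h3; have := ler_wpM2r D0 (le_trans h3 hh); lra.
have G_par x y k : M < Cmod x -> M < Cmod y -> Cmod k <= N ->
    Cmod (G x k - G y k) <= 2^-1 * Cmod (x - y).
  move=> Mx My kN; have [h h0 hn] := den x k Mx kN; have [h' h0' hn'] := den y k My kN.
  have -> : G x k - G y k = rc a^-1 * (k * (y - x) / ((x - k) * (y - k))).
    by rewrite /G; field; rewrite hn hn'.
  rewrite !CmodM CmodV !CmodM Cmod_mk (gtr0_norm ai0) (CmodBC y).
  rewrite mulrA ler_pdivrMr ?mulr_gt0//.
  have q : 0 < 16 / a by rewrite divr_gt0.
  have x2 : N <= Cmod x by move: Mx; rewrite /M; lra.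
  have y16 : 16 * a^-1 <= Cmod y.
    by apply: ltW; apply: le_lt_trans My; rewrite /M; lra.
  have D0 : 0 <= Cmod (x - y) := Cmod_ge0 _.
  have hh : Cmod x * Cmod y <= (2 * Cmod (x - k)) * (2 * Cmod (y - k)).
    by apply: ler_pM => //; exact: Cmod_ge0.
  have h3 : Cmod k * (16 * a^-1) <= Cmod x * Cmod y.
    by apply: ler_pM => //; [exact: Cmod_ge0|exact: ltW|exact: le_trans x2].
  have := ler_wpM2r D0 (le_trans h3 hh).
  have : 0 <= Cmod (x - k) * Cmod (y - k) * Cmod (x - y) by rewrite !mulr_ge0 ?Cmod_ge0.
  by lra.
have [|||h [h1 h2 h3]] := @fixed_curve R (cone c M) F r (ltW rp).
- move=> x z [_ Mx] z1; apply: (le_trans (CmodD _ _)).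
  have := P_lip z 0 z1; rewrite P0 !subr0 Cmod0 => /(_ (ltW rp)).
  have := G_le x _ Mx (nz z z1); lra.
- move=> x z w [_ Mx] z1 w1.
  have -> : F x z - F x w = (P z - P w) + (G x (nu + z) - G x (nu + w)) by rewrite /F; ring.
  apply: (le_trans (CmodD _ _)); have := P_lip z w z1 w1.
  have := G_lip x _ _ Mx (nz z z1) (nz w w1).
  rewrite (_ : nu + z - (nu + w) = z - w); last by ring.
  lra.
- move=> x y z [_ Mx] [_ My] _ z1.
  have -> : F x z - F y z = G x (nu + z) - G y (nu + z) by rewrite /F; ring.
  exact: (G_par x y _ Mx My (nz z z1)).
exists M, (fun x => nu + h x) => x Sx; have [_ Mx] := Sx; split.
- apply/mode_eqP; have [_ _ hn] := den x _ Mx (nz _ (h1 x Sx)).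
  have E : cexp (2 * (nu + h x) * rc a) = - cexp (A2 * h x).
    rewrite -mulN1r -(cexp_odd_pi m) -cexpD; congr cexp.
    have A2' : A2 = 2 * rc a by rewrite natrC; apply: C_eq; rewrite !CE; ring.
    rewrite A2' mulrDr mulrDl; congr (_ + _); last by ring.
    rewrite natrC /nu /even_zero; apply: C_eq; rewrite !CE; first by ring.
    by field; rewrite gt_eqF.
  have := h2 x Sx; rewrite /F /P -addrA => /eqP; rewrite -subr_eq0 addrAC subrr add0r.
  rewrite addrC subr_eq0 /G => /eqP E2.
  have : cexp (A2 * h x) - 1 = 2 * ((nu + h x) / (x - (nu + h x))).
    rewrite -[LHS](divfK A2_0) -E2.
    rewrite mulrAC (_ : rc a^-1 * A2 = 2)//.
    by rewrite natrC; apply: C_eq; rewrite !CE ?mulr0 ?mul0r ?addr0 ?subr0// mulrCA mulVf ?mulr1// gt_eqF.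
  move: hn; rewrite E; set k := nu + h x => hn /eqP; rewrite subr_eq => /eqP ->.
  by rewrite mul1r; field.
- by rewrite addrC addKr; exact: (le_trans (h1 _ Sx)).
- move=> y Sy xy; have -> : nu + h x - (nu + h y) = h x - h y by ring.
  by have := h3 x y Sx Sy xy; have := Cmod_ge0 (x - y); lra.
Qed.

End bounded_modes.

(** * Product eigenfunctions *)

Section product_functions.
Variable R : realType.
Local Notation C := (Cplx R).
Local Notation rc x := (Cmk x 0 : C).

Definition ccont (T : topologicalType) (f : T -> C) : Prop :=
  continuous (@Cre R \o f) /\ continuous (@Cim R \o f).

Lemma ccont_cst (T : topologicalType) (z : C) : ccont (fun _ : T => z).
Proof. by split; exact: cst_continuous. Qed.

Lemma ccontM (T : topologicalType) (f g : T -> C) : ccont f -> ccont g ->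
  ccont (fun x => f x * g x).
Proof.
move=> [f1 f2] [g1 g2]; split => x.
  rewrite (_ : _ \o _ = fun y => Cre (f y) * Cre (g y) - Cim (f y) * Cim (g y)).
    by apply: cvgB; apply: cvgM; [exact: f1|exact: g1|exact: f2|exact: g2].
  by apply/funext => y /=; rewrite CE.
rewrite (_ : _ \o _ = fun y => Cre (f y) * Cim (g y) + Cim (f y) * Cre (g y)).
  by apply: cvgD; apply: cvgM; [exact: f1|exact: g2|exact: f2|exact: g1].
by apply/funext => y /=; rewrite CE.
Qed.

Lemma ccont_prod (T : topologicalType) (I : Type) (s : seq I) (F : I -> T -> C) :
  (forall i, ccont (F i)) -> ccont (fun x => \prod_(i <- s) F i x).
Proof.
move=> H; elim: s => [|i s IH].
  by under eq_fun do rewrite big_nil; exact: ccont_cst.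
by under eq_fun do rewrite big_cons; exact: ccontM.
Qed.

Lemma ccontD (T : topologicalType) (f g : T -> C) : ccont f -> ccont g ->
  ccont (fun x => f x + g x).
Proof.
move=> [f1 f2] [g1 g2]; split => x.
  rewrite (_ : _ \o _ = fun y => Cre (f y) + Cre (g y)).
    by apply: cvgD; [exact: f1|exact: g1].
  by apply/funext => y /=; rewrite CE.
rewrite (_ : _ \o _ = fun y => Cim (f y) + Cim (g y)).
  by apply: cvgD; [exact: f2|exact: g2].
by apply/funext => y /=; rewrite CE.
Qed.

Lemma ccont_sum (T : topologicalType) (I : Type) (s : seq I) (F : I -> T -> C) :
  (forall i, ccont (F i)) -> ccont (fun x => \sum_(i <- s) F i x).
Proof.
move=> H; elim: s => [|i s IH].
  by under eq_fun do rewrite big_nil; exact: ccont_cst.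
by under eq_fun do rewrite big_cons; exact: ccontD.
Qed.

Lemma cderive_ccont (f f' : R -> C) : cderive f f' -> ccont f.
Proof.
move=> F; split; apply: derivable_continuous => x.
  by have [[h _] _] := F x; exact: h.
by have [_ [h _]] := F x; exact: h.
Qed.

Variable n : nat.
Implicit Types (e : 'I_n.+1 -> R -> C).

Definition pfun e (x : 'rV[R]_n.+1) : C := \prod_i e i (x ord0 i).

Definition pupd e (i : 'I_n.+1) (f : R -> C) : 'I_n.+1 -> R -> C :=
  fun j => if j == i then f else e j.

Lemma pupd_eq e i f : pupd e i f i = f. Proof. by rewrite /pupd eqxx. Qed.

Lemma pupd_lift e i f k : pupd e i f (lift i k) = e (lift i k).
Proof. by rewrite /pupd eq_sym (negbTE (neq_lift i k)). Qed.

Lemma pupdK e i : pupd e i (e i) = e.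
Proof. by apply/funext => j; rewrite /pupd; case: eqP => [->|]. Qed.

Lemma pupd_pupd e i f g : pupd (pupd e i f) i g = pupd e i g.
Proof. by apply/funext => j; rewrite /pupd; case: eqP. Qed.

Lemma pfun_ins e i f p :
  pfun (pupd e i f) (rV_ins i p) = f p.1 * \prod_k e (lift i k) (p.2 ord0 k).
Proof.
rewrite /pfun (bigD1_ord i) //= pupd_eq rV_ins_eq; congr (_ * _).
by apply: eq_bigr => k _; rewrite pupd_lift rV_ins_lift.
Qed.

Lemma rV_ins_col' (i : 'I_n.+1) (x : 'rV[R]_n.+1) : rV_ins i (x ord0 i, col' i x) = x.
Proof.
apply/rowP => j; case: (unliftP i j) => [k|] ->; first by rewrite rV_ins_lift !mxE.
by rewrite rV_ins_eq.
Qed.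

Lemma pfunZ e i (c : C) f x : pfun (pupd e i (fun t => c * f t)) x = c * pfun (pupd e i f) x.
Proof. by rewrite -(rV_ins_col' i x) !pfun_ins mulrA. Qed.

Lemma ccont_pfun e : (forall i, ccont (e i)) -> ccont (pfun e).
Proof.
move=> H; apply: ccont_prod => i; have [h1 h2] := H i.
have cc : continuous (fun x : 'rV[R]_n.+1 => x ord0 i) by exact: coord_continuous.
by split => x; [exact: (continuous_comp (cc x) (h1 _))|exact: (continuous_comp (cc x) (h2 _))].
Qed.

(** On a line in direction [i] the product is a constant times [e i], so the one-dimensional
    derivative applies. *)
Lemma pfun_derive e i f' (x : 'rV[R]_n.+1) : cderive (e i) f' ->
  [/\ derivable (@Cre R \o pfun e) x (dir R i), derivable (@Cim R \o pfun e) x (dir R i) &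
      cpartial i (pfun e) x = pfun (pupd e i f') x].
Proof.
move=> De; rewrite -{1 2 3}(pupdK e i) -(rV_ins_col' i x).
set y := col' i x; set t := x ord0 i.
pose c : C := \prod_k e (lift i k) (y ord0 k).
have := cderiveZ c De => /(_ t)[d1 d2].
have E (p : C -> R) : (fun s => (p \o pfun (pupd e i (e i))) (rV_ins i (s, y))) =
    p \o (fun s => c * e i s).
  by apply/funext => s /=; rewrite pfun_ins mulrC.
split.
- by apply: slice_derivable; rewrite E; case: d1.
- by apply: slice_derivable; rewrite E; case: d2.
- rewrite pfun_ins mulrC -/c; apply: C_eq; rewrite /cpartial !CE derive_slice E derive1E.
    by case: d1 => _ ->; rewrite !CE.
  by case: d2 => _ ->; rewrite !CE.
Qed.

Lemma C1_pfun e e' : (forall i, cderive (e i) (e' i)) -> (forall i, ccont (e' i)) ->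
  C1 (pfun e) /\ forall i, cpartial i (pfun e) = pfun (pupd e i (e' i)).
Proof.
move=> De ce'.
have ce i : ccont (e i) := cderive_ccont (De i).
have P i : cpartial i (pfun e) = pfun (pupd e i (e' i)).
  by apply/funext => x; have [] := pfun_derive x (De i).
split => //.
have cp i : ccont (cpartial i (pfun e)).
  by rewrite P; apply: ccont_pfun => j; rewrite /pupd; case: ifP => _.
have [c1 c2] := ccont_pfun ce.
apply/C1P; split; split.
- exact: c1.
- by move=> i x; have [] := pfun_derive x (De i).
- by move=> i; have [h _] := cp i; exact: h.
- exact: c2.
- by move=> i x; have [] := pfun_derive x (De i).
- by move=> i; have [_ h] := cp i; exact: h.
Qed.

(** Twice cosh (k x) for [s = 1], twice sinh (k x) for [s = -1]. *)
Definition cmode (k s : C) (x : R) : C := cexp (k * rc x) + s * cexp (- (k * rc x)).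

Lemma cderive_cmode k s : cderive (cmode k s) (fun x => k * cmode k (- s) x).
Proof.
apply: cderive_ext (cderiveD (cderive_cexp k) (cderiveZ s (cderive_cexp (- k)))) _ _ => x.
  by rewrite mulNr.
by rewrite /cmode (_ : - k * rc x = - (k * rc x)); [ring|rewrite mulNr].
Qed.

Lemma cmodeN k s x : s * s = 1 -> cmode k s (- x) = s * cmode k s x.
Proof.
move=> ss; rewrite /cmode.
have -> : rc (- x) = - rc x by apply: C_eq; rewrite !CE ?oppr0.
by rewrite mulrN opprK mulrDr mulrA ss mul1r addrC.
Qed.

(** [mode_eq] is the boundary condition at [a] rewritten; the one at [- a] follows by parity. *)
Lemma mode_eq_end (a : R) s kappa k : s * s = 1 -> mode_eq a s kappa k ->
  k * cmode k (- s) a = kappa * cmode k s a /\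
  k * cmode k (- s) (- a) = - (kappa * cmode k s (- a)).
Proof.
move=> ss H.
have E : k * cmode k (- s) a = kappa * cmode k s a.
  apply/eqP; rewrite -subr_eq0 /cmode.
  have -> : k * (cexp (k * rc a) + - s * cexp (- (k * rc a))) -
      kappa * (cexp (k * rc a) + s * cexp (- (k * rc a))) =
      (k - kappa) * cexp (k * rc a) - s * (k + kappa) * cexp (- (k * rc a)) by ring.
  by rewrite H subrr.
split => //; rewrite !cmodeN// ?mulrNN// mulNr mulrN; congr (- _).
by rewrite mulrCA E mulrCA.
Qed.

Variable a : 'I_n.+1 -> R.
Hypothesis a0 : forall i, 0 < a i.

Definition mode_fun (k s : 'I_n.+1 -> C) := pfun (fun i => cmode (k i) (s i)).

Lemma mode_fun_robin (kappa : C) (k s : 'I_n.+1 -> C) : (forall i, s i * s i = 1) ->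
  (forall i, mode_eq (a i) (s i) kappa (k i)) ->
  robin_laplacian a (- kappa) (mode_fun k s) (fun x => - (\sum_i k i ^+ 2) * mode_fun k s x).
Proof.
move=> ss H; set u := mode_fun k s.
have cm l t : ccont (cmode l t) := cderive_ccont (cderive_cmode l t).
have cm' l t : ccont (fun x => l * cmode l t x) by apply: ccontM => //; exact: ccont_cst.
pose e i := cmode (k i) (s i).
pose e' i x := k i * cmode (k i) (- s i) x.
have De i : cderive (e i) (e' i) by exact: cderive_cmode.
have [cu Pu] := C1_pfun De (fun i => cm' _ _).
have De' i j : cderive (pupd e i (e' i) j)
    (if j == i then fun x => k i * (k i * e i x) else e' j).
  rewrite /pupd; case: eqP => // _.
  apply: cderive_ext (cderiveZ (k i) (cderive_cmode (k i) (- s i))) _ _ => // x.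
  by rewrite opprK.
have ce' i j : ccont (if j == i then fun x => k i * (k i * e i x) else e' j).
  by case: ifP => _; [apply: ccontM; [exact: ccont_cst|exact: cm']|exact: cm'].
have c2 i := C1_pfun (De' i) (ce' i).
apply: (classical_robin a0) => //.
- by move=> i; rewrite Pu; have [] := c2 i.
- exact: (L2Z (measurable_box a) _ (C1_L2 a cu)).
- move=> x; rewrite mulNr mulr_suml; congr (- _); apply: eq_bigr => i _.
  have [_ Pi] := c2 i; rewrite Pu Pi eqxx pupd_pupd !pfunZ pupdK.
  by rewrite mulrA -expr2.
- move=> i b y; rewrite Pu face_pointE.
  have -> : u = pfun (pupd e i (e i)) by rewrite pupdK.
  rewrite !pfun_ins /=.
  have [E1 E2] := mode_eq_end (ss i) (H i).
  rewrite /e' /e; case: b => /=; rewrite ?E1 ?E2; ring.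
Qed.

End product_functions.

(** * Continuous functions vanishing almost everywhere *)

Section ae_continuous.
Variable R : realType.
Local Notation C := (Cplx R).

Lemma box_nbhs n (a : 'I_n -> R) x : box a x -> nbhs x (box a).
Proof.
move=> xa; have : forall i, nbhs x [set y : 'rV[R]_n | - a i < y ord0 i < a i].
  move=> i; have cc : {for x, continuous (fun y : 'rV[R]_n => y ord0 i)} by exact: coord_continuous.
  have : \forall t \near x ord0 i, t \in `]- a i, a i[.
    by apply: near_in_itvoo; rewrite in_itv; exact: xa.
  move=> /cc h; apply: (@filterS _ (nbhs x) _ _ _ _ h).
  by move=> y /=; rewrite in_itv.
move=> H; exact: (@filter_forall _ _ (fun i (y : 'rV[R]_n) => - a i < y ord0 i < a i) (nbhs x) _ H).
Qed.

(** Where the function is nonzero it stays so on a small cube, and cubes have positive measure. *)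
Lemma ae_zero_ccont n (a : 'I_n -> R) (u : 'rV[R]_n -> C) : ccont u -> ae_zero a u ->
  forall x, box a x -> u x = 0.
Proof.
move=> [cu1 cu2] [N [mN N0 uN]] x xa; apply/eqP; apply/negPn/negP => ux.
have : exists2 p : 'rV[R]_n -> R, continuous p & p x != 0 /\ forall y, u y = 0 -> p y = 0.
  have [r0|r0] := eqVneq (Cre (u x)) 0; last by exists (@Cre R \o u) => //; split => // y /= ->.
  exists (@Cim R \o u) => //; split => [|y /= -> //].
  by apply: contra_neq ux => i0; apply: C_eq; rewrite !CE.
move=> [p cp [px pu]].
have : nbhs x (box a `&` [set y | p y != 0]).
  apply: filterI; first exact: box_nbhs.
  have : nbhs (p x) [set r : R | r != 0] by apply: open_nbhs_nbhs; split => //; exact: open_neq.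
  exact: cp.
move=> /nbhs_ballP[e /= e0 He].
have lr i : x ord0 i - e < x ord0 i + e by rewrite ltrD2l gtrN.
pose Q := rV_cube (fun i => x ord0 i - e) (fun i => x ord0 i + e).
have mQ : measurable Q by exact: measurable_cube.
have Q0 : (0 < lebesgue_rV R n Q)%E by exact: cube_gt0.
have QN : Q `<=` N.
  move=> y Qy; apply: uN => /= H.
  have /He[ya py] : ball x e y.
    split => // i j; rewrite (ord1 i) /ball /= ltr_norml.
    by have := Qy j; lra.
  by move/eqP: py; apply; exact: pu (H ya).
by move: Q0; rewrite ltNge -N0 le_measure ?inE.
Qed.

End ae_continuous.

(** * Eigenvalue curves *)

Section lists.
Variable R : realType.
Local Notation C := (Cplx R).
Variables (n : nat) (a : 'I_n.+1 -> R).

(** Eigenfunctions are root vectors of order one, so independence inside each class of equal [s i]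
    gives the required multiplicities. *)
Lemma eigenvalue_list_of_vectors (alpha : C) m (s : 'I_m -> C) (u : 'I_m -> 'rV[R]_n.+1 -> C) :
  (forall i, robin_laplacian a alpha (u i) (fun x => s i * u i x)) ->
  (forall z (c : 'I_m -> C), ae_zero a (fun x => \sum_(i | s i == z) c i * u i x) ->
     forall i, s i == z -> c i = 0) ->
  eigenvalue_list a alpha s.
Proof.
move=> Au indep; split.
  move=> i; exists (u i) => // u0.
  have := indep (s i) (fun j => (j == i)%:R).
  have -> : (fun x => \sum_(j | s j == s i) (j == i)%:R * u j x) = u i.
    apply/funext => x; rewrite (bigD1 i)//= eqxx mul1r big1 ?addr0//.
    by move=> j /andP[_ /negbTE ->]; rewrite mul0r.
  by move=> /(_ u0 i (eqxx _))/eqP; rewrite eqxx oner_eq0.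
move=> z; exists (fun k => u (enum_val k)).
  move=> k; exists 1%N, (fun=> 0).
    have /eqP zE : s (enum_val k) == z := enum_valP k.
    have := Au (enum_val k); rewrite zE; congr (robin_laplacian a alpha _ _).
    by apply/funext => x; rewrite addr0.
  by apply: nearW => x _.
move=> c c0 k.
have h := enum_valP k.
have := indep z (fun i => c (enum_rank_in h i)); rewrite -[c k](congr1 c (enum_valK_in h k)).
apply; last exact: h.
rewrite (_ : (fun x => _) = fun x => \sum_k c k * u (enum_val k) x)//.
apply/funext => x.
transitivity (\sum_(i in [pred i | s i == z]) c (enum_rank_in h i) * u i x); first by [].
rewrite big_enum_val.
by apply: eq_bigr => l _; rewrite enum_valK_in.
Qed.

End lists.

(** * Continuity and asymptotics in a sector *)

Section sectors.
Variable R : realType.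
Local Notation C := (Cplx R).
Variable (phi : R).
Hypotheses (phi0 : 0 < phi) (phi1 : phi < pi / 2).

Lemma cos_gt0_sector : 0 < cos phi.
Proof. by apply: cos_gt0_pihalf; rewrite phi1 andbT; apply: lt_trans phi0; rewrite oppr_lt0 divr_gt0 ?pi_gt0. Qed.

Lemma sector_cone (M : R) (alpha : C) :
  sector_tail phi M alpha -> cone (cos phi) M (- alpha).
Proof.
move=> [[r [theta [r0 th ->]]] Mz]; split; last by rewrite CmodN.
rewrite opprK; have pi0 := pi_gt0 R.
have -> : Cmod (Cmk (r * cos theta) (r * sin theta)) = r.
  rewrite -[LHS]ger0_norm ?Cmod_ge0// -[LHS]sqrtr_sqr Cmod_sqr !CE.
  by rewrite !exprMn -mulrDr cos2Dsin2 mulr1 sqrtr_sqr gtr0_norm.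
rewrite !CE mulrC ler_pM2l//.
have -> : cos theta = cos `|theta| by case: (ger0P theta) => _; rewrite ?cosN.
by apply: ltW; rewrite ltr_cos ?in_itv /=; move: th (normr_ge0 theta) phi1 phi0 pi0 => /=; lra.
Qed.

Lemma continuous_spectral_sum m (M : R) (k : 'I_m -> C -> C) :
  (forall i x y, cone (cos phi) M x -> cone (cos phi) M y -> Cmod (x - y) <= 1 ->
     Cmod (k i x - k i y) <= 2 * Cmod (x - y)) ->
  {within sector_tail phi M, continuous (fun alpha => - (\sum_i k i (- alpha) ^+ 2))}.
Proof.
move=> kl; apply/subspace_continuousP => x Sx.
have FF : Filter (within (sector_tail phi M) (nbhs x)) by exact: within_filter.
have ck i : k i (- y) @[y --> within (sector_tail phi M) (nbhs x)] --> k i (- x).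
  apply/cvgCP => e e0.
  have e1 : 0 < Num.min 1 (e / 3) by rewrite lt_min ltr01 divr_gt0.
  have /cvgCP/(_ _ e1) : (y : C) @[y --> x] --> x by exact: cvg_id.
  rewrite !near_simpl /within; apply: filterS => y /=.
  rewrite lt_min => /andP[h1 h2] Sy.
  have E : Cmod (- y - - x) = Cmod (y - x) by rewrite -opprD CmodN.
  have := kl i _ _ (sector_cone Sy) (sector_cone Sx); rewrite E => /(_ (ltW h1)); lra.
apply: cvgN; apply: cvg_bigsum => i; rewrite expr2; under eq_fun do rewrite expr2.
exact: cvgM.
Qed.

Lemma sector_asymptotics (J : nat) (M B : R) (lam : C -> C) : (0 < J)%N ->
  (forall alpha, sector_tail phi M alpha ->
     Cmod (lam alpha + J%:R * alpha ^+ 2) <= B * (Cmod alpha + 1)) ->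
  divergent phi lam /\ asymptotic_sq phi (- J%:R) lam.
Proof.
move=> J0 H; have FF := sector_infty_filter phi.
have [j jE] : {j : R | j = J%:R} by exists J%:R.
have j1 : 1 <= j by rewrite jE ler1n.
have CJ : Cmod (J%:R : C) = j by rewrite natrC Cmod_mk ger0_norm ?ler0n.
have E2 z : Cmod (z ^+ 2 : C) = Cmod z ^+ 2 by rewrite expr2 CmodM -expr2.
split.
  apply/cvgryPge => A; exists (`|M| + 1 + 2 * `|B| + `|A|) => // z Tz.
  have [_ Mz] := Tz.
  have := normr_ge0 M; have := normr_ge0 B; have := normr_ge0 A.
  have := ler_norm M; have := ler_norm B; have := ler_norm A => hA hB hM A0 B0 M0.
  have /H : sector_tail phi M z by apply: sector_tailS Tz; lra.
  have := CmodB_ge (J%:R * z ^+ 2) (- lam z).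
  rewrite opprK addrC CmodN CmodM CJ E2 [lam z + _]addrC.
  set X := Cmod z in Mz *; move: Mz; clear -j1 hA hB hM A0 B0 M0.
  move: (Cmod (lam z)) (Cmod _) `|A| `|B| `|M| hA hB hM A0 B0 M0 => L D A' B' M' hA hB hM A0 B0 M0.
  move=> MX h1 h2.
  have : j * X ^+ 2 >= X ^+ 2 by rewrite ler_peMl// sqr_ge0.
  nra.
(* Beyond this bound [|alpha| > 1], so the error is at most [2 |B| |alpha|], which is below
   [e |alpha|^2]. *)
apply/cvgCP => e e0; exists (`|M| + 1 + 2 * `|B| / e) => // z Tz.
have [_ Mz] := Tz.
have := normr_ge0 M; have := normr_ge0 B; have := ler_norm M; have := ler_norm B => hB hM B0 M0.
have q : 0 <= 2 * `|B| / e by rewrite divr_ge0 ?mulr_ge0// ltW.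
have Sz : sector_tail phi M z by apply: sector_tailS Tz; lra.
have X1 : 1 < Cmod z by lra.
have z0 : z != 0 by rewrite -Cmod_eq0 gt_eqF//; lra.
have J0' : (J%:R : C) != 0 by rewrite -Cmod_eq0 CJ gt_eqF//; lra.
have -> : lam z / (- J%:R * z ^+ 2) - 1 = - ((lam z + J%:R * z ^+ 2) / (J%:R * z ^+ 2)).
  by field; rewrite z0 J0'.
rewrite CmodN CmodM CmodV CmodM CJ E2 ltr_pdivrMr; last by apply: mulr_gt0; [lra|apply: exprn_gt0; lra].
apply: (le_lt_trans (H _ Sz)).
have h : 2 * `|B| < e * Cmod z by rewrite [X in _ < X]mulrC -ltr_pdivrMr//; lra.
move: X1 h hB B0; set X := Cmod z; move: `|B| => B'; clear -j1 e0 => X1 h hB B0.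
have h2 : e * X * X <= e * (j * X ^+ 2).
  by rewrite -mulrA ler_pM2l// -expr2 ler_peMl ?sqr_ge0.
nra.
Qed.

End sectors.

(** * Spectral curves attached to a choice of modes *)

Section curves.
Variable R : realType.
Local Notation C := (Cplx R).
Local Notation rc x := (Cmk x 0 : C).

Definition parity (b : bool) : C := if b then 1 else -1.

(* [inl b] stands for the exponentially localized mode of parity [b], [inr m]
   for the m-th even mode which converges to a Dirichlet mode *)
Definition mode_sign (ch : bool + nat) : C := if ch is inl b then parity b else 1.

Definition mode_base (a : R) (ch : bool + nat) (x : C) : C :=
  if ch is inr m then even_zero a m else x.

(** The points [even_zero a m] are [pi / a] apart; a quarter of that keeps the discs disjoint and
    above the real axis, as [even_zero_gap] requires. For a localized root a bounded distance to
    [- alpha] is enough. *)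
Definition mode_radius (a : R) (ch : bool + nat) : R := if ch is inl _ then 1 else pi / a / 4.

Lemma parity_sqr b : parity b * parity b = 1.
Proof. by case: b; rewrite /parity ?mulr1// mulrNN mulr1. Qed.

Lemma Cmod_parity b : Cmod (parity b) = 1.
Proof. by case: b; rewrite /parity ?CmodN Cmod1. Qed.

Lemma mode_sign_sqr ch : mode_sign ch * mode_sign ch = 1.
Proof. by case: ch => [b|m] /=; [exact: parity_sqr|rewrite mulr1]. Qed.

Lemma mode_exists (a c : R) (ch : bool + nat) : 0 < a -> 0 < c -> exists M, exists k : C -> C,
  mode_curve a c M (mode_sign ch) (mode_base a ch) (mode_radius a ch) k /\
  forall b, ch = inl b -> forall x, cone c M x -> 0 < Cre (k x).
Proof.
move=> a0 c0; case: ch => [b|m].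
  have [M [k Hk pk]] := divergent_mode a0 c0 (Cmod_parity b).
  by exists M, k.
have r0 : 0 < pi / a / 4 by rewrite !divr_gt0 ?pi_gt0.
by have [M [k Hk]] := @bounded_mode R a c a0 m _ r0; exists M, k.
Qed.

(** [|exp (k x)| > |exp (- k x)|], so the two terms cannot cancel. *)
Lemma cmode_neq0 (k s : C) (x : R) : Cmod s = 1 -> 0 < Cre k -> 0 < x -> cmode k s x != 0.
Proof.
move=> s1 k0 x0; rewrite -Cmod_eq0 gt_eqF//.
have := CmodB_ge (cexp (k * rc x)) (- (s * cexp (- (k * rc x)))).
rewrite opprK CmodN CmodM s1 mul1r !Cmod_cexp => h; apply: lt_le_trans h.
by rewrite subr_gt0 ltr_expR !CE !mulr0 !subr0; have := mulr_gt0 k0 x0; lra.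
Qed.

Lemma cmode0_neq0 (k : C) : cmode k 1 0 != 0.
Proof.
have -> : cmode k 1 0 = rc 2.
  have e : k * rc 0 = 0 by apply: C_eq; rewrite !CE !mulr0 ?subr0 ?addr0.
  by rewrite /cmode e oppr0 cexp0 mul1r; apply: C_eq; rewrite !CE ?addr0.
by rewrite -Cmod_eq0 Cmod_mk normr_eq0.
Qed.

(** An eigenvalue determines [k] only up to sign. The absolute values of the imaginary parts agree,
    and they lie in disjoint positive intervals around [(m + 1/2) pi / a]. *)
Lemma even_zero_gap (a : R) (m m' : nat) (k k' : C) : 0 < a ->
  Cmod (k - even_zero a m) <= pi / a / 4 -> Cmod (k' - even_zero a m') <= pi / a / 4 ->
  k ^+ 2 = k' ^+ 2 -> m = m'.
Proof.
move=> a0; set g := pi / a; have g0 : 0 < g by rewrite divr_gt0 ?pi_gt0.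
have I (l : C) (p : nat) : Cmod (l - even_zero a p) <= g / 4 ->
    `|Cim l - (p%:R + 2^-1) * g| <= g / 4.
  by move=> h; apply: le_trans h; have := Cmod_im (l - even_zero a p); rewrite /even_zero !CE.
move=> /I + /I; have gap (p q : nat) : (p < q)%N -> p%:R * g + g <= q%:R * g.
  by move=> pq; rewrite -[X in _ + X <= _]mul1r -mulrDl ler_pM2r// natr1 ler_nat.
have p0 : 0 <= m%:R * g by rewrite mulr_ge0 ?ler0n ?ltW.
have p0' : 0 <= m'%:R * g by rewrite mulr_ge0 ?ler0n ?ltW.
move: (gap m m') (gap m' m) p0 p0'; rewrite !mulrDl.
move: (m%:R * g) (m'%:R * g) => p q pq qp p0 p0' h h' /eqP kk.
have e : `|Cim k| = `|Cim k'|.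
  by move: kk; rewrite eqf_sqr => /orP[/eqP ->//|/eqP ->]; rewrite CimN normrN.
move: e h h' {kk}; move: (Cim k) (Cim k') => x y.
rewrite !ler_norml => e /andP[h1 h2] /andP[h3 h4].
have x0 : 0 <= x by lra.
have y0 : 0 <= y by lra.
rewrite (ger0_norm x0) (ger0_norm y0) in e.
by case: (ltngtP m m') => // [/pq|/qp] ?; exfalso; lra.
Qed.

Section rectangle.
Variables (n : nat) (a : 'I_n.+1 -> R) (phi : R).
Hypotheses (a0 : forall i, 0 < a i) (phi0 : 0 < phi) (phi1 : phi < pi / 2).
Local Notation c := (cos phi).
Local Notation choices := ('I_n.+1 -> bool + nat).

Let c0 : 0 < c. Proof. exact: cos_gt0_sector. Qed.

Definition mode_bound i ch : R := proj1_sig (cid (@mode_exists (a i) c ch (a0 i) c0)).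

Definition mode_root i ch : C -> C :=
  proj1_sig (cid (proj2_sig (cid (@mode_exists (a i) c ch (a0 i) c0)))).

Lemma mode_rootP i ch :
  mode_curve (a i) c (mode_bound i ch) (mode_sign ch) (mode_base (a i) ch)
    (mode_radius (a i) ch) (mode_root i ch) /\
  forall b, ch = inl b -> forall x, cone c (mode_bound i ch) x -> 0 < Cre (mode_root i ch x).
Proof. exact: (proj2_sig (cid (proj2_sig (cid (@mode_exists (a i) c ch (a0 i) c0))))). Qed.

Definition total_bound (f : choices) : R := \sum_i `|mode_bound i (f i)|.

Lemma coneS (M N : R) x : M <= N -> cone c N x -> cone c M x.
Proof. by move=> MN [h1 h2]; split => //; exact: le_lt_trans h2. Qed.

Lemma mode_bound_le f i : mode_bound i (f i) <= total_bound f.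
Proof.
apply: (le_trans (ler_norm _)).
by rewrite /total_bound (bigD1 i)//= lerDl sumr_ge0.
Qed.

Definition spectral_curve (f : choices) (alpha : C) : C := - (\sum_i mode_root i (f i) (- alpha) ^+ 2).

Definition spectral_fun (f : choices) (alpha : C) : 'rV[R]_n.+1 -> C :=
  mode_fun (fun i => mode_root i (f i) (- alpha)) (fun i => mode_sign (f i)).

Lemma curve_robin f M alpha : total_bound f <= M -> sector_tail phi M alpha ->
  robin_laplacian a alpha (spectral_fun f alpha) (fun x => spectral_curve f alpha * spectral_fun f alpha x).
Proof.
move=> fM /(sector_cone phi0 phi1) Sx; rewrite -[X in robin_laplacian a X](opprK alpha).
apply: (mode_fun_robin a0) => i; first exact: mode_sign_sqr.
have [H _] := mode_rootP i (f i); have [] // := H (- alpha).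
by apply: coneS Sx; exact: (le_trans (mode_bound_le f i)).
Qed.

Lemma curve_continuous f M : total_bound f <= M ->
  {within sector_tail phi M, continuous (spectral_curve f)}.
Proof.
move=> fM; apply: (@continuous_spectral_sum R phi phi0 phi1 n.+1 M (fun i => mode_root i (f i))).
move=> i x y Sx Sy xy.
have [H _] := mode_rootP i (f i).
have cS z : cone c M z -> cone c (mode_bound i (f i)) z.
  exact: (coneS (le_trans (mode_bound_le f i) fM)).
by have [_ _] := H x (cS _ Sx); apply => //; exact: cS.
Qed.

(** For a localized root, [k^2 - alpha^2 = (k + alpha) (k - alpha)] with bounded first factor; a
    bounded root contributes a bounded term. The total error is linear in [|alpha|]. *)
Lemma curve_asymptotics f (J : nat) : (0 < J)%N ->
  (\sum_i (if f i is inl _ then 1 else 0) = J)%N ->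
  divergent phi (spectral_curve f) /\ asymptotic_sq phi (- J%:R) (spectral_curve f).
Proof.
move=> J0 fJ.
pose B i : R := if f i is inr m then (Cmod (even_zero (a i) m) + pi / a i / 4) ^+ 2 else 2.
apply: (sector_asymptotics (M := total_bound f) (B := \sum_i B i) J0).
move=> alpha /(sector_cone phi0 phi1); rewrite -(CmodN alpha) -[alpha ^+ 2]sqrrN.
move: (- alpha) (opprK alpha) => x xE Sx; rewrite /spectral_curve -xE opprK.
have -> : J%:R = \sum_i (if f i is inl _ then 1 else 0) :> C.
  by rewrite -fJ natr_sum; apply: eq_bigr => i _; case: (f i).
rewrite mulr_suml -sumrN -big_split /= mulr_suml.
have T (s : seq 'I_n.+1) (F : 'I_n.+1 -> C) (G : 'I_n.+1 -> R) :
    (forall i, Cmod (F i) <= G i) -> Cmod (\sum_(i <- s) F i) <= \sum_(i <- s) G i.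
  move=> H; elim: s => [|i s IH]; first by rewrite !big_nil Cmod0.
  by rewrite !big_cons; apply: (le_trans (CmodD _ _)); rewrite lerD.
apply: T => i; have [H _] := mode_rootP i (f i).
have {H} [_ h _] := H x (coneS (mode_bound_le f i) Sx).
have X0 : 0 <= Cmod x := Cmod_ge0 _.
rewrite /B; move: h; set k := mode_root i (f i) x; case: (f i) => [b|m] /= h.
  have -> : - k ^+ 2 + 1 * x ^+ 2 = - ((k - x) * (k + x)) by ring.
  rewrite CmodN CmodM.
  have : Cmod (k + x) <= 1 + 2 * Cmod x.
    have -> : k + x = (k - x) + (x + x) by ring.
    by have := CmodD (k - x) (x + x); have := CmodD x x; lra.
  move=> h2; have : Cmod (k - x) * Cmod (k + x) <= 1 * (1 + 2 * Cmod x).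
    by apply: ler_pM => //; exact: Cmod_ge0.
  lra.
rewrite mul0r addr0 CmodN expr2 CmodM.
have kk : Cmod k <= Cmod (even_zero (a i) m) + pi / a i / 4.
  by have := CmodD (k - even_zero (a i) m) (even_zero (a i) m); rewrite subrK; lra.
apply: (@le_trans _ _ ((Cmod (even_zero (a i) m) + pi / a i / 4) ^+ 2)).
  by rewrite expr2; apply: ler_pM => //; exact: Cmod_ge0.
by rewrite ler_peMr ?sqr_ge0//; lra.
Qed.

Lemma curve_fun_ccont f alpha : ccont (spectral_fun f alpha).
Proof. by apply: ccont_pfun => i; exact: (cderive_ccont (cderive_cmode _ _)). Qed.

Lemma half_mode_neq0 f M alpha i b : total_bound f <= M -> sector_tail phi M alpha ->
  f i = inl b -> cmode (mode_root i (f i) (- alpha)) (parity b) (a i / 2) != 0.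
Proof.
move=> fM /(sector_cone phi0 phi1) Sx fi.
apply: cmode_neq0; [exact: Cmod_parity| |by rewrite divr_gt0].
have [_ H] := mode_rootP i (f i); apply: (H b) => //.
by apply: coneS Sx; exact: (le_trans (mode_bound_le f i)).
Qed.

Lemma curve_fun_neq0 f M alpha : total_bound f <= M -> sector_tail phi M alpha ->
  exists2 x, box a x & spectral_fun f alpha x != 0.
Proof.
(* Odd modes vanish at 0, hence [a i / 2] in the localized coordinates; the bounded modes are even
   and have the value 2 at 0. *)
move=> fM S; exists (\row_i (if f i is inl _ then a i / 2 else 0)).
  by move=> i; rewrite mxE; have := a0 i; case: (f i) => _; lra.
rewrite /spectral_fun /mode_fun /pfun; apply/prodf_neq0 => i _; rewrite mxE.
have := @half_mode_neq0 f M alpha i; case: (f i) => [b|m] H.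
  exact: (H b).
exact: cmode0_neq0.
Qed.

End rectangle.
End curves.

(** * Existence and independence of the curves *)

Section existence.
Variable R : realType.
Local Notation C := (Cplx R).
Variables (n : nat) (a : 'I_n.+1 -> R) (phi : R).
Hypotheses (a0 : forall i, 0 < a i) (phi0 : 0 < phi) (phi1 : phi < pi / 2).
Local Notation choices := ('I_n.+1 -> bool + nat).
Local Notation curve := (@spectral_curve R n a phi a0 phi0 phi1).
Local Notation curve_fun := (@spectral_fun R n a phi a0 phi0 phi1).
Local Notation total_bound := (@total_bound R n a phi a0 phi0 phi1).

(** The free index [m] sits in the last coordinate, which is not localized as long as [J <= n]. *)
Let localized_choice (J m : nat) : choices :=
  fun i => if (i < J)%N then inl true else inr (if i == ord_max then m else 0%N).

(** The two sums differ in the last coordinate alone, so the squares of its bounded roots agree and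
    [even_zero_gap] applies. *)
Let curve_inj J m m' M alpha : (J <= n)%N ->
  total_bound (localized_choice J m) <= M -> total_bound (localized_choice J m') <= M ->
  sector_tail phi M alpha ->
  curve (localized_choice J m) alpha = curve (localized_choice J m') alpha -> m = m'.
Proof.
move=> Jn h h' S; rewrite /spectral_curve => /oppr_inj.
rewrite [LHS](bigD1 ord_max)//= [RHS](bigD1 ord_max)//=.
have -> : \sum_(i < n.+1 | i != ord_max) mode_root a0 phi0 phi1 i (localized_choice J m i) (- alpha) ^+ 2 =
    \sum_(i < n.+1 | i != ord_max) mode_root a0 phi0 phi1 i (localized_choice J m' i) (- alpha) ^+ 2.
  by apply: eq_bigr => i /negbTE ni; rewrite /localized_choice ni.
move=> /addIr.
have chE p : localized_choice J p ord_max = inr p.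
  by rewrite /localized_choice /= ltnNge Jn eqxx.
have near p : total_bound (localized_choice J p) <= M ->
    Cmod (mode_root a0 phi0 phi1 ord_max (localized_choice J p ord_max) (- alpha) -
      even_zero (a ord_max) p) <= pi / a ord_max / 4.
  move=> hp; have [H _] := mode_rootP a0 phi0 phi1 ord_max (localized_choice J p ord_max).
  have [|_ + _] := H (- alpha); last by rewrite chE.
  apply: coneS (sector_cone phi0 phi1 S).
  exact: (le_trans (mode_bound_le a0 phi0 phi1 (localized_choice J p) ord_max)).
exact: (even_zero_gap (a0 ord_max) (near _ h) (near _ h')).
Qed.

Lemma infinitely_many_curves (J : nat) : (0 < J)%N -> (J <= n)%N ->
  exists lambda : nat -> C -> C,
    (forall N : nat, eigencurves a phi (fun i : 'I_N => lambda i)) /\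
    (forall k : nat, divergent phi (lambda k) /\ asymptotic_sq phi (- J%:R) (lambda k)).
Proof.
move=> J0 Jn; exists (fun m => curve (localized_choice J m)); split; last first.
  move=> m; apply: (curve_asymptotics a0 phi0 phi1 J0).
  transitivity (\sum_(i < n.+1 | (i < J)%N) 1)%N.
    by rewrite [RHS]big_mkcond; apply: eq_bigr => i _; rewrite /localized_choice; case: ifP.
  by rewrite -(big_ord_widen n.+1 (fun=> 1%N)) ?sum1_card ?card_ord// ltnW.
(* Each finite family of curves gets its own threshold, which may grow with [N]. *)
move=> N; pose M := \sum_(m < N) total_bound (localized_choice J m).
have tM (m : 'I_N) : total_bound (localized_choice J m) <= M.
  rewrite /M (bigD1 m)//= lerDl sumr_ge0// => p _.
  by apply: sumr_ge0 => i _.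
exists M; split; last by move=> m; exact: (curve_continuous (tM m)).
move=> alpha S.
apply: (@eigenvalue_list_of_vectors R n a alpha N _
  (fun m : 'I_N => curve_fun (localized_choice J m) alpha)).
  by move=> m; exact: (curve_robin (tM m) S).
move=> z c c0 m zm.
(* The values are pairwise different, so each eigenvalue class is a single curve and independence
   means that its eigenfunction is not null. *)
have uniq_m (p : 'I_N) : (curve (localized_choice J p) alpha == z) = (p == m).
  apply/eqP/eqP => [pz|->]; last exact/eqP.
  by apply/val_inj; apply: (curve_inj Jn (tM p) (tM m) S); rewrite pz; exact/esym/eqP.
have [x xa ux] := curve_fun_neq0 (tM m) S.
have := ae_zero_ccont _ c0 xa; rewrite (eq_bigl _ _ uniq_m) big_pred1_eq => H.
apply/eqP; have /eqP : c m * curve_fun (localized_choice J m) alpha x = 0.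
  apply: H; under eq_fun do rewrite (eq_bigl _ _ uniq_m) big_pred1_eq.
  by apply: ccontM; [exact: ccont_cst|exact: curve_fun_ccont].
by rewrite mulf_eq0 (negbTE ux) orbF.
Qed.

Let corner_choice (e : {ffun 'I_n.+1 -> bool}) : choices := fun i => inl (e i).

Lemma card_corners : #|{ffun 'I_n.+1 -> bool}| = (2 ^ n.+1)%N.
Proof. by rewrite card_ffun card_bool card_ord. Qed.

(* the factor by which a mode of parity [b] changes from the point [a / 2] to
   [a / 2] ([e = true]) or [- a / 2] ([e = false]) *)
Let character (b e : bool) : C := if e then 1 else parity R b.

Lemma character_sum (b b' : bool) :
  \sum_(e : bool) character b e * character b' e = if b == b' then 2 else 0.
Proof. by rewrite big_bool /character /parity; case: b b' => -[] /=; ring. Qed.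

(** The values at the points with coordinates [a i / 2] or [- a i / 2] form the character table of
    [{1, -1}^d], up to the nonzero factors [E e]; orthogonality of characters isolates each
    coefficient. Several sign patterns may share an eigenvalue, so distinct values cannot be relied
    on here. *)
Lemma corner_independent M alpha (c : {ffun 'I_n.+1 -> bool} -> C) :
  (forall e, total_bound (corner_choice e) <= M) -> sector_tail phi M alpha ->
  ae_zero a (fun x => \sum_e c e * curve_fun (corner_choice e) alpha x) ->
  forall e, c e = 0.
Proof.
move=> tM S c0 t.
have u0 : forall x, box a x -> \sum_e c e * curve_fun (corner_choice e) alpha x = 0.
  apply: ae_zero_ccont c0; apply: ccont_sum => e.
  by apply: ccontM; [exact: ccont_cst|exact: curve_fun_ccont].
pose E (e : {ffun 'I_n.+1 -> bool}) : C := \prod_i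
  cmode (mode_root a0 phi0 phi1 i (inl (e i)) (- alpha)) (parity R (e i)) (a i / 2).
have E0 e : E e != 0.
  by apply/prodf_neq0 => i _; exact: (@half_mode_neq0 R n a phi a0 phi0 phi1 (corner_choice e) M).
pose pt (e : {ffun 'I_n.+1 -> bool}) : 'rV[R]_n.+1 := \row_i (if e i then a i / 2 else - (a i / 2)).
have pta e : box a (pt e).
  by move=> i; rewrite mxE; have := a0 i; case: (e i); lra.
have uE e p : curve_fun (corner_choice e) alpha (pt p) = (\prod_i character (e i) (p i)) * E e.
  rewrite /E -big_split; apply: eq_bigr => i _; rewrite mxE /= /character.
  by case: (p i); [rewrite mul1r|rewrite cmodeN//; exact: parity_sqr].
(* The relations at all these points are paired with the character of [t]. *)
have : \sum_(p : {ffun 'I_n.+1 -> bool}) (\prod_i character (t i) (p i)) *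
    (\sum_e c e * curve_fun (corner_choice e) alpha (pt p)) = 0.
  by rewrite big1// => p _; rewrite u0 ?mulr0.
under eq_bigr do rewrite mulr_sumr.
rewrite exchange_big /= (bigD1 t)//= [X in _ + X]big1 ?addr0; last first.
  move=> e et.
  have -> : \sum_(p : {ffun 'I_n.+1 -> bool}) (\prod_i character (t i) (p i)) *
       (c e * curve_fun (corner_choice e) alpha (pt p)) =
      (\prod_i \sum_(b : bool) character (t i) b * character (e i) b) * (c e * E e).
    rewrite bigA_distr_bigA mulr_suml; apply: eq_bigr => p _.
    by rewrite uE big_split /=; ring.
  have [i ti] : exists i, t i != e i.
    apply/existsP; apply: contraR et => /existsPn H.
    by apply/eqP/ffunP => i; have := H i; rewrite negbK => /eqP.
  by rewrite (bigD1 i)//= character_sum (negbTE ti) !mul0r.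
have -> : \sum_(p : {ffun 'I_n.+1 -> bool}) (\prod_i character (t i) (p i)) *
     (c t * curve_fun (corner_choice t) alpha (pt p)) =
    (\prod_i \sum_(b : bool) character (t i) b * character (t i) b) * (c t * E t).
  rewrite bigA_distr_bigA mulr_suml; apply: eq_bigr => p _.
  by rewrite uE big_split /=; ring.
move=> /eqP; rewrite !mulf_eq0 (negbTE (E0 t)) orbF => /orP[|/eqP//].
move=> /prodf_eq0[i _]; rewrite character_sum eqxx natrC -Cmod_eq0 Cmod_mk.
by rewrite normr_eq0 pnatr_eq0.
Qed.

Lemma corner_curves : exists lambda : 'I_(2 ^ n.+1) -> C -> C,
  eigencurves a phi lambda /\ (forall i, asymptotic_sq phi (- n.+1%:R) (lambda i)).
Proof.
pose en (l : 'I_(2 ^ n.+1)) : {ffun 'I_n.+1 -> bool} :=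
  enum_val (cast_ord (esym card_corners) l).
pose de (e : {ffun 'I_n.+1 -> bool}) : 'I_(2 ^ n.+1) := cast_ord card_corners (enum_rank e).
have enK : cancel en de by move=> l; rewrite /en /de enum_valK cast_ordKV.
have deK : cancel de en by move=> e; rewrite /en /de cast_ordK enum_rankK.
exists (fun l => curve (corner_choice (en l))); split; last first.
  move=> l; apply: (proj2 (curve_asymptotics a0 phi0 phi1 _ _)) => //.
  by rewrite sum1_card card_ord.
pose M := \sum_e total_bound (corner_choice e).
have tM e : total_bound (corner_choice e) <= M.
  rewrite /M (bigD1 e)//= lerDl sumr_ge0// => p _.
  by apply: sumr_ge0 => i _.
exists M; split; last by move=> l; exact: (curve_continuous (tM _)).
move=> alpha S.
apply: (@eigenvalue_list_of_vectors R n a alpha _ _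
  (fun l => curve_fun (corner_choice (en l)) alpha)).
  by move=> l; exact: (curve_robin (tM _) S).
move=> z c c0 l zl.
(* Coefficients of curves with a value other than [z] are set to 0, so that independence of the
   whole family applies to one eigenvalue class. *)
pose c' e : C := if curve (corner_choice e) alpha == z then c (de e) else 0.
have := @corner_independent M alpha c' tM S _ (en l); rewrite /c' enK zl; apply.
move: c0; congr (ae_zero a _); apply/funext => x.
rewrite big_mkcond (reindex de)/=; last first.
  by exists en.
apply: eq_bigr => e _; rewrite /c' deK; case: ifP => //.
by rewrite mul0r.
Qed.

End existence.

Theorem theorem9p3 (R : realType) (d : nat) (a : 'I_d -> R) (phi : R)
    (hd : (2 <= d)%N) (ha : forall i, 0 < a i)
    (hphi0 : 0 < phi) (hphi1 : phi < pi / 2) :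
  (forall j : nat, (1 <= j)%N -> (j <= d - 1)%N ->
     exists lambda : nat -> Cplx R -> Cplx R,
       (forall n : nat, eigencurves a phi (fun i : 'I_n => lambda i)) /\
       (forall k : nat, divergent phi (lambda k) /\
                        asymptotic_sq phi (- j%:R) (lambda k))) /\
  ((exists lambda : 'I_(2 ^ d) -> Cplx R -> Cplx R,
      eigencurves a phi lambda /\
      (forall i, asymptotic_sq phi (- d%:R) (lambda i))) /\
   (forall (m : nat) (mu : 'I_m -> Cplx R -> Cplx R),
      eigencurves a phi mu ->
      (forall i, asymptotic_sq phi (- d%:R) (mu i)) -> (m <= 2 ^ d)%N)).
Proof.
case: d a hd ha => [//|n] a _ a0; split.
  move=> j j1; rewrite subn1 => jn; exact: (infinitely_many_curves a0 hphi0 hphi1 j1 jn).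
split; first exact: (corner_curves a0 hphi0 hphi1).
move=> m mu ev asy; exact: (eigencurves_count a0 hphi0 ev asy).
Qed.
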